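(* Let $\mathcal P_t=e^{t\mathcal L}$ be a primitive quantum Markov semigroup satisfying the $\sigma$-GNS detailed balance condition for its full-rank invariant state $\sigma$. Suppose that for some $p\in(1,2]$ the $p$-Beckner inequality $$\alpha_p\,\mathcal F_{p,\sigma}(\rho)\le p^{-2}\,\mathcal E_{p,\mathcal L}(\Gamma_\sigma^{-1}(\rho))\qquad\text{for all }\rho\in\mathcal D_+(\mathcal H)$$ holds with constant $\alpha_p>0$. Then for every constant $c\ge1/\alpha_p$ the transport cost inequality $$W_{2,p}(\rho,\sigma)\le\sqrt{c\,\mathcal F_{p,\sigma}(\rho)}\qquad\text{for all }\rho\in\mathcal D(\mathcal H)$$ holds.
   Context: $\mathcal H$ is a Hilbert space of finite dimension $d$; $\mathcal D(\mathcal H)$, $\mathcal D_+(\mathcal H)$ are the density operators and the full-rank ones; $\dagger$ is the adjoint for $\langle X,Y\rangle=\mathrm{Tr}(X^*Y)$. A quantum Markov semigroup is a $C_0$-semigroup of completely positive unital maps on $\mathcal B(\mathcal H)$ with generator $\mathcal L$; primitive means there is a unique invariant state $\sigma$ ($\mathcal P_t^\dagger(\sigma)=\sigma$) and it is full rank; $\sigma$-GNS detailed balance means $\mathcal L$ is self-adjoint for $\mathrm{Tr}(\sigma X^*Y)$. By Alicki's theorem one can write (and a choice is fixed) $$\mathcal L(X)=\sum_{j=1}^J\big(e^{-\omega_j/2}V_j^*[X,V_j]+e^{\omega_j/2}[V_j,X]V_j^*\big),$$ with $\omega_j\in\mathbb R$, $\sigma V_j\sigma^{-1}=e^{-\omega_j}V_j$,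 $\mathrm{Tr}(V_j)=0$, $\langle V_j,V_k\rangle=c_j\delta_{jk}$, $c_j>0$, and for each $j$ an index $j'$ with $V_j^*=V_{j'}$, $\omega_{j'}=-\omega_j$. Let $\partial_jX=[V_j,X]$, so $\partial_j^\dagger Y=[V_j^*,Y]$. Let $\Gamma_\sigma^s(X)=\sigma^{s/2}X\sigma^{s/2}$, $\hat p=p/(p-1)$, $\|X\|_{p,\sigma}=\mathrm{Tr}(|\Gamma_\sigma^{1/p}(X)|^p)^{1/p}$, $\mathcal F_{p,\sigma}(\rho)=\frac1{p(p-1)}\big(\|\Gamma_\sigma^{-1}(\rho)\|_{p,\sigma}^p-1\big)$, and for $X\ge0$ $$\mathcal E_{p,\mathcal L}(X)=-\frac{\hat p\,p}{4}\Big\langle \Gamma_\sigma^{-1/\hat p}\big((\Gamma_\sigma^{1/p}(X))^{p-1}\big),\mathcal L(X)\Big\rangle_{\sigma,1/2},\quad \langle X,Y\rangle_{\sigma,1/2}=\mathrm{Tr}(\sigma^{1/2}X^*\sigma^{1/2}Y).$$ For $x,y>0$ let $\theta_p(x,y)=(p-1)\frac{x-y}{x^{p-1}-y^{p-1}}$ if $x\ne y$ and $\theta_p(x,x)=x^{2-p}$. For self-adjoint $A=\sum_i\lambda_iA_i$, $B=\sum_k\mu_kB_k$ (spectral decompositions), $f(A,B)(X)=\sum_{i,k}f(\lambda_i,\mu_k)A_iXB_k$. For $\rho\in\mathcal D_+(\mathcal H)$, $\omega\in\mathbb R$, $$[\rho]_{p,\omega}=\Gamma_\sigma^{1/\hat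 p}\circ\theta_p\big(e^{\omega/2p}\Gamma_\sigma^{-1/\hat p}(\rho),\,e^{-\omega/2p}\Gamma_\sigma^{-1/\hat p}(\rho)\big)\circ\Gamma_\sigma^{1/\hat p},\qquad \mathfrak D_{p,\rho}(A)=\sum_{j=1}^J\partial_j^\dagger\big([\rho]_{p,\omega_j}\partial_jA\big).$$ On $T_\rho=\mathcal B^0_{sa}(\mathcal H)$ (traceless self-adjoint operators), the tangent space of $\mathcal D_+(\mathcal H)$ at $\rho$, $\mathfrak D_{p,\rho}$ is positive definite and $g_{p,\rho}(\nu_1,\nu_2)=\langle\mathfrak D_{p,\rho}^{-1}(\nu_1),\nu_2\rangle$ is a Riemannian metric. $W_{2,p}$ is its Riemannian distance: $W_{2,p}(\rho_0,\rho_1)^2=\inf\int_0^1g_{p,\gamma(s)}(\dot\gamma(s),\dot\gamma(s))\,ds$ over smooth curves $\gamma:[0,1]\to\mathcal D_+(\mathcal H)$ from $\rho_0$ to $\rho_1$; it extends continuously to $\mathcal D(\mathcal H)$, the extension being denoted the same. *)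

(* Defs.v *)
From HB Require Import structures.
From mathcomp Require Import all_boot all_order all_algebra.
From mathcomp Require Import sesquilinear spectral complex.
From mathcomp Require Import all_classical all_reals all_analysis.
Set Implicit Arguments.
Unset Strict Implicit.
Unset Printing Implicit Defensive.
Import Order.TTheory GRing.Theory Num.Theory numFieldNormedType.Exports.
Local Open Scope ring_scope.
Local Open Scope classical_set_scope.
Local Open Scope sesquilinear_scope.
Local Open Scope complex_scope.

(* An orthonormal basis identifies B(H), dim H = d, with the complex d x d
   matrices. Since R[i] carries no topology in the libraries, limits of
   matrices are taken in the Hilbert-Schmidt norm, and curves are
   differentiated through the real and imaginary parts of their entries. *)
Notation op R d := 'M[R[i]]_d.

Section Operators.
Variable R : realType.

Definition psdmx n (A : op R n) : Prop :=
  forall v : 'cV[R[i]]_n, 0 <= (v^t* *m A *m v) 0 0.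

Definition density n (A : op R n) : Prop := psdmx A /\ \tr A = 1.

Definition pdensity n (A : op R n) : Prop := density A /\ A \in unitmx.

(* Traceless self-adjoint operators: the tangent space of the full-rank
   densities. *)
Definition tangent n (A : op R n) : Prop := A^t* = A /\ \tr A = 0.

Definition hsip n (X Y : op R n) : R[i] := \tr (X^t* *m Y).

Definition hsnorm n (X : op R n) : R := Num.sqrt (complex.Re (hsip X X)).

(* Adjoint for [hsip] of a linear map Phi: its (i, j) entry at Y is
   <E_ij, Phi^dagger Y> = <Phi E_ij, Y>. *)
Definition hsadj n (Phi : op R n -> op R n) (Y : op R n) : op R n :=
  \matrix_(i, j) hsip (Phi (delta_mx i j)) Y.

Definition commutator n (V X : op R n) : op R n := V *m X - X *m V.

(* Functional calculus. For A self-adjoint, A is the sum over i of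
   [spec_val A i] times the rank-one projection [spec_proj A i]; grouping
   equal eigenvalues gives the spectral decomposition with distinct
   eigenvalues, and yields the same [mxfun] and [mxfun2]. *)
Definition spec_proj n (A : op R n) (i : 'I_n) : op R n :=
  (row i (spectralmx A))^t* *m row i (spectralmx A).

Definition spec_val n (A : op R n) (i : 'I_n) : R :=
  complex.Re (spectral_diag A 0 i).

Definition mxfun n (f : R -> R) (A : op R n) : op R n :=
  \sum_i (f (spec_val A i))%:C *: spec_proj A i.

Definition mxfun2 n (f : R -> R -> R) (A B X : op R n) : op R n :=
  \sum_i \sum_k (f (spec_val A i) (spec_val B k))%:C *:
    (spec_proj A i *m X *m spec_proj B k).

Definition mxpow n (A : op R n) (s : R) : op R n := mxfun (fun x => x `^ s) A.

Definition mxabs n (X : op R n) : op R n := mxfun Num.sqrt (X^t* *m X).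

End Operators.

Section Semigroups.
Variables (R : realType) (d : nat).
Implicit Types (P : R -> op R d -> op R d) (L Phi : op R d -> op R d).

Definition completely_positive Phi : Prop :=
  forall n (X : 'I_n -> 'I_n -> op R d),
    psdmx (\mxblock_(i < n, j < n) X i j) ->
    psdmx (\mxblock_(i < n, j < n) Phi (X i j)).

(* Only the values P t for t >= 0 are relevant. *)
Record quantum_markov_semigroup P : Prop := QuantumMarkovSemigroup {
  qms_linear : forall t, 0 <= t -> linear (P t);
  qms_cp : forall t, 0 <= t -> completely_positive (P t);
  qms_unital : forall t, 0 <= t -> P t 1%:M = 1%:M;
  qms0 : forall X, P 0 X = X;
  qmsD : forall s t X, 0 <= s -> 0 <= t -> P (s + t) X = P s (P t X);
  qms_C0 : forall X, hsnorm (P t X - X) @[t --> 0^'+] --> 0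
}.

Definition is_generator P L : Prop :=
  forall X, hsnorm ((t^-1)%:C *: (P t X - X) - L X) @[t --> 0^'+] --> 0.

Definition invariant_state P (rho : op R d) : Prop :=
  density rho /\ forall t, 0 <= t -> hsadj (P t) rho = rho.

(* sigma is the unique invariant state, and has full rank. *)
Definition primitive P (sigma : op R d) : Prop :=
  [/\ invariant_state P sigma, sigma \in unitmx &
      forall rho, invariant_state P rho -> rho = sigma].

Definition GNS_detailed_balance (sigma : op R d) L : Prop :=
  forall X Y,
    \tr (sigma *m (L X)^t* *m Y) = \tr (sigma *m X^t* *m L Y).

Record alicki_form (sigma : op R d) L J (V : 'I_J -> op R d)
    (omega : 'I_J -> R) : Prop := AlickiForm {
  alicki_generator : forall X, L X = \sum_(j < J)
    ((expR (- omega j / 2))%:C *: ((V j)^t* *m commutator X (V j)) +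
     (expR (omega j / 2))%:C *: (commutator (V j) X *m (V j)^t*));
  alicki_modular : forall j,
    sigma *m V j *m invmx sigma = (expR (- omega j))%:C *: V j;
  alicki_traceless : forall j, \tr (V j) = 0;
  alicki_orthogonal : exists2 c : 'I_J -> R, (forall j, 0 < c j) &
    forall j k, hsip (V j) (V k) = (c j)%:C *+ (j == k);
  alicki_adjoint : forall j, exists2 j', (V j)^t* = V j' & omega j' = - omega j
}.

End Semigroups.

Section Functionals.
Variables (R : realType) (d : nat) (sigma : op R d) (p : R).

Definition Gamma (s : R) (X : op R d) : op R d :=
  mxpow sigma (s / 2) *m X *m mxpow sigma (s / 2).

Definition conjexp : R := p / (p - 1).

Definition pnorm (X : op R d) : R :=
  complex.Re (\tr (mxpow (mxabs (Gamma p^-1 X)) p)) `^ p^-1.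

Definition Fp (rho : op R d) : R :=
  (p * (p - 1))^-1 * (pnorm (Gamma (-1) rho) `^ p - 1).

Definition KMSip (X Y : op R d) : R[i] :=
  \tr (mxpow sigma (2^-1) *m X^t* *m mxpow sigma (2^-1) *m Y).

(* Real part of an expression which is real when L preserves
   self-adjointness. *)
Definition Ep (L : op R d -> op R d) (X : op R d) : R :=
  - (conjexp * p / 4) *
  complex.Re
    (KMSip (Gamma (- conjexp^-1) (mxpow (Gamma p^-1 X) (p - 1))) (L X)).

Definition beckner (L : op R d -> op R d) (alpha : R) : Prop :=
  forall rho, pdensity rho ->
    alpha * Fp rho <= p ^- 2 * Ep L (Gamma (-1) rho).

Definition theta (x y : R) : R :=
  if x == y then x `^ (2 - p)
  else (p - 1) * ((x - y) / (x `^ (p - 1) - y `^ (p - 1))).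

Definition bracket (rho : op R d) (omega : R) (X : op R d) : op R d :=
  Gamma conjexp^-1
    (mxfun2 theta
       ((expR (omega / (2 * p)))%:C *: Gamma (- conjexp^-1) rho)
       ((expR (- omega / (2 * p)))%:C *: Gamma (- conjexp^-1) rho)
       (Gamma conjexp^-1 X)).

Variables (J : nat) (V : 'I_J -> op R d) (omega : 'I_J -> R).

Definition Dop (rho A : op R d) : op R d :=
  \sum_(j < J) hsadj (commutator (V j))
                 (bracket rho (omega j) (commutator (V j) A)).

(* Inverse of [Dop rho] as an endomorphism of the tangent space, on which it
   is positive definite; the default value 0 is then never used there. *)
Definition Dinv (rho nu : op R d) : op R d :=
  xget 0 [set A | tangent A /\ Dop rho A = nu].

(* Again a real number when nu1 and nu2 are tangent vectors. *)
Definition metric (rho nu1 nu2 : op R d) : R :=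
  complex.Re (hsip (Dinv rho nu1) nu2).

Definition deriv_mx (g : R -> op R d) (s : R) : op R d :=
  \matrix_(i, j) ((fun t => complex.Re (g t i j))^`() s +i*
                  (fun t => complex.Im (g t i j))^`() s).

Definition smooth_on (U : set R) (f : R -> R) : Prop :=
  forall n x, U x -> derivable f^`(n) x 1.

(* Smoothness on the closed interval means smoothness on some open
   neighbourhood of it; outside [0, 1] the values are unconstrained. *)
Definition admissible_curve (rho0 rho1 : op R d) (g : R -> op R d) : Prop :=
  [/\ g 0 = rho0, g 1 = rho1,
      forall s, 0 <= s <= 1 -> pdensity (g s) &
      exists2 U : set R, open U /\ `[0, 1] `<=` U &
        forall i j, smooth_on U (fun t => complex.Re (g t i j)) /\
                    smooth_on U (fun t => complex.Im (g t i j))].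

Definition energy (g : R -> op R d) : \bar R :=
  (\int[lebesgue_measure]_(s in `[0%R, 1%R])
     (metric (g s) (deriv_mx g s) (deriv_mx g s))%:E)%E.

(* The distance W_{2,p} on full-rank densities. The infimum is a real number
   since the convex set of full-rank densities contains the segment from rho0
   to rho1, so that [fine] returns it unchanged. *)
Definition W2p (rho0 rho1 : op R d) : R :=
  Num.sqrt (fine (ereal_inf [set energy g | g in admissible_curve rho0 rho1])).

(* W is the (necessarily unique, by density) continuous extension of W2p to
   pairs of density operators. *)
Definition continuous_extension_W2p (W : op R d -> op R d -> R) : Prop :=
  (forall rho0 rho1, pdensity rho0 -> pdensity rho1 ->
     W rho0 rho1 = W2p rho0 rho1) /\
  (forall rho0 rho1, density rho0 -> density rho1 ->
     forall e : R, 0 < e -> exists2 del : R, 0 < del &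
       forall tau0 tau1, density tau0 -> density tau1 ->
         hsnorm (tau0 - rho0) < del -> hsnorm (tau1 - rho1) < del ->
         `|W tau0 tau1 - W rho0 rho1| < e).

End Functionals.

(* Main.v *)
(* Put F(t) = F_{p,sigma}(rho_t) for rho_t = P_t^dagger(rho). The chain rule for
   theta_p says that D_{p,rho_t} maps -grad F to the generator applied to rho_t,
   so that the flow is the gradient flow of F and g(rho_t', rho_t') = -F'(t) =
   4 p^-2 E_p >= 4 alpha F(t). Running along the flow so that sqrt F decreases at
   constant rate therefore costs energy at most F(0) / alpha, and rho_t tends to
   sigma because F(t) decays exponentially and is coercive.

   Two devices keep the analysis elementary. Detailed balance diagonalizes the
   generator with real eigenvalues, so rho_t is an explicit combination of
   exponentials, and a curve obtained from it by a polynomial change of time is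
   smooth; the optimal change of time is approximated by polynomials. The
   derivative of F is obtained from its subgradients (Klein's inequality), without
   differentiating the functional calculus. *)

Require Import Defs.
From HB Require Import structures.
From mathcomp Require Import all_boot all_order all_algebra.
From mathcomp Require Import sesquilinear spectral complex.
From mathcomp Require Import all_classical all_reals all_analysis.
From mathcomp Require Import ring lra.
Import Order.TTheory GRing.Theory Num.Theory numFieldNormedType.Exports.
Local Open Scope ring_scope.

Set Implicit Arguments.
Unset Strict Implicit.
Unset Printing Implicit Defensive.

(** * Hilbert-Schmidt geometry *)

(** Several degeneracies are removed by perturbation. The entropy F(t) is differentiated only at
    positive times and along full-rank states, so rho is first mixed with sigma, which does not
    raise F, and the flow is entered at a small time a > 0. The square root of F is not
    differentiable where F vanishes, so F is replaced by F + alpha z e^(-4 alpha t), whose added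
    term obeys the decay law with equality. The state sigma is only a limit of the flow, so the
    curve stops at a late time. Continuity of W absorbs the displacement of both endpoints.

    Only one derivative of F is obtained, so the ideal change of time is merely C^1, whereas
    admissible curves are smooth to all orders: hence the polynomials. If sqrt F falls at constant
    rate N on the unit interval and h = -F', then t' = 2 N sqrt F / h, and t'^2 h = 4 N^2 F / h <=
    N^2 / alpha <= F(a) / alpha.

    Klein's inequality is used twice over: its plain form gives the subgradients and the behaviour
    under mixing, its strongly convex form the coercivity. *)

Section ComplexParts.
Variable R : realType.
Implicit Types (x y : R[i]) (r : R).
Local Open Scope complex_scope.

Lemma ReD x y : complex.Re (x + y) = complex.Re x + complex.Re y.
Proof. by case: x y => [? ?] []. Qed.

Lemma ImD x y : complex.Im (x + y) = complex.Im x + complex.Im y.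
Proof. by case: x y => [? ?] []. Qed.

Lemma ReN x : complex.Re (- x) = - complex.Re x. Proof. by case: x. Qed.

Lemma ImN x : complex.Im (- x) = - complex.Im x. Proof. by case: x. Qed.

Lemma Re_sum I (s : seq I) (P : pred I) (F : I -> R[i]) :
  complex.Re (\sum_(i <- s | P i) F i) = \sum_(i <- s | P i) complex.Re (F i).
Proof. exact: (big_morph _ ReD). Qed.

Lemma Im_sum I (s : seq I) (P : pred I) (F : I -> R[i]) :
  complex.Im (\sum_(i <- s | P i) F i) = \sum_(i <- s | P i) complex.Im (F i).
Proof. exact: (big_morph _ ImD). Qed.

Lemma ReZ r x : complex.Re (r%:C * x) = r * complex.Re x.
Proof. by case: x => a b /=; rewrite mul0r subr0. Qed.

Lemma ImZ r x : complex.Im (r%:C * x) = r * complex.Im x.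
Proof. by case: x => a b /=; rewrite mul0r addr0. Qed.

Lemma ReM x y : complex.Re (x * y) =
  complex.Re x * complex.Re y - complex.Im x * complex.Im y.
Proof. by case: x y => [? ?] []. Qed.

Lemma Re_conj x : complex.Re (Num.conj x) = complex.Re x. Proof. by case: x. Qed.

Lemma Im_conj x : complex.Im (Num.conj x) = - complex.Im x. Proof. by case: x. Qed.

Lemma ge0_complexE x : (0 <= x) = (complex.Im x == 0) && (0 <= complex.Re x).
Proof. by rewrite lecE. Qed.

Lemma conj_realC r : Num.conj (r%:C : R[i]) = r%:C.
Proof. by apply/eqP; rewrite eq_complex /= oppr0 !eqxx. Qed.

Lemma conj_i : Num.conj ('i%C : R[i]) = - 'i%C.
Proof. by apply/eqP; rewrite eq_complex /= oppr0 !eqxx. Qed.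

End ComplexParts.

Section Adjoint.
Variable R : realType.
Local Open Scope complex_scope.
Local Open Scope sesquilinear_scope.

Lemma adjmxM m n q (A : 'M[R[i]]_(m, n)) (B : 'M[R[i]]_(n, q)) :
  (A *m B)^t* = B^t* *m A^t*.
Proof. by rewrite trmx_mul map_mxM. Qed.

Lemma adjmxD m n (A B : 'M[R[i]]_(m, n)) : (A + B)^t* = A^t* + B^t*.
Proof. by rewrite linearD map_mxD. Qed.

Lemma adjmxN m n (A : 'M[R[i]]_(m, n)) : (- A)^t* = - A^t*.
Proof. by rewrite linearN map_mxN. Qed.

Lemma adjmxB m n (A B : 'M[R[i]]_(m, n)) : (A - B)^t* = A^t* - B^t*.
Proof. by rewrite adjmxD adjmxN. Qed.

Lemma adjmxZ m n (a : R[i]) (A : 'M[R[i]]_(m, n)) :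
  (a *: A)^t* = Num.conj a *: A^t*.
Proof. by rewrite linearZ /= map_mxZ. Qed.

Lemma adjmxZr m n (r : R) (A : 'M[R[i]]_(m, n)) :
  (r%:C *: A)^t* = r%:C *: A^t*.
Proof. by rewrite adjmxZ conj_realC. Qed.

Lemma adjmx0 m n : (0 : 'M[R[i]]_(m, n))^t* = 0.
Proof. by rewrite trmx0 map_mx0. Qed.

Lemma adjmx1 n : (1%:M : 'M[R[i]]_n)^t* = 1%:M.
Proof. by rewrite trmx1 map_mx1. Qed.

Lemma adjmx_sum m n I (s : seq I) (P : pred I) (F : I -> 'M[R[i]]_(m, n)) :
  (\sum_(i <- s | P i) F i)^t* = \sum_(i <- s | P i) (F i)^t*.
Proof.
exact: (big_morph (fun A => A^t*) (@adjmxD m n) (adjmx0 m n)).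
Qed.

Lemma mxtrace_adj n (A : 'M[R[i]]_n) : \tr (A^t*) = Num.conj (\tr A).
Proof.
rewrite /mxtrace rmorph_sum; apply: eq_bigr => i _; by rewrite !mxE.
Qed.

(** Polarization. Expanding at u + v makes the sesquilinear form antisymmetric; replacing v by i v
    makes it symmetric as well, which is where complex scalars are essential. *)
Lemma qform_eq0 n (A : 'M[R[i]]_n) :
  (forall v : 'cV[R[i]]_n, (v^t* *m A *m v) 0 0 = 0) -> A = 0.
Proof.
move=> A0; pose B (u v : 'cV[R[i]]_n) : R[i] := (u^t* *m A *m v) 0 0.
have BDl u v w : B (u + v) w = B u w + B v w.
  by rewrite /B adjmxD mulmxDl mulmxDl [LHS]mxE.
have BDr u v w : B u (v + w) = B u v + B u w.
  by rewrite /B mulmxDr [LHS]mxE.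
have BZl u v a : B (a *: u) v = Num.conj a * B u v.
  by rewrite /B adjmxZ -scalemxAl -scalemxAl [LHS]mxE.
have BZr u v a : B u (a *: v) = a * B u v by rewrite /B -scalemxAr [LHS]mxE.
have B0 u v : B u v + B v u = 0.
  have : B (u + v) (u + v) = 0 by exact: A0.
  rewrite BDl !BDr; have -> : B u u = 0 by exact: A0.
  have -> : B v v = 0 by exact: A0.
  by rewrite add0r addr0.
have B1 u v : B u v = 0.
  have := B0 u ('i%C *: v); rewrite BZl BZr conj_i => h.
  have : ('i%C * 2) * B u v = 0.
    by rewrite -[RHS](mulr0 'i%C) -(B0 u v) -[RHS]addr0 -h; ring.
  move/eqP; rewrite mulf_eq0 mulf_eq0 pnatr_eq0 orbF => /orP[/eqP/eqP|/eqP//].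
  by rewrite eq_complex /= oner_eq0 andbF.
apply/matrixP => i j; rewrite mxE -[RHS](B1 (delta_mx i 0) (delta_mx j 0)) /B.
rewrite (_ : (delta_mx i 0)^t* = delta_mx 0 i); last first.
  by rewrite trmx_delta map_delta_mx.
by rewrite -rowE -colE !mxE.
Qed.

End Adjoint.

Section HilbertSchmidt.
Variables (R : realType) (n : nat).
Local Open Scope complex_scope.
Local Open Scope sesquilinear_scope.
Implicit Types (X Y Z : op R n) (r : R).

Definition hsre X Y : R := complex.Re (hsip X Y).

Lemma hsip_conj X Y : hsip Y X = Num.conj (hsip X Y).
Proof. by rewrite /hsip -mxtrace_adj adjmxM trmxCK. Qed.

Lemma hsipDr X Y Z : hsip X (Y + Z) = hsip X Y + hsip X Z.
Proof. by rewrite /hsip mulmxDr mxtraceD. Qed.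

Lemma hsipZr X a Y : hsip X (a *: Y) = a * hsip X Y.
Proof. by rewrite /hsip -scalemxAr mxtraceZ. Qed.

Lemma hsipDl X Y Z : hsip (X + Y) Z = hsip X Z + hsip Y Z.
Proof. by rewrite /hsip adjmxD mulmxDl mxtraceD. Qed.

Lemma hsipZl X a Y : hsip (a *: X) Y = Num.conj a * hsip X Y.
Proof. by rewrite /hsip adjmxZ -scalemxAl mxtraceZ. Qed.

Lemma hsipZrl X r Y : hsip (r%:C *: X) Y = r%:C * hsip X Y.
Proof. by rewrite hsipZl conj_realC. Qed.

Lemma hsip_delta i j Y : hsip (delta_mx i j) Y = Y i j.
Proof.
rewrite /hsip trmx_delta map_delta_mx /mxtrace (bigD1 j)//= big1 ?addr0.
  rewrite !mxE (bigD1 i)//= big1 ?addr0 ?mxE ?eqxx ?mul1r//.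
  by move=> k /negPf ki; rewrite !mxE ki andbF mul0r.
move=> k /negPf kj; rewrite !mxE big1// => l _.
by rewrite !mxE kj mul0r.
Qed.

Lemma hsreC X Y : hsre X Y = hsre Y X.
Proof. by rewrite /hsre hsip_conj Re_conj. Qed.

Lemma hsreDr X Y Z : hsre X (Y + Z) = hsre X Y + hsre X Z.
Proof. by rewrite /hsre hsipDr ReD. Qed.

Lemma hsreZr X r Y : hsre X (r%:C *: Y) = r * hsre X Y.
Proof. by rewrite /hsre hsipZr ReZ. Qed.

Lemma hsreDl X Y Z : hsre (X + Y) Z = hsre X Z + hsre Y Z.
Proof. by rewrite /hsre hsipDl ReD. Qed.

Lemma hsreZl X r Y : hsre (r%:C *: X) Y = r * hsre X Y.
Proof. by rewrite /hsre hsipZrl ReZ. Qed.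

Lemma hsre0r X : hsre X 0 = 0.
Proof. by rewrite /hsre /hsip mulmx0 mxtrace0. Qed.

Lemma hsreNr X Y : hsre X (- Y) = - hsre X Y.
Proof. by rewrite /hsre /hsip mulmxN raddfN ReN. Qed.

Lemma hsreNl X Y : hsre (- X) Y = - hsre X Y.
Proof. by rewrite hsreC hsreNr hsreC. Qed.

Lemma hsreBr X Y Z : hsre X (Y - Z) = hsre X Y - hsre X Z.
Proof. by rewrite hsreDr hsreNr. Qed.

Lemma hsreBl X Y Z : hsre (X - Y) Z = hsre X Z - hsre Y Z.
Proof. by rewrite hsreDl hsreNl. Qed.

Lemma hsre_sumr X I (s : seq I) (P : pred I) (F : I -> op R n) :
  hsre X (\sum_(i <- s | P i) F i) = \sum_(i <- s | P i) hsre X (F i).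
Proof. exact: (big_morph (hsre X) (hsreDr X) (hsre0r X)). Qed.

Lemma hsre_suml X I (s : seq I) (P : pred I) (F : I -> op R n) :
  hsre (\sum_(i <- s | P i) F i) X = \sum_(i <- s | P i) hsre (F i) X.
Proof. by rewrite hsreC hsre_sumr; apply: eq_bigr => i _; rewrite hsreC. Qed.

Lemma hsreE X Y : hsre X Y = \sum_i \sum_j
  (complex.Re (X i j) * complex.Re (Y i j) +
   complex.Im (X i j) * complex.Im (Y i j)).
Proof.
rewrite /hsre /hsip /mxtrace Re_sum exchange_big /=; apply: eq_bigr => j _.
rewrite !mxE Re_sum; apply: eq_bigr => i _; rewrite !mxE ReM.
by rewrite Re_conj Im_conj mulNr opprK.
Qed.

Lemma hsre_ge0 X : 0 <= hsre X X.
Proof.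
rewrite hsreE; apply: sumr_ge0 => i _; apply: sumr_ge0 => j _.
by rewrite -!expr2 addr_ge0 ?sqr_ge0.
Qed.

Lemma hsre_eq0 X : hsre X X = 0 -> X = 0.
Proof.
rewrite hsreE => /eqP.
have h i j : 0 <= complex.Re (X i j) * complex.Re (X i j) +
   complex.Im (X i j) * complex.Im (X i j).
  by rewrite -!expr2 addr_ge0 ?sqr_ge0.
rewrite psumr_eq0 => [/allP h0|i _]; last by apply: sumr_ge0 => j _; exact: h.
apply/matrixP => i j; rewrite mxE.
have /= := h0 i (mem_index_enum i); rewrite psumr_eq0 => [/allP h1|k _ //].
have /= := h1 j (mem_index_enum j).
rewrite -!expr2 paddr_eq0 ?sqr_ge0// !expf_eq0/= => /andP[/eqP r /eqP i0].
by apply/eqP; rewrite eq_complex r i0 !eqxx.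
Qed.

Lemma hsnorm_ge0 X : 0 <= hsnorm X. Proof. exact: sqrtr_ge0. Qed.

Lemma sqr_hsnorm X : hsnorm X ^+ 2 = hsre X X.
Proof. by rewrite /hsnorm sqr_sqrtr// hsre_ge0. Qed.

Lemma hsre_le X Y : hsre X Y <= hsnorm X * hsnorm Y.
Proof.
have [/eqP Y0|Ypos] := eqVneq (hsre Y Y) 0.
  by rewrite (hsre_eq0 (eqP Y0)) hsre0r mulr_ge0 ?hsnorm_ge0.
have {}Ypos : 0 < hsre Y Y by rewrite lt_def Ypos hsre_ge0.
(* Up to the factor <Y, Y>, this vector is the component of X orthogonal to Y. *)
have := hsre_ge0 ((hsre Y Y)%:C *: X - (hsre X Y)%:C *: Y).
rewrite hsreBl !hsreBr !hsreZl !hsreZr [hsre Y X]hsreC => h.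
have {h} : 0 <= hsre Y Y * (hsre X X * hsre Y Y - hsre X Y ^+ 2).
  by apply: le_trans h _; rewrite le_eqVlt; apply/orP; left; apply/eqP; ring.
rewrite pmulr_rge0// subr_ge0 -!sqr_hsnorm -exprMn => h.
apply: le_trans (ler_norm _) _; rewrite -(@ler_pXn2r _ 2) ?nnegrE ?mulr_ge0 ?hsnorm_ge0//.
by rewrite -normrX ger0_norm ?sqr_ge0.
Qed.

Lemma normr_hsre_le X Y : `|hsre X Y| <= hsnorm X * hsnorm Y.
Proof.
rewrite ler_norml hsre_le andbT lerNl -hsreNl.
apply: le_trans (hsre_le _ _) _.
by rewrite /hsnorm -/(hsre _ _) hsreNl hsreNr opprK.
Qed.

Lemma hsnormZ r X : hsnorm (r%:C *: X) = `|r| * hsnorm X.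
Proof.
rewrite /hsnorm -!/(hsre _ _) hsreZl hsreZr mulrA -expr2.
by rewrite sqrtrM ?sqr_ge0// sqrtr_sqr.
Qed.

Lemma hsnormZi X : hsnorm ('i%C *: X) = hsnorm X.
Proof.
rewrite /hsnorm hsipZl hsipZr mulrA (_ : Num.conj _ * _ = 1) ?mul1r//.
by rewrite conj_i mulNr -expr2 sqr_i opprK.
Qed.

Lemma hsnormD X Y : hsnorm (X + Y) <= hsnorm X + hsnorm Y.
Proof.
rewrite -(@ler_pXn2r _ 2) ?nnegrE ?addr_ge0 ?hsnorm_ge0//.
rewrite sqr_hsnorm hsreDl !hsreDr sqrrD !sqr_hsnorm [hsre Y X]hsreC.
have := hsre_le X Y; lra.
Qed.

Lemma hsnorm0 : hsnorm (0 : op R n) = 0.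
Proof. by rewrite /hsnorm -/(hsre _ _) hsre0r sqrtr0. Qed.

Lemma hsnorm_sum I (s : seq I) (P : pred I) (F : I -> op R n) :
  hsnorm (\sum_(i <- s | P i) F i) <= \sum_(i <- s | P i) hsnorm (F i).
Proof.
elim/big_ind2: _ => [|x r y t h1 h2|//]; first by rewrite hsnorm0.
by apply: le_trans (hsnormD _ _) _; exact: lerD.
Qed.

End HilbertSchmidt.

(** * Functional calculus and positivity *)

Section FunctionalCalculus.
Variables (R : realType) (n : nat).
Local Open Scope complex_scope.
Local Open Scope sesquilinear_scope.
Implicit Types (A B X Y Z : op R n) (r : R) (f g : R -> R).

Lemma spec_projM A i j :
  spec_proj A i *m spec_proj A j = spec_proj A i *+ (i == j).
Proof.
rewrite /spec_proj mulmxA -[X in X *m row j _]mulmxA.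
have /row_unitarymxP/(_ i j) := spectral_unitarymx A.
rewrite dotmxE => h.
have -> : row i (spectralmx A) *m (row j (spectralmx A))^t* = (i == j)%:R%:M.
  by apply/matrixP => a b; rewrite !ord1 h !mxE mulr1n.
rewrite mul_mx_scalar -scalemxAl; case: eqP => [->|_].
  by rewrite scale1r mulr1n.
by rewrite scale0r mulr0n.
Qed.

Lemma spec_proj_adj A i : (spec_proj A i)^t* = spec_proj A i.
Proof. by rewrite /spec_proj adjmxM trmxCK. Qed.

Lemma spec_proj_sum A : \sum_i spec_proj A i = 1%:M.
Proof.
have /unitarymxP := spectral_unitarymx A => /mulmx1C <-.
apply/matrixP => i j; rewrite summxE mxE; apply: eq_bigr => k _.
by rewrite mxE big_ord1 !mxE.
Qed.

Lemma trace_spec_proj A i : \tr (spec_proj A i) = 1.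
Proof.
rewrite /spec_proj mxtrace_mulC.
have /row_unitarymxP/(_ i i) := spectral_unitarymx A.
by rewrite dotmxE eqxx => h; rewrite /mxtrace big_ord1 h.
Qed.

Lemma spec_proj_qform A X i : \tr (spec_proj A i *m X) =
  (row i (spectralmx A) *m X *m (row i (spectralmx A))^t*) 0 0.
Proof.
by rewrite /spec_proj -[X in \tr X]mulmxA mxtrace_mulC trace_mx11.
Qed.

Lemma herm_spec A : A^t* = A -> A = \sum_i (spec_val A i)%:C *: spec_proj A i.
Proof.
move=> Ah.
have hA : A \is hermsymmx.
  by apply/is_hermitianmxP; rewrite expr0 scale1r Ah.
have /orthomx_spectralP {1}-> := hermitian_normalmx hA.
rewrite invmx_unitary ?spectral_unitarymx//.
apply/matrixP => i j; rewrite summxE mxE; apply: eq_bigr => k _.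
rewrite mul_mx_diag !mxE big_ord1 !mxE mulrA [_ * spectral_diag _ _ _]mulrC.
rewrite -!mulrA /spec_val RRe_real//.
by have /mxOverP := hermitian_spectral_diag_real hA.
Qed.

Lemma spec_proj_mull A i : A^t* = A ->
  spec_proj A i *m A = (spec_val A i)%:C *: spec_proj A i.
Proof.
move=> Ah; rewrite {2}(herm_spec Ah) mulmx_sumr (bigD1 i)//= big1 ?addr0.
  by rewrite -scalemxAr spec_projM eqxx.
by move=> j /negPf ji; rewrite -scalemxAr spec_projM eq_sym ji mulr0n scaler0.
Qed.

Lemma spec_proj_mulr A i : A^t* = A ->
  A *m spec_proj A i = (spec_val A i)%:C *: spec_proj A i.
Proof.
move=> Ah; rewrite -[LHS]trmxCK adjmxM Ah spec_proj_adj spec_proj_mull//.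
by rewrite adjmxZr spec_proj_adj.
Qed.

Lemma spec_proj_mxfun f A i :
  spec_proj A i *m mxfun f A = (f (spec_val A i))%:C *: spec_proj A i.
Proof.
rewrite /mxfun mulmx_sumr (bigD1 i)//= big1 ?addr0.
  by rewrite -scalemxAr spec_projM eqxx.
by move=> j /negPf ji; rewrite -scalemxAr spec_projM eq_sym ji mulr0n scaler0.
Qed.

Lemma mxfun_adj f A : (mxfun f A)^t* = mxfun f A.
Proof.
by rewrite /mxfun adjmx_sum; apply: eq_bigr => i _; rewrite adjmxZr spec_proj_adj.
Qed.

Lemma mxfun_spec_proj f A i :
  mxfun f A *m spec_proj A i = (f (spec_val A i))%:C *: spec_proj A i.
Proof.
by rewrite -[LHS]trmxCK adjmxM mxfun_adj spec_proj_adj spec_proj_mxfun adjmxZr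
  spec_proj_adj.
Qed.

Lemma mxfunM f g A : mxfun f A *m mxfun g A = mxfun (fun x => f x * g x) A.
Proof.
rewrite {1}/mxfun mulmx_suml; apply: eq_bigr => i _.
by rewrite -scalemxAl spec_proj_mxfun scalerA rmorphM.
Qed.

Lemma eq_mxfun f g A : (forall i, f (spec_val A i) = g (spec_val A i)) ->
  mxfun f A = mxfun g A.
Proof. by move=> fg; apply: eq_bigr => i _; rewrite fg. Qed.

Lemma mxfun1 f A : (forall i, f (spec_val A i) = 1) -> mxfun f A = 1%:M.
Proof.
move=> f1; rewrite -(spec_proj_sum A); apply: eq_bigr => i _.
by rewrite f1 scale1r.
Qed.

Lemma mxfun_id f A : A^t* = A -> (forall i, f (spec_val A i) = spec_val A i) ->
  mxfun f A = A.
Proof.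
by move=> Ah fi; rewrite [RHS](herm_spec Ah); apply: eq_bigr => i _; rewrite fi.
Qed.

Lemma trace_mxfun f A : \tr (mxfun f A) = (\sum_i f (spec_val A i))%:C.
Proof.
rewrite /mxfun raddf_sum rmorph_sum; apply: eq_bigr => i _.
by rewrite /= mxtraceZ trace_spec_proj mulr1.
Qed.

(* A resolution of the identity diagonalizing A need not be the one chosen by
   [spectralmx], but it computes the same functions of A. *)
Lemma mxfun_resolution (f : R -> R) A m (Q : 'I_m -> op R n) (a : 'I_m -> R) :
  A^t* = A -> \sum_k Q k = 1%:M -> (forall k, A *m Q k = (a k)%:C *: Q k) ->
  mxfun f A = \sum_k (f (a k))%:C *: Q k.
Proof.
move=> Ah Q1 AQ; rewrite -[LHS]mulmx1 -Q1 mulmx_sumr; apply: eq_bigr => k _.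
have {2}-> : Q k = \sum_i spec_proj A i *m Q k.
  by rewrite -mulmx_suml spec_proj_sum mul1mx.
rewrite scaler_sumr mulmx_suml; apply: eq_bigr => i _.
rewrite -scalemxAl; have [->//|ne] := eqVneq (spec_val A i) (a k).
suff -> : spec_proj A i *m Q k = 0 by rewrite !scaler0.
have : (spec_val A i - a k)%:C *: (spec_proj A i *m Q k) = 0.
  rewrite rmorphB scalerBl scalemxAl -spec_proj_mull// -mulmxA AQ.
  by rewrite -scalemxAr subrr.
move=> /eqP; rewrite scaler_eq0 => /orP[|/eqP//].
by rewrite -(rmorph0 (real_complex R)) (inj_eq (@complexI R)) subr_eq0 (negPf ne).
Qed.

(** Since A V = V B, the block of V between the two projections is multiplied by either eigenvalue
    with the same result; if they differ, the block is 0. *)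
Lemma spec_proj_intertwine A B V i k : A^t* = A -> B^t* = B ->
  A *m V = V *m B -> spec_val A i != spec_val B k ->
  spec_proj A i *m V *m spec_proj B k = 0.
Proof.
move=> Ah Bh AB ne.
have : (spec_val A i - spec_val B k)%:C *:
    (spec_proj A i *m V *m spec_proj B k) = 0.
  rewrite rmorphB scalerBl [X in X - _]scalemxAl [X in X *m _ - _]scalemxAl.
  rewrite -spec_proj_mull//.
  rewrite scalemxAr -spec_proj_mulr// -!mulmxA [V *m (B *m _)]mulmxA -AB.
  by rewrite !mulmxA subrr.
move=> /eqP; rewrite scaler_eq0 => /orP[|/eqP//].
by rewrite -(rmorph0 (real_complex R)) (inj_eq (@complexI R)) subr_eq0 (negPf ne).
Qed.

(** The blocks of V that survive [spec_proj_intertwine] join equal eigenvalues, on which f takes the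
    same value. In [mxpow_modular] the matrix B is a multiple of A. *)
Lemma mxfun_intertwine f A B V : A^t* = A -> B^t* = B ->
  A *m V = V *m B -> mxfun f A *m V = V *m mxfun f B.
Proof.
move=> Ah Bh AB.
rewrite -[LHS]mulmx1 -(spec_proj_sum B) -[RHS]mul1mx -[X in X *m (V *m _)](spec_proj_sum A).
rewrite mulmx_sumr; under eq_bigr do rewrite !mulmx_suml.
rewrite [RHS]mulmx_suml; under [in RHS]eq_bigr do rewrite mulmxA mulmx_sumr.
rewrite exchange_big /=; apply: eq_bigr => i _; apply: eq_bigr => k _.
rewrite -!scalemxAl -!scalemxAr.
have [->//|ne] := eqVneq (spec_val A i) (spec_val B k).
by rewrite (spec_proj_intertwine Ah Bh AB ne) !scaler0.
Qed.

Lemma mxfunZ f r A : A^t* = A ->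
  mxfun f (r%:C *: A) = mxfun (fun x => f (r * x)) A.
Proof.
move=> Ah; apply: mxfun_resolution; [|exact: spec_proj_sum|].
  by rewrite adjmxZr Ah.
by move=> k; rewrite -scalemxAl spec_proj_mulr// scalerA rmorphM.
Qed.

Lemma mxfun_scale f r A :
  mxfun (fun x => r * f x) A = r%:C *: mxfun f A.
Proof.
rewrite /mxfun scaler_sumr; apply: eq_bigr => i _.
by rewrite scalerA rmorphM.
Qed.

(** The squared modulus of the inner product of the i-th eigenvector of A and the k-th eigenvector
    of B. These weights form a doubly stochastic matrix, so a sum over one spectrum can be spread
    over both. *)
Definition overlap A B i k : R := hsre (spec_proj A i) (spec_proj B k).

Lemma hsre_mxfun f g A B : hsre (mxfun f A) (mxfun g B) =
  \sum_i \sum_k f (spec_val A i) * g (spec_val B k) * overlap A B i k.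
Proof.
rewrite hsre_suml; apply: eq_bigr => i _; rewrite hsre_sumr.
by apply: eq_bigr => k _; rewrite hsreZl hsreZr mulrA.
Qed.

Lemma overlap_suml A B i : \sum_k overlap A B i k = 1.
Proof.
rewrite -hsre_sumr spec_proj_sum /hsre /hsip mulmx1 spec_proj_adj.
by rewrite trace_spec_proj.
Qed.

Lemma overlap_sumr A B k : \sum_i overlap A B i k = 1.
Proof.
rewrite -hsre_suml spec_proj_sum /hsre /hsip adjmx1 mul1mx.
by rewrite trace_spec_proj.
Qed.

Lemma psd_spec_proj A i : psdmx (spec_proj A i).
Proof.
move=> v; rewrite /spec_proj; set b := row i (spectralmx A) *m v.
rewrite (_ : v^t* *m _ *m v = b^t* *m b); last by rewrite adjmxM !mulmxA.
by rewrite mxE big_ord1 !mxE mulrC mul_conjC_ge0.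
Qed.

End FunctionalCalculus.

(** * Positive semidefinite matrices and their spectra *)

Section Positivity.
Variables (R : realType) (n : nat).
Local Open Scope complex_scope.
Local Open Scope sesquilinear_scope.
Implicit Types (A B X Y Z : op R n) (r : R) (f g : R -> R).

(** For complex numbers 0 <= z includes that z is real, so A and its adjoint have the same quadratic
    form. *)
Lemma psd_herm A : psdmx A -> A^t* = A.
Proof.
move=> Ap; apply/eqP; rewrite -subr_eq0; apply/eqP/qform_eq0 => v.
have h : (v^t* *m A^t* *m v) 0 0 = Num.conj ((v^t* *m A *m v) 0 0).
  rewrite (_ : v^t* *m A^t* *m v = (v^t* *m A *m v)^t*) ?mxE ?mxE//.
  by rewrite !adjmxM trmxCK mulmxA.
rewrite mulmxBr mulmxBl mxE h [X in _ + X]mxE.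
have /CrealP -> : (v^t* *m A *m v) 0 0 \is Num.real by apply: ger0_real; exact: Ap.
by rewrite subrr.
Qed.

Lemma psdD A B : psdmx A -> psdmx B -> psdmx (A + B).
Proof.
by move=> Ap Bp v; rewrite mulmxDr mulmxDl mxE addr_ge0.
Qed.

Lemma psdZ r A : 0 <= r -> psdmx A -> psdmx (r%:C *: A).
Proof.
move=> r0 Ap v; rewrite -scalemxAr -scalemxAl mxE mulr_ge0 ?ler0c//.
Qed.

Lemma psd0 : psdmx (0 : op R n).
Proof. by move=> v; rewrite mulmx0 mul0mx mxE. Qed.

Lemma psd_sum I (s : seq I) (P : pred I) (F : I -> op R n) :
  (forall i, P i -> psdmx (F i)) -> psdmx (\sum_(i <- s | P i) F i).
Proof. exact: (big_ind (@psdmx R n) psd0 psdD). Qed.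

Lemma psd_congr (S : op R n) A : psdmx A -> psdmx (S^t* *m A *m S).
Proof.
move=> Ap v; have := Ap (S *m v).
by rewrite adjmxM !mulmxA.
Qed.

Lemma psd1 : psdmx (1%:M : op R n).
Proof.
move=> v; rewrite mulmx1 mxE sumr_ge0// => i _.
by rewrite !mxE mulrC mul_conjC_ge0.
Qed.

Lemma psd_rank1 (v : 'cV[R[i]]_n) : psdmx (v *m v^t*).
Proof.
move=> w; rewrite -mulmxA -mulmxA.
have -> : v^t* *m w = (w^t* *m v)^t* by rewrite adjmxM trmxCK.
rewrite mulmxA mxE big_ord1 [X in _ * X]mxE [X in _ * _ X]mxE.
by rewrite mul_conjC_ge0.
Qed.

Lemma psd_mxfun f A : (forall i, 0 <= f (spec_val A i)) -> psdmx (mxfun f A).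
Proof.
move=> f0; apply: psd_sum => i _; apply: psdZ => //; exact: psd_spec_proj.
Qed.

Lemma spec_valE A i : A^t* = A ->
  (spec_val A i)%:C = (row i (spectralmx A) *m A *m (row i (spectralmx A))^t*) 0 0.
Proof.
move=> Ah; rewrite -spec_proj_qform spec_proj_mull// mxtraceZ trace_spec_proj.
by rewrite mulr1.
Qed.

Lemma psd_spec_val A i : psdmx A -> 0 <= spec_val A i.
Proof.
move=> Ap; rewrite -ler0c (spec_valE i (psd_herm Ap)).
by have := Ap ((row i (spectralmx A))^t*); rewrite trmxCK.
Qed.

Lemma psd_spec A : A^t* = A -> (forall i, 0 <= spec_val A i) -> psdmx A.
Proof.
by move=> Ah h; rewrite -(@mxfun_id _ _ id A Ah)//; exact: psd_mxfun.
Qed.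

Lemma psd_traceM A B : psdmx A -> psdmx B -> 0 <= \tr (A *m B).
Proof.
move=> Ap Bp; rewrite (herm_spec (psd_herm Ap)) mulmx_suml raddf_sum.
apply: sumr_ge0 => i _; rewrite -scalemxAl /= mxtraceZ mulr_ge0 ?ler0c ?psd_spec_val//.
rewrite spec_proj_qform.
by have := Bp ((row i (spectralmx A))^t*); rewrite trmxCK.
Qed.

Lemma psd_hsip A B : psdmx A -> psdmx B -> 0 <= hsip A B.
Proof. by move=> Ap Bp; rewrite /hsip psd_herm//; exact: psd_traceM. Qed.

Lemma psd_hsre A B : psdmx A -> psdmx B -> 0 <= hsre A B.
Proof.
by move=> Ap Bp; have := psd_hsip Ap Bp; rewrite ge0_complexE => /andP[].
Qed.

Lemma overlap_ge0 A B i k : 0 <= overlap A B i k.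
Proof. by apply: psd_hsre; exact: psd_spec_proj. Qed.

Lemma psdB_spec_val A B r i : A^t* = A -> psdmx (A - B) -> psdmx (B - r%:C%:M) ->
  r <= spec_val A i.
Proof.
move=> Ah AB Br; have := psdD AB Br; rewrite addrA subrK => h.
have := h ((row i (spectralmx A))^t*).
rewrite trmxCK mulmxBr mulmxBl mxE -spec_valE// mxE mul_mx_scalar -scalemxAl mxE.
have /row_unitarymxP/(_ i i) := spectral_unitarymx A.
rewrite dotmxE eqxx => ->; rewrite mulr1 subr_ge0.
by rewrite lecR.
Qed.

Lemma psd_spec_sub A r : A^t* = A -> (forall i, r <= spec_val A i) ->
  psdmx (A - r%:C%:M).
Proof.
move=> Ah h; rewrite -(@mxfun_id _ _ id A Ah)//.
have -> : (r%:C%:M : op R n) = r%:C *: \sum_i spec_proj A i.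
  by rewrite spec_proj_sum scalemx1.
rewrite scaler_sumr /mxfun -sumrB; apply: psd_sum => i _.
rewrite -scalerBl -rmorphB; apply: psdZ; last exact: psd_spec_proj.
by rewrite subr_ge0.
Qed.

Lemma unit_spec_val A i : A^t* = A -> A \in unitmx -> spec_val A i != 0.
Proof.
move=> Ah Au; apply/eqP => h.
have := spec_proj_mulr i Ah; rewrite h scale0r => /(congr1 (mulmx (invmx A))).
rewrite mulKmx// mulmx0 => /(congr1 mxtrace).
by rewrite trace_spec_proj mxtrace0 => /eqP; rewrite oner_eq0.
Qed.

Lemma mxfun_unit f A : (forall i, f (spec_val A i) != 0) -> mxfun f A \in unitmx.
Proof.
move=> h.
have : mxfun f A *m mxfun (fun x => (f x)^-1) A = 1%:M.
  by rewrite mxfunM mxfun1// => i; rewrite divff.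
by case/mulmx1_unit.
Qed.

Lemma unit_spec A : A^t* = A -> (forall i, spec_val A i != 0) -> A \in unitmx.
Proof.
by move=> Ah h; rewrite -(@mxfun_id _ _ id A Ah)// mxfun_unit.
Qed.

End Positivity.

(** * Trace inequalities for powers *)

Section PowerInequalities.
Variable R : realType.
Implicit Types (p q m M x y : R).

Lemma within_continuous_is_derive (f df : R -> R) (a b : R) :
  (forall x, a <= x <= b -> is_derive x 1 f (df x)) ->
  {within `[a, b], continuous f}%classic.
Proof.
move=> h; apply: derivable_within_continuous => x; rewrite in_itv/= => /h.
by case.
Qed.

Lemma MVT_le (f df : R -> R) (a b : R) : a <= b ->
  (forall x, a <= x <= b -> is_derive x 1 f (df x)) ->
  exists2 c, a <= c <= b & f b - f a = df c * (b - a).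
Proof.
move=> ab h; have [||c] := @MVT_segment _ f df a b ab.
- by move=> x; rewrite in_itv/= => /andP[ax xb]; apply: h; rewrite !ltW.
- exact: within_continuous_is_derive h.
- by rewrite in_itv/= => cab E; exists c.
Qed.

Lemma powR_MVT q x y : 0 < x -> x <= y ->
  exists2 c, x <= c <= y & y `^ q - x `^ q = q * c `^ (q - 1) * (y - x).
Proof.
move=> x0 xy; apply: (@MVT_le (fun z => z `^ q) (fun z => q * z `^ (q - 1))) => //.
by move=> z /andP[xz _]; apply: is_derive1_powR; exact: lt_le_trans xz.
Qed.

Lemma ler_powR_le0 q x y : q <= 0 -> 0 < x -> x <= y -> y `^ q <= x `^ q.
Proof.
move=> q0 x0 xy; have y0 := lt_le_trans x0 xy.
by rewrite /powR !gt_eqF// ler_expR ler_wnM2l// ler_ln ?posrE.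
Qed.

(** The derivative q x^(q-1) decreases in x, so its value at the lower end m is the largest. The
    constant blows up as m tends to 0, which is why the spectra along the flow are kept above a
    fixed level. *)
Lemma powR_lipschitz q m x y : 0 <= q <= 1 -> 0 < m -> m <= x -> m <= y ->
  `|x `^ q - y `^ q| <= q * m `^ (q - 1) * `|x - y|.
Proof.
move=> /andP[q0 q1] m0.
wlog yx : x y / y <= x.
  move=> H mx my; case: (leP y x) => [|/ltW] yx; first exact: H.
  by rewrite distrC [X in _ * X]distrC; exact: H.
move=> mx my; have y0 := lt_le_trans m0 my.
have [c /andP[yc cx] ->] := powR_MVT q y0 yx.
rewrite normrM ler_wpM2r// ger0_norm ?mulr_ge0 ?powR_ge0// ler_wpM2l//.
by apply: ler_powR_le0; rewrite ?subr_le0// (le_trans my).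
Qed.

(** The same decreasing derivative, now bounded below by its value at the upper end M. *)
Lemma powR_increment_ge q M x y : 0 <= q <= 1 -> 0 < y -> y <= x -> x <= M ->
  q * M `^ (q - 1) * (x - y) <= x `^ q - y `^ q.
Proof.
move=> /andP[q0 q1] y0 yx xM.
have [c /andP[yc cx] ->] := powR_MVT q y0 yx.
rewrite ler_wpM2r ?subr_ge0// ler_wpM2l//.
by apply: ler_powR_le0; rewrite ?subr_le0// ?(lt_le_trans y0)// (le_trans cx).
Qed.

(** Because p <= 2, the second derivative p (p-1) x^(p-2) on (0, M] is least at M; this is Taylor's
    bound with that value. *)
Lemma powR_strongly_convex p M x y : 1 < p <= 2 -> 0 <= x <= M -> 0 < y <= M ->
  p * (p - 1) / 2 * M `^ (p - 2) * (x - y) ^+ 2 <=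
  x `^ p - y `^ p - p * y `^ (p - 1) * (x - y).
Proof.
move=> /andP[p1 p2] /andP[x0 xM] /andP[y0 yM].
have q01 : 0 <= p - 1 <= 1 by apply/andP; split; lra.
have p12 : p - 1 - 1 = p - 2 by ring.
(* The derivative formula does not reach x = 0. There the claim reduces to (p/2) M^(p-2) <= y^(p-2),
   true since p/2 <= 1 and y <= M. *)
have [<-|xN0] := eqVneq 0 x.
  rewrite powR0 ?gt_eqF ?(lt_trans _ p1)// !sub0r sqrrN.
  have yp : y `^ p = y `^ (p - 2) * y ^+ 2.
    rewrite -powR_mulrn ?ltW// -powRD ?subrK//; apply/implyP => _.
    by rewrite gt_eqF.
  have yp' : y `^ (p - 1) * y = y `^ p.
    by rewrite -{2}[y]powRr1 ?ltW// -powRD ?subrK//; apply/implyP => _; rewrite gt_eqF.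
  rewrite mulrN opprK -[p * _ * y]mulrA yp' yp.
  have h : M `^ (p - 2) <= y `^ (p - 2) by apply: ler_powR_le0; rewrite ?subr_le0.
  have y2 : 0 <= y ^+ 2 by rewrite sqr_ge0.
  have h1 : M `^ (p - 2) * y ^+ 2 <= y `^ (p - 2) * y ^+ 2 by exact: ler_wpM2r.
  have h2 : 0 <= M `^ (p - 2) * y ^+ 2 by rewrite mulr_ge0 ?powR_ge0.
  set u := y `^ (p - 2) * _ in h1 *; set v := M `^ (p - 2) * y ^+ 2 in h1 h2.
  have -> : p * (p - 1) / 2 * M `^ (p - 2) * y ^+ 2 = p * (p - 1) / 2 * v.
    by rewrite /v mulrA.
  apply: (@le_trans _ _ ((p - 1) * v)).
    by rewrite ler_wpM2r//; nra.
  by apply: (@le_trans _ _ ((p - 1) * u)); [rewrite ler_wpM2l//; lra|lra].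
have {}x0 : 0 < x by rewrite lt_def x0 eq_sym xN0.
set k := p * (p - 1) / 2 * M `^ (p - 2).
(* Up to a constant, the right side minus the left side as a function of x. By [powR_increment_ge]
   it decreases before y and increases after y. *)
pose h (z : R) := z `^ p - (p * y `^ (p - 1)) * z - k * (z - y) ^+ 2.
pose dh (z : R) := p * z `^ (p - 1) - p * y `^ (p - 1) - 2 * k * (z - y).
have hd (z : R) : 0 < z -> is_derive z 1 h (dh z).
  move=> z0; rewrite /h /dh.
  have d1 := is_derive1_powR p z0.
  apply: is_derive_eq.
  by rewrite /GRing.scale /=; ring.
suff : h y <= h x by rewrite /h subrr expr0n/= mulr0 subr0; lra.
have [xy|/ltW yx] := leP x y.
  have [|c /andP[xc cy] E] := @MVT_le h dh x y xy.
    by move=> z /andP[xz _]; apply: hd; exact: lt_le_trans xz.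
  have c0 := lt_le_trans x0 xc.
  have := powR_increment_ge q01 c0 cy yM; rewrite p12 => H.
  have : dh c <= 0 by rewrite /dh /k; nra.
  by move=> dc; rewrite -subr_le0 E mulr_le0_ge0// subr_ge0.
have [|c /andP[yc cx] E] := @MVT_le h dh y x yx.
  by move=> z /andP[xz _]; apply: hd; exact: lt_le_trans xz.
have := powR_increment_ge q01 y0 yc (le_trans cx xM); rewrite p12 => H.
have : 0 <= dh c by rewrite /dh /k; nra.
by move=> dc; rewrite -subr_ge0 E mulr_ge0// subr_ge0.
Qed.

End PowerInequalities.

Lemma sqr_hsnormB (R : realType) n (X Y : op R n) :
  hsnorm (X - Y) ^+ 2 = hsre X X + hsre Y Y - 2 * hsre X Y.
Proof. by rewrite sqr_hsnorm hsreBl !hsreBr [hsre Y X]hsreC; ring. Qed.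

Section TraceInequalities.
Variables (R : realType) (n : nat).
Local Open Scope complex_scope.
Local Open Scope sesquilinear_scope.
Implicit Types (A B X Y Z : op R n) (r : R) (f g : R -> R).

Lemma mxfun_comp f g A : mxfun f (mxfun g A) = mxfun (f \o g) A.
Proof.
apply: mxfun_resolution; [exact: mxfun_adj|exact: spec_proj_sum|].
by move=> k; exact: mxfun_spec_proj.
Qed.

Lemma sum_spec_val_overlapl f A B : \sum_i f (spec_val A i) =
  \sum_i \sum_k f (spec_val A i) * overlap A B i k.
Proof.
by apply: eq_bigr => i _; rewrite -mulr_sumr overlap_suml mulr1.
Qed.

Lemma sum_spec_val_overlapr f A B : \sum_k f (spec_val B k) =
  \sum_i \sum_k f (spec_val B k) * overlap A B i k.
Proof.
rewrite exchange_big /=.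
by apply: eq_bigr => k _; rewrite -mulr_sumr overlap_sumr mulr1.
Qed.

Lemma hsre_mxfun_same f g A :
  hsre (mxfun f A) (mxfun g A) = \sum_i f (spec_val A i) * g (spec_val A i).
Proof. by rewrite /hsre /hsip mxfun_adj mxfunM trace_mxfun. Qed.

(** After expanding the square, the sums over a single spectrum become double sums because the
    overlaps are doubly stochastic; the squares are then completed term by term. *)
Lemma sqr_hsnorm_mxfunB f g A B : hsnorm (mxfun f A - mxfun g B) ^+ 2 =
  \sum_i \sum_k (f (spec_val A i) - g (spec_val B k)) ^+ 2 * overlap A B i k.
Proof.
have := hsre_mxfun f g A B; have := hsre_mxfun_same g g B.
have := hsre_mxfun_same f f A; move: (mxfun f A) (mxfun g B) => X Y E1 E2 E3.
rewrite sqr_hsnormB E1 E2 E3.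
rewrite [X in X + _ - _](sum_spec_val_overlapl (fun x => f x * f x) A B).
rewrite [X in _ + X - _](sum_spec_val_overlapr (fun x => g x * g x) A B).
rewrite mulr_sumr -big_split -sumrB; apply: eq_bigr => i _.
rewrite mulr_sumr -big_split -sumrB; apply: eq_bigr => k _.
by rewrite /=; ring.
Qed.

(** In the Hilbert-Schmidt norm the scalar constant carries over unchanged: the double sums of
    [sqr_hsnorm_mxfunB] for f and for the identity are compared termwise. *)
Lemma mxfun_lipschitz f A B l : 0 <= l -> A^t* = A -> B^t* = B ->
  (forall i k, `|f (spec_val A i) - f (spec_val B k)| <=
    l * `|spec_val A i - spec_val B k|) ->
  hsnorm (mxfun f A - mxfun f B) <= l * hsnorm (A - B).
Proof.
move=> l0 Ah Bh h.
rewrite -(@ler_pXn2r _ 2) ?nnegrE ?mulr_ge0 ?hsnorm_ge0// exprMn.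
rewrite -{2}(@mxfun_id _ _ id A Ah)// -{2}(@mxfun_id _ _ id B Bh)//.
have := sqr_hsnorm_mxfunB id id A B; move: (mxfun id A - _) => X ->.
rewrite sqr_hsnorm_mxfunB mulr_sumr; apply: ler_sum => i _.
rewrite mulr_sumr; apply: ler_sum => k _; rewrite mulrA ler_wpM2r ?overlap_ge0//.
rewrite -exprMn -real_normK ?num_real// -[leRHS]real_normK ?num_real//.
by rewrite ler_pXn2r ?nnegrE// normrM [`|l|]ger0_norm.
Qed.

(* Klein's inequality, by Peierls' argument: expanding both sides in the two
   eigenbases leaves the scalar inequality with nonnegative weights. *)
Lemma klein_mxfun f g kappa A B : A^t* = A -> B^t* = B ->
  (forall i k, kappa * (spec_val A i - spec_val B k) ^+ 2 <=
    f (spec_val A i) - f (spec_val B k) -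
    g (spec_val B k) * (spec_val A i - spec_val B k)) ->
  kappa * hsnorm (A - B) ^+ 2 <=
  \sum_i f (spec_val A i) - \sum_k f (spec_val B k) - hsre (mxfun g B) (A - B).
Proof.
move=> Ah Bh h.
have E1 : hsnorm (A - B) ^+ 2 = \sum_i \sum_k
    (spec_val A i - spec_val B k) ^+ 2 * overlap A B i k.
  by rewrite -(sqr_hsnorm_mxfunB id id) !mxfun_id.
have E2 : hsre (mxfun g B) A = \sum_i \sum_k
    g (spec_val B k) * spec_val A i * overlap A B i k.
  rewrite hsreC -{1}(@mxfun_id _ _ id A Ah)// hsre_mxfun.
  by apply: eq_bigr => i _; apply: eq_bigr => k _; rewrite [_ * g _]mulrC.
have E3 : hsre (mxfun g B) B = \sum_i \sum_k
    g (spec_val B k) * spec_val B k * overlap A B i k.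
  rewrite -{2}(@mxfun_id _ _ id B Bh)// hsre_mxfun_same.
  exact: (sum_spec_val_overlapr (fun x => g x * x)).
rewrite hsreBr E1 E2 E3 (sum_spec_val_overlapl f A B) (sum_spec_val_overlapr f A B).
rewrite -!sumrB mulr_sumr; apply: ler_sum => i _.
rewrite -!sumrB mulr_sumr; apply: ler_sum => k _.
rewrite -mulrBl -mulrBl -mulrBl mulrA ler_wpM2r ?overlap_ge0//.
by apply: le_trans (h i k) _; rewrite mulrBr.
Qed.

Definition trpow (p : R) A : R := \sum_i spec_val A i `^ p.

Lemma trpow_strongly_convex p M A B : 1 < p <= 2 -> A^t* = A -> B^t* = B ->
  (forall i, 0 <= spec_val A i <= M) -> (forall k, 0 < spec_val B k <= M) ->
  p * (p - 1) / 2 * M `^ (p - 2) * hsnorm (A - B) ^+ 2 <=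
  trpow p A - trpow p B - p * hsre (mxpow B (p - 1)) (A - B).
Proof.
move=> p12 Ah Bh hA hB; rewrite -hsreZl /mxpow -mxfun_scale.
apply: (@klein_mxfun (fun x => x `^ p)) => // i k.
exact: powR_strongly_convex.
Qed.

Lemma trpow_klein p A B : 1 < p <= 2 -> A^t* = A -> B^t* = B ->
  (forall i, 0 <= spec_val A i) -> (forall k, 0 < spec_val B k) ->
  p * hsre (mxpow B (p - 1)) (A - B) <= trpow p A - trpow p B.
Proof.
move=> p12 Ah Bh hA hB.
(* Some common bound for both spectra, only to invoke the strongly convex version; its quadratic
   gain is then dropped. *)
pose M := \sum_i spec_val A i + \sum_k spec_val B k.
have SA : 0 <= \sum_i spec_val A i by exact: sumr_ge0.
have SB : 0 <= \sum_i spec_val B i by apply: sumr_ge0 => i _; exact/ltW.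
have HA i : 0 <= spec_val A i <= M.
  rewrite hA /M (bigD1 i)//= -addrA lerDl addr_ge0//.
  by apply: sumr_ge0.
have HB i : 0 < spec_val B i <= M.
  rewrite hB /M addrC (bigD1 i)//= -addrA lerDl addr_ge0//.
  by apply: sumr_ge0 => k _; exact: ltW.
have := trpow_strongly_convex p12 Ah Bh HA HB.
rewrite -subr_ge0 => /le_trans H; rewrite -subr_ge0.
apply: le_trans (_ : 0 <= p * (p - 1) / 2 * M `^ (p - 2) * hsnorm (A - B) ^+ 2) _.
  rewrite mulr_ge0 ?sqr_ge0// mulr_ge0 ?powR_ge0//.
  by case/andP: p12 => p1 p2; rewrite divr_ge0// mulr_ge0//; lra.
by rewrite -subr_ge0; exact: H.
Qed.

End TraceInequalities.

(** * Reparametrization by polynomials *)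

Section RealAnalysis.
Variable R : realType.
Local Open Scope classical_set_scope.

Lemma is_derive_continuous (f : R -> R) (x a : R) :
  is_derive x 1 f a -> {for x, continuous f}.
Proof.
by case=> h _; apply: differentiable_continuous; exact/derivable1_diffP.
Qed.

Lemma is_derive_horner (q : {poly R}) (x : R) :
  is_derive x 1 (horner q) (q^`()).[x].
Proof.
by rewrite derivE derive1E; apply/derivableP; exact: derivable_horner.
Qed.

Lemma sum_continuous N (f : 'I_N -> R -> R) (x : R) :
  (forall k, {for x, continuous (f k)}) ->
  {for x, continuous (fun z => \sum_k f k z)}.
Proof.
rewrite /prop_for /continuous_at => fc; elim: (index_enum _) => [|k s IH].
  by under eq_fun do rewrite big_nil; rewrite big_nil; exact: cvg_cst.
under eq_fun do rewrite big_cons; rewrite big_cons.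
by apply: cvgD; [exact: fc|exact: IH].
Qed.

(* The functions e_k enter through their difference quotients, so that the two
   subgradient inequalities squeeze that of f. *)
Lemma is_derive_subgradient (N : nat) (e de c : 'I_N -> R -> R) (f : R -> R)
    (t : R) : 0 < t ->
  (forall k, is_derive t 1 (e k) (de k t)) ->
  (forall k, {for t, continuous (c k)}) ->
  (forall u v, 0 <= u -> 0 <= v ->
     \sum_k c k u * (e k v - e k u) <= f v - f u) ->
  is_derive t 1 f (\sum_k c k t * de k t).
Proof.
move=> t0 ed cc sub.
have /choice[q hq] k : exists q, [/\ forall z, e k z - e k t = q z * (z - t),
    {for t, continuous q} & q t = de k t].
  by have /is_derive1_caratheodory := ed k.
set a := \sum_k c k t * de k t.
apply/is_derive1_caratheodory.
exists (fun z => if z == t then a else (f z - f t) / (z - t)); split.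
- move=> z; case: eqP => [->|/eqP zt]; first by rewrite !subrr mulr0.
  by rewrite divfK// subr_eq0.
(* The subgradient at t bounds the increment of f from below with coefficients c_k(t), the one at z
   bounds it from above with coefficients c_k(z). Both sums tend to a; dividing by z - t swaps their
   roles when z < t. *)
- have cA : {for t, continuous (fun z => \sum_k c k t * q k z)}.
    apply: sum_continuous => k; apply: cvgM; first exact: cvg_cst.
    by have [] := hq k.
  have cB : {for t, continuous (fun z => \sum_k c k z * q k z)}.
    apply: sum_continuous => k; apply: cvgM; first exact: cc.
    by have [] := hq k.
  rewrite /prop_for /continuous_at eqxx; apply/cvgrPdist_lt => e0 e00.
  have aE : \sum_k c k t * q k t = a.
    by apply: eq_bigr => k _; have [_ _ ->] := hq k.
  move: cA cB; rewrite /prop_for /continuous_at/= aE => /cvgrPdist_lt/(_ _ e00) cA.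
  move=> /cvgrPdist_lt/(_ _ e00) cB.
  near=> z.
  have zA : `|a - \sum_k c k t * q k z| < e0 by near: z.
  have zB : `|a - \sum_k c k z * q k z| < e0 by near: z.
  have z0 : 0 < z by near: z; exact: lt_nbhsr.
  case: eqP => [_|/eqP zt]; first by rewrite subrr normr0.
  have lo : (\sum_k c k t * q k z) * (z - t) <= f z - f t.
    apply: le_trans (sub t z (ltW t0) (ltW z0)).
    rewrite mulr_suml le_eqVlt; apply/orP; left; apply/eqP; apply: eq_bigr => k _.
    by have [-> _ _] := hq k; rewrite mulrA.
  have hi : f z - f t <= (\sum_k c k z * q k z) * (z - t).
    rewrite -lerN2 opprB.
    apply: le_trans (sub z t (ltW z0) (ltW t0)).
    rewrite -mulrN opprB mulr_suml le_eqVlt; apply/orP; left; apply/eqP.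
    apply: eq_bigr => k _; rewrite -[e k t - _]opprB.
    by have [-> _ _] := hq k; rewrite -mulrN opprB mulrA.
  move: zA zB; rewrite !ltr_distlC; move: (\sum_k _) (\sum_k _) lo hi => A B lo hi.
  move=> /andP[A1 A2] /andP[B1 B2].
  have [zt0|tz0] : z - t < 0 \/ 0 < z - t.
    by have : z - t != 0; [rewrite subr_eq0|case: ltgtP; auto].
  - apply/andP; split.
      by apply: lt_le_trans B1 _; rewrite ler_ndivlMr.
    by apply: le_lt_trans A2; rewrite ler_ndivrMr.
  - apply/andP; split.
      by apply: lt_le_trans A1 _; rewrite ler_pdivlMr.
    by apply: le_lt_trans B2; rewrite ler_pdivrMr.
- by rewrite eqxx.
Unshelve. all: by end_near. Qed.

(** Heine-Cantor with only x confined to the segment, continuity being assumed in the topology of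
    the whole line. The freedom of y matters because the polynomial time change may leave [a, b]. *)
Lemma segment_uniform_continuity (f : R -> R) (a b eps : R) : 0 < eps ->
  (forall x, a <= x <= b -> {for x, continuous f}) ->
  exists2 del : R, 0 < del & forall x y, a <= x <= b -> `|x - y| < del ->
    `|f x - f y| < eps.
Proof.
move=> e0 cf.
have := (@compact_near_coveringP R `[a, b]).1 (@segment_compact R a b).
move=> /(_ R (0^'+) (fun del x => forall y, `|x - y| < del -> `|f x - f y| < eps)).
case=> [x|del /= del0 H].
  rewrite /= in_itv/= => /cf /cvgrPdist_lt /(_ (eps / 2)).
  rewrite divr_gt0// => /(_ isT) [r /= r0 rH].
  exists (ball x (r / 2), [set d | 0 < d < r / 2]) => /=.
    split; first by apply: nbhsx_ballx; rewrite divr_gt0.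
    near=> d; apply/andP; split => //.
    by near: d; apply: nbhs_right_lt; rewrite divr_gt0.
  move=> [z d] /= [xz /andP[d0 dr]] y zy.
  have h1 : `|f x - f z| < eps / 2.
    by apply: rH; apply: lt_trans xz _; rewrite ltr_pdivrMr// ltr_pMr// ltr1n.
  have h2 : `|f x - f y| < eps / 2.
    apply: rH => /=; rewrite -(subrKA z) (splitr r).
    apply: le_lt_trans (ler_normD _ _) _.
    by rewrite ltrD//; exact: lt_trans zy _.
  rewrite -(subrKA (f x)) (splitr eps); apply: le_lt_trans (ler_normD _ _) _.
  by rewrite ltrD// distrC.
exists (del / 2) => [|x y xab xy]; first by rewrite divr_gt0.
apply: (H (del / 2)) => //=.
  rewrite sub0r normrN gtr0_norm ?divr_gt0//.
  by rewrite ltr_pdivrMr// ltr_pMr// ltr1n.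
by rewrite divr_gt0.
Unshelve. all: by end_near. Qed.

(** The Bernstein polynomial of the values g 0, ..., g n: the mean of g over a binomial variable
    with n trials and success probability X, written by conditioning on one trial. Monotonicity and
    moments then follow by induction, without binomial coefficients. *)
Fixpoint bernstein (n : nat) (g : nat -> R) : {poly R} :=
  if n is m.+1 then
    'X * bernstein m (fun k => g k.+1) + (1 - 'X) * bernstein m g
  else (g 0)%:P.

Lemma bernsteinS m g x : (bernstein m.+1 g).[x] =
  x * (bernstein m (fun k => g k.+1)).[x] + (1 - x) * (bernstein m g).[x].
Proof. by rewrite /= !hornerE. Qed.

Lemma bernstein_le n g h x : 0 <= x <= 1 ->
  (forall k, (k <= n)%N -> g k <= h k) -> (bernstein n g).[x] <= (bernstein n h).[x].
Proof.
move=> /andP[x0 x1]; elim: n g h => [|n IH] g h gh.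
  by rewrite /= !hornerE; exact: gh.
rewrite !bernsteinS lerD// ler_wpM2l// ?subr_ge0//; apply: IH => k kn; apply: gh => //.
exact: leqW.
Qed.

Lemma bernsteinN n g x : (bernstein n (fun k => - g k)).[x] = - (bernstein n g).[x].
Proof.
elim: n g => [|n IH] g; first by rewrite /= !hornerE.
by rewrite !bernsteinS !IH; ring.
Qed.

(** The binomial moments: mean n x and variance n x (1 - x). *)
Lemma bernstein_quadratic n c0 c1 c2 x :
  (bernstein n (fun k => c0 + c1 * k%:R + c2 * k%:R ^+ 2)).[x] =
  c0 + c1 * (n%:R * x) + c2 * (n%:R * x * (1 - x) + (n%:R * x) ^+ 2).
Proof.
elim: n c0 c1 c2 => [|n IH] c0 c1 c2; first by rewrite /= hornerC !mulr0n; ring.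
rewrite bernsteinS IH.
have -> : (fun k => c0 + c1 * k.+1%:R + c2 * k.+1%:R ^+ 2) =
    (fun k => (c0 + c1 + c2) + (c1 + 2 * c2) * k%:R + c2 * k%:R ^+ 2) :> (nat -> R).
  by apply/funext => k; rewrite -natr1; ring.
by rewrite IH -natr1; ring.
Qed.

Lemma weierstrass01 (f : R -> R) (eps : R) : 0 < eps ->
  (forall x, 0 <= x <= 1 -> {for x, continuous f}) ->
  exists q : {poly R}, forall x, 0 <= x <= 1 -> `|f x - q.[x]| <= eps.
Proof.
move=> e0 cf.
have [del del0 unif] : exists2 del : R, 0 < del & forall x y, 0 <= x <= 1 ->
    `|x - y| < del -> `|f x - f y| < eps / 2.
  by apply: segment_uniform_continuity => //; rewrite divr_gt0.
have cfn : {within `[0, 1], continuous (fun x => `|f x|)}.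
  apply: continuous_in_subspaceT => x; rewrite inE/= in_itv/= => /cf fx.
  exact: (cvg_norm fx).
have [c c01 cmax] := EVT_max (@ler01 R) cfn.
set M : R := `|f c|.
have fM x : 0 <= x <= 1 -> `|f x| <= M by move=> x01; apply: cmax; rewrite in_itv.
have M0 : 0 <= M by exact: normr_ge0.
(* Chebyshev's argument: K del^2 = 2 M, so K (y - x)^2 dominates the oscillation of f as soon as y
   is at distance del from x. *)
pose K : R := 2 * M / del ^+ 2.
have K0 : 0 <= K by rewrite divr_ge0 ?sqr_ge0// mulr_ge0.
(* The variance contributes K x (1 - x) / n, which this n brings below eps / 2. *)
have [n nK] : exists n : nat, 2 * K / eps < n%:R.
  by exists (Num.truncn (2 * K / eps)).+1; exact: truncnS_gt.
have n0 : 0 < n%:R :> R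
  by apply: le_lt_trans nK; apply: divr_ge0; [exact: mulr_ge0|exact: ltW].
have nN0 : n%:R != 0 :> R by rewrite gt_eqF.
exists (bernstein n (fun k => f (k%:R / n%:R))) => x x01.
have key k : (k <= n)%N ->
    `|f x - f (k%:R / n%:R)| <= eps / 2 + K * (k%:R / n%:R - x) ^+ 2.
  move=> kn.
  have kn01 : 0 <= (k%:R / n%:R : R) <= 1.
    by rewrite divr_ge0//= ler_pdivrMr// mul1r ler_nat.
  have [/unif-/(_ x01)/ltW h|far] := ltP `|x - k%:R / n%:R| del.
    by rewrite (le_trans h)// lerDl mulr_ge0// sqr_ge0.
  apply: (@le_trans _ _ (2 * M)).
    by apply: le_trans (ler_normB _ _) _; have := fM _ x01; have := fM _ kn01; lra.
  rewrite ler_wpDl ?divr_ge0 ?(ltW e0)//.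
  rewrite /K -mulrA ler_peMr ?mulr_ge0//.
  rewrite mulrC ler_pdivlMr ?exprn_gt0// mul1r -[leRHS]real_normK ?num_real//.
  by rewrite distrC ler_pXn2r ?nnegrE// ltW.
have E1 : (bernstein n (fun k => eps / 2 + K * (k%:R / n%:R - x) ^+ 2)).[x] <= eps.
  have -> : (fun k => eps / 2 + K * (k%:R / n%:R - x) ^+ 2) =
     (fun k => (eps / 2 + K * x ^+ 2) + (- 2 * K * x / n%:R) * k%:R +
        (K / n%:R ^+ 2) * k%:R ^+ 2) :> (nat -> R).
    by apply/funext => k; field.
  rewrite bernstein_quadratic.
  have -> : eps / 2 + K * x ^+ 2 + - 2 * K * x / n%:R * (n%:R * x) +
     K / n%:R ^+ 2 * (n%:R * x * (1 - x) + (n%:R * x) ^+ 2) =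
     eps / 2 + K / n%:R * (x * (1 - x)) by field.
  rewrite [leRHS]splitr lerD2l.
  have xx : x * (1 - x) <= 1 by case/andP: x01 => ? ?; nra.
  apply: (@le_trans _ _ (K / n%:R)).
    by rewrite -[leRHS]mulr1 ler_wpM2l// divr_ge0// ltW.
  rewrite ler_pdivrMr// ltW// mulrAC ltr_pdivlMr//.
  by move: nK; rewrite ltr_pdivrMr//; lra.
have fx : (bernstein n (fun k => f x + 0 * k%:R + 0 * k%:R ^+ 2)).[x] = f x.
  by rewrite bernstein_quadratic; ring.
have addE g h : (bernstein n (fun k => g k + h k)).[x] =
    (bernstein n g).[x] + (bernstein n h).[x].
  elim: (n) g h => [|m IH] g h; first by rewrite /= !hornerE.
  by rewrite !bernsteinS IH IH; ring.
rewrite -{1}fx -bernsteinN -addE ler_norml; apply/andP; split; last first.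
  apply: le_trans E1; apply: bernstein_le => // k kn.
  rewrite !mul0r !addr0; apply: le_trans (key k kn); exact: ler_norm.
rewrite lerNl -bernsteinN; apply: le_trans E1; apply: bernstein_le => // k kn.
by rewrite !mul0r !addr0; apply: le_trans (key k kn); rewrite -normrN; exact: ler_norm.
Qed.

Lemma poly_primitive (q0 : {poly R}) (a : R) :
  exists q : {poly R}, deriv q = q0 /\ q.[0] = a.
Proof.
exists (a%:P + \poly_(i < (size q0).+1) (if i is j.+1 then q0`_j / j.+1%:R else 0)).
split; last first.
  by rewrite !hornerE horner_coef0 coef_poly/= addr0.
apply/polyP => i; rewrite derivD derivC add0r coef_deriv coef_poly ltnS.
case: ltnP => [_|h]; last by rewrite mul0rn nth_default.
by rewrite -[LHS]mulr_natr divfK// pnatr_eq0.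
Qed.

(* The curve s |-> t(s) for which sqrt Phi decreases at constant rate from a to b
   satisfies t'^2 h(t) <= Phi a / alpha; the polynomial q is close to it in the
   C^1 sense. *)
Lemma constant_rate_reparametrization (Phi h : R -> R) (alpha a b eta : R) :
  0 < alpha -> 0 < a -> a < b -> 0 < eta ->
  (forall t : R, 0 < t -> is_derive t 1 Phi (- h t)) ->
  (forall t, 0 < t -> {for t, continuous h}) ->
  (forall t, 0 < t -> 0 < Phi t) ->
  (forall t, 0 < t -> 4 * alpha * Phi t <= h t) ->
  exists q : {poly R}, [/\ q.[0] = a, b - eta <= q.[1] &
    forall s, 0 <= s <= 1 -> 0 < q.[s] /\
      (deriv q).[s] ^+ 2 * h q.[s] <= Phi a / alpha + eta].
Proof.
move=> alpha0 a0 ab eta0 dPhi ch Phi0 hPhi.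
have h0 t : 0 < t -> 0 < h t.
  by move=> t0; apply: lt_le_trans (hPhi t t0); rewrite !mulr_gt0// Phi0.
pose G t : R := Num.sqrt (Phi t).
have G0 t : 0 < t -> 0 < G t by move=> t0; rewrite sqrtr_gt0 Phi0.
have GG t : 0 < t -> G t ^+ 2 = Phi t by move=> t0; rewrite sqr_sqrtr// ltW// Phi0.
have dG (t : R) : 0 < t -> is_derive t 1 G (- (h t / (2 * G t))).
  move=> t0; have d1 := dPhi t t0; have d2 := is_derive1_sqrt (Phi0 t t0).
  have -> : - (h t / (2 * G t)) = (2 * Num.sqrt (Phi t))^-1 * - h t.
    by rewrite mulrN mulrC.
  exact: is_derive1_comp d2 d1.
have Gdecr x y : 0 < x -> x < y -> G y < G x.
  move=> x0 xy; have [|c /andP[xc cy] E] :=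
    @MVT_le _ G (fun t => - (h t / (2 * G t))) x y (ltW xy).
    by move=> z /andP[xz _]; apply: dG; exact: lt_le_trans xz.
  have c0 := lt_le_trans x0 xc.
  by rewrite -subr_lt0 E /= mulNr oppr_lt0 mulr_gt0 ?subr_gt0// divr_gt0 ?h0// mulr_gt0// G0.
pose N : R := G a - G b.
have N0 : 0 < N by rewrite subr_gt0 Gdecr.
(* [psi] increases from 0 at a to 1 at b; its inverse is the time change along which sqrt Phi is
   affine. *)
pose psi t : R := (G a - G t) / N.
pose dpsi t : R := h t / (2 * G t) / N.
have dpsi0 t : 0 < t -> 0 < dpsi t.
  by move=> t0; rewrite !divr_gt0 ?h0// mulr_gt0// G0.
have dpsiP (t : R) : 0 < t -> is_derive t 1 psi (dpsi t).
  move=> t0; have d1 := dG t t0; rewrite /psi /dpsi; apply: is_derive_eq.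
  by rewrite /GRing.scale /=; ring.
have cG t : 0 < t -> {for t, continuous G} by move=> /dG/is_derive_continuous.
have cdpsi t : 0 < t -> {for t, continuous dpsi}.
  move=> t0; rewrite /prop_for /continuous_at /dpsi; apply: cvgM; last exact: cvg_cst.
  apply: cvgM; first exact: ch.
  apply: cvgV; first by rewrite mulf_neq0// gt_eqF// G0.
  by apply: cvgM; [exact: cvg_cst|exact: cG].
have psi_lt x y : 0 < x -> x < y -> psi x < psi y.
  by move=> x0 xy; rewrite ltr_pM2r ?invr_gt0// ltrD2l ltrN2 Gdecr.
have psi_inj x y : 0 < x -> 0 < y -> psi x = psi y -> x = y.
  move=> x0 y0 E; case: (ltgtP x y) => // xy.
    by have := psi_lt x y x0 xy; rewrite E ltxx.
  by have := psi_lt y x y0 xy; rewrite E ltxx.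
have psia : psi a = 0 by rewrite /psi subrr mul0r.
have psib : psi b = 1 by rewrite /psi divff// gt_eqF.
(* The inverse of [psi]. Searching slightly beyond [a, b] makes it an inverse around the endpoints
   too, as two-sided derivatives there require. *)
pose k s : R := xget a [set t | a / 2 <= t <= b + 1 /\ psi t = s].
have a20 : 0 < a / 2 by rewrite divr_gt0.
have kpsi t : a / 2 <= t <= b + 1 -> k (psi t) = t.
  move=> tab; rewrite /k; case: xgetP => [x _ [/andP[x1 x2] E]|/(_ t)/=[]//].
  by case/andP: tab => t1 t2; apply: psi_inj E; [exact: lt_le_trans x1|exact: lt_le_trans t1].
have itv t : a <= t <= b -> a / 2 <= t <= b + 1 by move=> /andP[? ?]; apply/andP; split; lra.
have kbij s : 0 <= s <= 1 -> exists2 t, a <= t <= b & psi t = s.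
  move=> /andP[s0 s1].
  have [||t] := @IVT R psi a b s (ltW ab).
  - apply: (@within_continuous_is_derive _ _ dpsi) => x /andP[ax _].
    by apply: dpsiP; exact: lt_le_trans ax.
  - by rewrite psia psib /Num.min /Num.max ltr01 s0.
  - by rewrite in_itv/= => tab E; exists t.
have dk (t : R) : a <= t <= b -> is_derive (psi t) 1 k (dpsi t)^-1.
  move=> tab; have t0 : 0 < t by case/andP: tab => at_ _; exact: lt_le_trans at_.
  apply: is_derive_inverse; last by rewrite gt_eqF// dpsi0.
  - near=> z; apply: kpsi; apply/andP; split; apply: ltW.
      by near: z; apply: lt_nbhsr; case/andP: tab => ? ?; lra.
    by near: z; apply: lt_nbhsl; case/andP: tab => ? ?; lra.
  - near=> z; apply: is_derive_continuous (dpsiP z _).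
    by near: z; exact: lt_nbhsr.
  - exact: dpsiP.
pose kap s : R := (dpsi (k s))^-1.
have dks (s : R) : 0 <= s <= 1 -> is_derive s 1 k (kap s).
  by move=> /kbij[t tab <-]; rewrite /kap kpsi ?itv//; exact: dk.
have kab s : 0 <= s <= 1 -> a <= k s <= b.
  by move=> /kbij[t tab <-]; rewrite kpsi ?itv//.
have ks0 s : 0 <= s <= 1 -> 0 < k s.
  by move=> /kab/andP[as_ _]; exact: lt_le_trans as_.
have ckap s : 0 <= s <= 1 -> {for s, continuous kap}.
  move=> s01; rewrite /prop_for /continuous_at /kap.
  apply: cvgV; first by rewrite gt_eqF// dpsi0// ks0.
  apply: (@continuous_comp _ _ _ k dpsi).
    exact: is_derive_continuous (dks s s01).
  by apply: cdpsi; exact: ks0.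
have kap0 s : 0 <= s <= 1 -> 0 < kap s by move=> s01; rewrite invr_gt0 dpsi0// ks0.
(* Here kap = 2 N G / h, so kap^2 h = 4 N^2 Phi / h; the bound follows from 4 alpha Phi <= h and N
   <= G a. *)
have main s : 0 <= s <= 1 -> kap s ^+ 2 * h (k s) <= Phi a / alpha.
  move=> s01; have t0 := ks0 s s01; set t := k s in t0 *.
  have ht0 := h0 t t0; have Gt0 := G0 t t0.
  have -> : kap s ^+ 2 * h t = 4 * Phi t * N ^+ 2 / h t.
    rewrite -GG// /kap /dpsi -/t; field.
    by rewrite !gt_eqF.
  have N2 : N ^+ 2 <= Phi a.
    rewrite -GG// ler_pXn2r ?nnegrE ?(ltW (G0 _ _))// ?ltW//.
    by have := G0 b (lt_trans a0 ab); rewrite /N; lra.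
  rewrite ler_pdivrMr// [leRHS]mulrAC ler_pdivlMr//.
  apply: (@le_trans _ _ (Phi a * (4 * alpha * Phi t))).
    rewrite (_ : 4 * Phi t * _ * _ = N ^+ 2 * (4 * alpha * Phi t)); last by ring.
    by rewrite ler_wpM2r// !mulr_ge0// ltW// Phi0.
  by rewrite ler_wpM2l ?hPhi// ltW// Phi0.
have ckapn : {within `[0, 1], continuous kap}.
  by apply: continuous_in_subspaceT => x; rewrite inE/= in_itv/= => /ckap.
have [c c01 cmax] := EVT_max (@ler01 R) ckapn.
pose K : R := kap c.
have kapK s : 0 <= s <= 1 -> kap s <= K by move=> s01; apply: cmax; rewrite in_itv.
have K0 : 0 < K by apply: kap0; move: c01; rewrite in_itv.
have chn : {within `[a, b], continuous h}.
  apply: continuous_in_subspaceT => x; rewrite inE/= in_itv/= => /andP[ax _].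
  by apply: ch; exact: lt_le_trans ax.
have [d dab dmax] := EVT_max (ltW ab) chn.
pose H : R := h d.
have hH t : a <= t <= b -> h t <= H by move=> tab; apply: dmax; rewrite in_itv.
have H0 : 0 < H.
  by apply: h0; move: dab; rewrite in_itv/= => /andP[ad _]; exact: lt_le_trans ad.
pose e1 : R := Num.min 1 (eta / (2 * K ^+ 2)).
have e10 : 0 < e1 by rewrite lt_min ltr01/= divr_gt0// mulr_gt0// exprn_gt0.
have e11 : e1 <= 1 by rewrite ge_min lexx.
have e1K : K ^+ 2 * e1 <= eta / 2.
  apply: (@le_trans _ _ (K ^+ 2 * (eta / (2 * K ^+ 2)))).
    by rewrite ler_wpM2l ?sqr_ge0// ge_min lexx orbT.
  by rewrite le_eqVlt; apply/orP; left; apply/eqP; field; rewrite gt_eqF.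
have [dh dh0 hunif] : exists2 del : R, 0 < del & forall x y, a <= x <= b ->
    `|x - y| < del -> `|h x - h y| < e1.
  apply: segment_uniform_continuity => // x /andP[ax _].
  by apply: ch; exact: lt_le_trans ax.
(* Chosen so that (2 K + 1) D (H + 1) = eta / 2, the error from perturbing the speed. The other half
   of eta pays, through [e1], for perturbing h. *)
pose D : R := eta / (2 * ((2 * K + 1) * (H + 1))).
have KH0 : 0 < (2 * K + 1) * (H + 1) by rewrite mulr_gt0// addr_gt0// mulr_gt0.
have D0 : 0 < D by rewrite divr_gt0// mulr_gt0.
(* The five bounds serve, in order, to have 2 kap + del <= 2 K + 1, to meet the error budget, to fix
   the end time, to keep q positive and to use the uniform continuity of h. *)
pose del : R := Num.min (Num.min 1 D) (Num.min (Num.min eta (a / 2)) (dh / 2)).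
have del0 : 0 < del by rewrite !lt_min ltr01 D0 eta0 a20/= divr_gt0.
have [del1 [delD [dele [dela deldh]]]] :
    del <= 1 /\ del <= D /\ del <= eta /\ del <= a / 2 /\ del <= dh / 2.
  by rewrite /del !ge_min !lexx !orbT.
(* The speed is approximated and then integrated, so that q and its derivative are both within del
   of their targets on [0, 1]. *)
have [q0 q0P] := weierstrass01 del0 ckap.
have [q [dq qa]] := poly_primitive q0 a.
have qk s : 0 <= s <= 1 -> `|q.[s] - k s| <= del.
  move=> /andP[s0 s1].
  have [|e /andP[e0 es] E] :=
    @MVT_le _ (fun x => q.[x] - k x) (fun x => q0.[x] - kap x) 0 s s0.
    move=> x /andP[x0 xs]; have x01 : 0 <= x <= 1 by rewrite x0 (le_trans xs).
    have d1 := dks x x01; have d2 := is_derive_horner q x; rewrite dq in d2.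
    exact: is_deriveB.
  have k0 : k 0 = a by rewrite -psia kpsi ?itv ?lexx ?ltW.
  move: E; rewrite qa k0 subrr !subr0 => ->.
  rewrite normrM [`|s|]ger0_norm//; apply: le_trans (_ : `|q0.[e] - kap e| <= _).
    by rewrite ler_piMr.
  by rewrite distrC; apply: q0P; rewrite e0 (le_trans es).
exists q; split => //.
  have k1 : k 1 = b by rewrite -psib; apply/kpsi/itv; rewrite lexx ltW.
  have := qk 1; rewrite k1 ler01 lexx => /(_ isT).
  by rewrite ler_norml => /andP[+ _]; lra.
move=> s s01; have := qk s s01; rewrite ler_norml => /andP[qk1 qk2].
have /andP[ka kb] := kab s s01.
split; first lra.
have hd : `|h (k s) - h q.[s]| < e1.
  apply: hunif; first exact: kab.
  by rewrite distrC; apply: le_lt_trans (qk s s01) _; lra.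
have := q0P s s01; rewrite dq; move: (q0.[s]) => v.
have := main s s01; have := kap0 s s01; have := kapK s s01.
have := hH _ (kab s s01); have := h0 _ (ks0 s s01).
have hq0 : 0 < h q.[s] by apply: h0; lra.
move: hd hq0; move: (h (k s)) (h q.[s]) (kap s) => hk hq kp.
rewrite ltr_distlC => /andP[_ hqk] hq0 hk0 hkH kpK kp0 kmain.
rewrite ler_norml => /andP[v1 v2].
have v3 : v ^+ 2 <= (kp + del) ^+ 2.
  rewrite -[leLHS]real_normK ?num_real// ler_pXn2r ?nnegrE//; last lra.
  by rewrite ler_norml; apply/andP; split; lra.
apply: (@le_trans _ _ ((kp + del) ^+ 2 * (hk + e1))).
  by apply: ler_pM; rewrite ?sqr_ge0//; lra.
have -> : (kp + del) ^+ 2 * (hk + e1) =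
  kp ^+ 2 * hk + kp ^+ 2 * e1 + (2 * kp + del) * del * (hk + e1) by ring.
rewrite -addrA lerD// (splitr eta) lerD//.
  by apply: le_trans e1K; rewrite ler_wpM2r ?(ltW e10)// ler_pXn2r ?nnegrE//; lra.
apply: (@le_trans _ _ ((2 * K + 1) * D * (H + 1))).
  have p1 : 0 <= 2 * kp + del by lra.
  apply: ler_pM; [|lra| |lra]; first by rewrite mulr_ge0// ltW.
  by apply: ler_pM => //; [exact: ltW|lra].
by rewrite le_eqVlt; apply/orP; left; apply/eqP; rewrite /D; field; rewrite !gt_eqF//; lra.
Unshelve. all: by end_near. Qed.

End RealAnalysis.

(** * Powers and modular operators *)

Section PositiveDefinite.
Variables (R : realType) (n : nat).
Local Open Scope complex_scope.
Local Open Scope sesquilinear_scope.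
Implicit Types (A B X : op R n) (r s t m : R).

Definition pdmx A : Prop := A^t* = A /\ forall i, 0 < spec_val A i.

Lemma pd_psd A : pdmx A -> psdmx A.
Proof. by case=> Ah A0; apply: psd_spec => // i; exact: ltW. Qed.

Lemma pd_unit A : pdmx A -> A \in unitmx.
Proof. by case=> Ah A0; apply: unit_spec => // i; rewrite gt_eqF. Qed.

Lemma psd_unit_pd A : psdmx A -> A \in unitmx -> pdmx A.
Proof.
move=> Ap Au; have Ah := psd_herm Ap; split => // i.
by rewrite lt_def unit_spec_val// psd_spec_val.
Qed.

Lemma finite_lower_bound (f : 'I_n -> R) : (forall i, 0 < f i) ->
  exists2 m, 0 < m & forall i, m <= f i.
Proof.
(* A substitute for the minimum; the summand 1 keeps it positive for an empty index set. *)
move=> f0; exists (1 + \sum_i (f i)^-1)^-1.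
  by rewrite invr_gt0 ltr_wpDr// sumr_ge0// => i _; rewrite invr_ge0 ltW.
move=> i; rewrite -[leRHS]invrK lef_pV2 ?posrE ?invr_gt0//.
  rewrite (bigD1 i)//= addrCA lerDl addr_ge0// sumr_ge0// => j _.
  by rewrite invr_ge0 ltW.
by rewrite ltr_wpDr// sumr_ge0// => j _; rewrite invr_ge0 ltW.
Qed.

(** Turns a condition on eigenvalues into an operator inequality, which is visibly stable under sums
    and scalings. *)
Lemma pd_lower A : pdmx A -> exists2 m, 0 < m & psdmx (A - m%:C%:M).
Proof.
case=> Ah /finite_lower_bound[m m0 mA]; exists m => //.
exact: psd_spec_sub.
Qed.

Lemma lower_spec_val A m i : psdmx (A - m%:C%:M) -> m <= spec_val A i.
Proof.
move=> Am; have Ah : A^t* = A.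
  rewrite -[A](subrK (m%:C%:M)) adjmxD (psd_herm Am) -scalemx1 adjmxZr.
  by rewrite adjmx1.
have AA : psdmx (A - A) by rewrite subrr; exact: psd0.
exact: psdB_spec_val Ah AA Am.
Qed.

Lemma lower_pd A m : 0 < m -> psdmx (A - m%:C%:M) -> pdmx A.
Proof.
move=> m0 Am; split; last by move=> i; apply: lt_le_trans m0 _; exact: lower_spec_val.
rewrite -[A](subrK (m%:C%:M)) adjmxD (psd_herm Am) -scalemx1 adjmxZr.
by rewrite adjmx1.
Qed.

Lemma pdZ r A : 0 < r -> pdmx A -> pdmx (r%:C *: A).
Proof.
move=> r0 /pd_lower[m m0 Am]; apply: (@lower_pd _ (r * m)); first exact: mulr_gt0.
rewrite rmorphM -scale_scalar_mx -scalerBr.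
by apply: psdZ => //; exact: ltW.
Qed.

Lemma pdD A B : pdmx A -> psdmx B -> pdmx (A + B).
Proof.
move=> /pd_lower[m m0 Am] Bp; apply: (lower_pd m0).
by rewrite addrAC; exact: psdD.
Qed.

Lemma pd_congr S A : S \in unitmx -> pdmx A -> pdmx (S^t* *m A *m S).
Proof.
move=> Su Apd; apply: psd_unit_pd; first exact/psd_congr/pd_psd.
by rewrite !unitmx_mul Su (pd_unit Apd) map_unitmx unitmx_tr Su.
Qed.

Lemma mxpow_adj A s : (mxpow A s)^t* = mxpow A s. Proof. exact: mxfun_adj. Qed.

Section Powers.
Variable A : op R n.
Hypothesis Apd : pdmx A.

Lemma mxpowD s t : mxpow A s *m mxpow A t = mxpow A (s + t).
Proof.
rewrite /mxpow mxfunM; apply: eq_mxfun => i; rewrite powRD//.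
by apply/implyP => _; rewrite gt_eqF//; case: Apd.
Qed.

Lemma mxpow0 : mxpow A 0 = 1%:M.
Proof. by apply: mxfun1 => i; rewrite powRr0. Qed.

Lemma mxpow1 : mxpow A 1 = A.
Proof. by apply: mxfun_id => [|i]; [case: Apd|rewrite powRr1// ltW//; case: Apd]. Qed.

Lemma mxpowVl s : mxpow A (- s) *m mxpow A s = 1%:M.
Proof. by rewrite mxpowD addNr mxpow0. Qed.

Lemma mxpowVr s : mxpow A s *m mxpow A (- s) = 1%:M.
Proof. by rewrite mxpowD subrr mxpow0. Qed.

Lemma mxpow_unit s : mxpow A s \in unitmx.
Proof. by have /mulmx1_unit[] := mxpowVr s. Qed.

Lemma mxpow_pd s : pdmx (mxpow A s).
Proof.
apply: psd_unit_pd (mxpow_unit s); apply: psd_mxfun => i; exact: powR_ge0.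
Qed.

Lemma mxpow_scale r s : 0 <= r -> mxpow (r%:C *: A) s = (r `^ s)%:C *: mxpow A s.
Proof.
move=> r0; rewrite /mxpow mxfunZ; last by case: Apd.
rewrite -mxfun_scale; apply: eq_mxfun => i; rewrite powRM// ltW//.
by case: Apd.
Qed.

Lemma trpow_mxpow s : trpow s A = complex.Re (\tr (mxpow A s)).
Proof. by rewrite trace_mxfun. Qed.

Lemma mxpowM s t : mxpow (mxpow A s) t = mxpow A (s * t).
Proof.
by rewrite /mxpow mxfun_comp; apply: eq_mxfun => i /=; rewrite powRrM.
Qed.

(* The modular relation A V A^-1 = e^{-w} V propagates to all powers of A. *)
Lemma mxpow_modular V w s :
  A *m V *m invmx A = (expR (- w))%:C *: V ->
  mxpow A s *m V = (expR (- w * s))%:C *: (V *m mxpow A s).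
Proof.
move=> AV; have {AV} AV : A *m V = V *m ((expR (- w))%:C *: A).
  by rewrite -scalemxAr scalemxAl -AV mulmxKV// pd_unit.
have Ah := Apd.1.
rewrite /mxpow (mxfun_intertwine _ Ah _ AV); last by rewrite adjmxZr Ah.
rewrite -/(mxpow _ s) mxpow_scale ?expR_ge0// -scalemxAr; congr (_%:C *: _).
by rewrite /powR gt_eqF ?expR_gt0// expRK mulrC.
Qed.

Lemma mxpow_modularV V w s :
  A *m V *m invmx A = (expR (- w))%:C *: V ->
  V *m mxpow A s = (expR (w * s))%:C *: (mxpow A s *m V).
Proof.
move=> /(mxpow_modular s) ->; rewrite scalerA -rmorphM -expRD.
by rewrite mulNr subrr expR0 scale1r.
Qed.

End Powers.

(** The adjoint of V A = e^w A V: passing to the adjoint reverses the sign of w. *)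
Lemma mxpow_modular_adj A V w : pdmx A ->
  A *m V *m invmx A = (expR (- w))%:C *: V ->
  A *m V^t* *m invmx A = (expR (- - w))%:C *: V^t*.
Proof.
move=> Apd /(mxpow_modularV Apd 1); rewrite mxpow1// mulr1 => /(congr1 (fun X => X^t*)).
rewrite adjmxM adjmxZr adjmxM Apd.1 opprK => ->.
by rewrite -scalemxAl mulmxK// pd_unit.
Qed.

End PositiveDefinite.

(** * The weighting maps Gamma *)

Section Weighting.
Variables (R : realType) (d : nat) (sigma : op R d).
Hypothesis sigma_pd : pdmx sigma.
Local Open Scope complex_scope.
Local Open Scope sesquilinear_scope.
Implicit Types (X Y : op R d) (s t : R).

Lemma GammaM s t X : Gamma sigma s (Gamma sigma t X) = Gamma sigma (s + t) X.
Proof.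
rewrite /Gamma !mulmxA mxpowD// -mulmxA mxpowD//.
by rewrite -mulrDl [t / 2 + _]addrC -mulrDl.
Qed.

Lemma Gamma0 X : Gamma sigma 0 X = X.
Proof. by rewrite /Gamma mul0r mxpow0 mul1mx mulmx1. Qed.

Lemma GammaK s X : Gamma sigma s (Gamma sigma (- s) X) = X.
Proof. by rewrite GammaM subrr Gamma0. Qed.

Lemma GammaD s X Y : Gamma sigma s (X + Y) = Gamma sigma s X + Gamma sigma s Y.
Proof. by rewrite /Gamma mulmxDr mulmxDl. Qed.

Lemma GammaZ s z X : Gamma sigma s (z *: X) = z *: Gamma sigma s X.
Proof. by rewrite /Gamma -scalemxAr -scalemxAl. Qed.

Lemma GammaN s X : Gamma sigma s (- X) = - Gamma sigma s X.
Proof. by rewrite -scaleN1r GammaZ scaleN1r. Qed.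

Lemma GammaB s X Y : Gamma sigma s (X - Y) = Gamma sigma s X - Gamma sigma s Y.
Proof. by rewrite GammaD GammaN. Qed.

Lemma Gamma_sum s I (r : seq I) (P : pred I) (F : I -> op R d) :
  Gamma sigma s (\sum_(i <- r | P i) F i) = \sum_(i <- r | P i) Gamma sigma s (F i).
Proof.
by rewrite /Gamma; move: (mxpow sigma _) => S; rewrite mulmx_sumr mulmx_suml.
Qed.

Lemma Gamma_adj s X : (Gamma sigma s X)^t* = Gamma sigma s (X^t*).
Proof. by rewrite /Gamma !adjmxM !mxpow_adj mulmxA. Qed.

Lemma Gamma_psd s X : psdmx X -> psdmx (Gamma sigma s X).
Proof. by move=> Xp; rewrite /Gamma -{1}mxpow_adj; exact: psd_congr. Qed.

Lemma Gamma_pd s X : pdmx X -> pdmx (Gamma sigma s X).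
Proof.
by move=> Xp; rewrite /Gamma -{1}mxpow_adj; apply: pd_congr => //; exact: mxpow_unit.
Qed.

Lemma Gamma_hsip s X Y : hsip (Gamma sigma s X) Y = hsip X (Gamma sigma s Y).
Proof.
rewrite /hsip Gamma_adj /Gamma; move: (mxpow sigma _) => S.
by rewrite -!mulmxA mxtrace_mulC !mulmxA.
Qed.

Lemma Gamma_hsre s X Y : hsre (Gamma sigma s X) Y = hsre X (Gamma sigma s Y).
Proof. by rewrite /hsre Gamma_hsip. Qed.

Lemma Gamma_mxpow s t : Gamma sigma s (mxpow sigma t) = mxpow sigma (s + t).
Proof. by rewrite /Gamma !mxpowD// addrAC -splitr. Qed.

Lemma Gamma_id s : Gamma sigma s sigma = mxpow sigma (s + 1).
Proof. by rewrite -{2}(mxpow1 sigma_pd) Gamma_mxpow. Qed.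

End Weighting.

(** * The gradient structure *)

Opaque mxfun mxpow spec_proj spec_val.

Section HilbertSchmidtAdjoint.
Variables (R : realType) (d : nat).
Local Open Scope complex_scope.
Local Open Scope sesquilinear_scope.
Implicit Types (X Y Z V : op R d) (Phi : op R d -> op R d).

Lemma hsadj_eq Phi Y Z : (forall X, hsip (Phi X) Y = hsip X Z) ->
  hsadj Phi Y = Z.
Proof. by move=> h; apply/matrixP => i j; rewrite mxE h hsip_delta. Qed.

Lemma hsadjZ Phi z Y : hsadj Phi (z *: Y) = z *: hsadj Phi Y.
Proof. by apply/matrixP => i j; rewrite !mxE hsipZr. Qed.

Lemma hsadjD Phi Y Z : hsadj Phi (Y + Z) = hsadj Phi Y + hsadj Phi Z.
Proof. by apply/matrixP => i j; rewrite !mxE hsipDr. Qed.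

Lemma hsadj_entry Phi Y i j : hsadj Phi Y i j = hsip (Phi (delta_mx i j)) Y.
Proof. by rewrite mxE. Qed.

Lemma hsadj_sum Phi I (r : seq I) (P : pred I) (F : I -> op R d) :
  hsadj Phi (\sum_(i <- r | P i) F i) = \sum_(i <- r | P i) hsadj Phi (F i).
Proof.
apply: (big_morph (hsadj Phi)) => [A B|]; first exact: hsadjD.
by apply/matrixP => i j; rewrite hsadj_entry /hsip mulmx0 mxtrace0 mxE.
Qed.

Lemma linear_sum_delta Phi X : linear Phi ->
  Phi X = \sum_i \sum_j X i j *: Phi (delta_mx i j).
Proof.
move=> Plin.
have P0 : Phi 0 = 0.
  by have := Plin (-1) 0 0; rewrite scaler0 addr0 scaleN1r addNr.
have PD Y Z : Phi (Y + Z) = Phi Y + Phi Z by rewrite -[Y]scale1r Plin !scale1r.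
have PZ a Y : Phi (a *: Y) = a *: Phi Y by rewrite -[a *: Y]addr0 Plin P0 addr0.
rewrite {1}[X]matrix_sum_delta (big_morph Phi PD P0); apply: eq_bigr => i _.
by rewrite (big_morph Phi PD P0); apply: eq_bigr => j _; rewrite PZ.
Qed.

Lemma hsipE X Y : hsip X Y = \sum_i \sum_j Num.conj (X i j) * Y i j.
Proof.
rewrite /hsip /mxtrace exchange_big /=; apply: eq_bigr => j _.
by rewrite mxE; apply: eq_bigr => i _; rewrite !mxE.
Qed.

Lemma hsip_suml I (r : seq I) (P : pred I) (F : I -> op R d) Y :
  hsip (\sum_(i <- r | P i) F i) Y = \sum_(i <- r | P i) hsip (F i) Y.
Proof.
apply: (big_morph (fun X => hsip X Y)) => [A B|]; first exact: hsipDl.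
by rewrite /hsip adjmx0 mul0mx mxtrace0.
Qed.

Lemma hsip_sumr I (r : seq I) (P : pred I) (F : I -> op R d) Y :
  hsip Y (\sum_(i <- r | P i) F i) = \sum_(i <- r | P i) hsip Y (F i).
Proof.
by rewrite hsip_conj hsip_suml rmorph_sum; apply: eq_bigr => i _; rewrite [RHS]hsip_conj.
Qed.

Lemma hsadjP Phi X Y : linear Phi -> hsip X (hsadj Phi Y) = hsip (Phi X) Y.
Proof.
move=> Plin; rewrite (linear_sum_delta X Plin) hsip_suml hsipE.
apply: eq_bigr => i _; rewrite hsip_suml; apply: eq_bigr => j _.
by rewrite mxE hsipZl.
Qed.

End HilbertSchmidtAdjoint.

Lemma GammaE (R : realType) d (sigma : op R d) s X :
  Gamma sigma s X = mxpow sigma (s / 2) *m X *m mxpow sigma (s / 2).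
Proof. by []. Qed.

Lemma bracketE (R : realType) d (sigma : op R d) p rho w X :
  bracket sigma p rho w X = Gamma sigma (conjexp p)^-1 (mxfun2 (theta p)
    ((expR (w / (2 * p)))%:C%C *: Gamma sigma (- (conjexp p)^-1) rho)
    ((expR (- w / (2 * p)))%:C%C *: Gamma sigma (- (conjexp p)^-1) rho)
    (Gamma sigma (conjexp p)^-1 X)).
Proof. by []. Qed.

Lemma commutatorE (R : realType) d (V X : op R d) :
  commutator V X = V *m X - X *m V.
Proof. by []. Qed.

(** * Noncommutative identities behind the modular computations *)

Section MatrixIdentities.
Variables (F : fieldType) (d : nat).
Implicit Types (S T u v X Y Z : 'M[F]_d) (e f x y : F).

Lemma conj_mull S v e Y : S *m v = e *: (v *m S) ->
  S *m (v *m Y) *m S = e *: (v *m (S *m Y *m S)).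
Proof. by move=> Sv; rewrite mulmxA Sv -!scalemxAl !mulmxA. Qed.

Lemma conj_mulr S v e Y : v *m S = e *: (S *m v) ->
  S *m (Y *m v) *m S = e *: (S *m Y *m S *m v).
Proof. by move=> vS; rewrite -!mulmxA vS -!scalemxAr. Qed.

(** S undoes the sandwich of Z by its inverse T, at the price of the weights picked up when v
    crosses S. With S a power of sigma, this produces the twisted commutator to which theta_p
    applies. *)
Lemma conj_commutator S T v Z e f : S *m T = 1%:M -> T *m S = 1%:M ->
  S *m v = e *: (v *m S) -> v *m S = f *: (S *m v) ->
  S *m (v *m (T *m Z *m T) - T *m Z *m T *m v) *m S =
  e *: (v *m Z) - f *: (Z *m v).
Proof.
move=> ST TS Sv vS; rewrite mulmxBr mulmxBl (conj_mull _ Sv) (conj_mulr _ vS).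
have -> : S *m (T *m Z *m T) *m S = Z by rewrite !mulmxA ST mul1mx -mulmxA TS mulmx1.
by [].
Qed.

(** One computation for two similarities: S = T = sigma^(1/2) in [dissipator_KMS], and S = 1, T =
    sigma in [dissipator_GNS]. Moving S and T inwards leaves the one-sided terms unweighted and
    exchanges the weights x and y of the terms with X in the middle. *)
Lemma sandwich_lindblad S T u v X x1 x2 y1 y2 x y :
  S *m u = x1 *: (u *m S) -> S *m v = y1 *: (v *m S) ->
  v *m T = x2 *: (T *m v) -> u *m T = y2 *: (T *m u) ->
  x1 * y1 = 1 -> x2 * y2 = 1 -> y * (x1 * x2) = x -> x * (y1 * y2) = y ->
  S *m (y *: (u *m (X *m v - v *m X)) + x *: ((v *m X - X *m v) *m u)) *m T =
  y *: (v *m (S *m X *m T) *m u - u *m v *m (S *m X *m T)) +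
  x *: (u *m (S *m X *m T) *m v - S *m X *m T *m v *m u).
Proof.
move=> Su Sv vT uT xy1 xy2 xE yE; pose rho := S *m X *m T; rewrite -/rho.
have lin P Q : S *m (y *: P + x *: Q) *m T = y *: (S *m P *m T) + x *: (S *m Q *m T).
  by rewrite mulmxDr mulmxDl -!scalemxAr -!scalemxAl.
have sub P Q : S *m (P - Q) *m T = S *m P *m T - S *m Q *m T.
  by rewrite mulmxBr mulmxBl.
have E1 : S *m (u *m (X *m v)) *m T = (x1 * x2) *: (u *m rho *m v).
  rewrite mulmxA Su -!scalemxAl -!mulmxA vT -!scalemxAr scalerA.
  by rewrite /rho !mulmxA.
have E2 : S *m (u *m (v *m X)) *m T = u *m v *m rho.
  rewrite mulmxA Su -!scalemxAl -[u *m S *m _]mulmxA [S *m (v *m X)]mulmxA Sv.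
  by rewrite -!scalemxAl -scalemxAr -scalemxAl scalerA xy1 scale1r /rho !mulmxA.
have E3 : S *m (v *m X *m u) *m T = (y1 * y2) *: (v *m rho *m u).
  rewrite -[v *m X *m u]mulmxA mulmxA Sv -!scalemxAl -!mulmxA uT -!scalemxAr scalerA.
  by rewrite /rho !mulmxA.
have E4 : S *m (X *m v *m u) *m T = rho *m v *m u.
  rewrite -!mulmxA uT -!scalemxAr [v *m (T *m u)]mulmxA vT -!scalemxAl -!scalemxAr.
  by rewrite scalerA mulrC xy2 scale1r /rho !mulmxA.
rewrite lin mulmxBr mulmxBl !sub E1 E2 E3 E4 !scalerBr !scalerA xE yE.
by rewrite [LHS]addrC [LHS]addrACA [RHS]addrACA; congr (_ + _); exact: addrC.
Qed.

Lemma scale_sub_sub e f a b c g : e *: a - f *: b - (e *: c - f *: g) =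
  - (e *: (c - a) + f *: (b - g)) :> 'M[F]_d.
Proof.
by rewrite !scalerBr [RHS]opprD !opprB addrACA [X in _ + X]addrC addrACA.
Qed.

Lemma lindblad_linear e f a u X1 X2 Y1 Y2 :
  e *: (u *m (a *: X1 + X2)) + f *: ((a *: Y1 + Y2) *m u) =
  a *: (e *: (u *m X1) + f *: (Y1 *m u)) + (e *: (u *m X2) + f *: (Y2 *m u)).
Proof.
rewrite mulmxDr mulmxDl -scalemxAr -scalemxAl !scalerDr !scalerA.
by rewrite [a * e]mulrC [a * f]mulrC addrACA.
Qed.

End MatrixIdentities.

Section Bracket.
Variables (R : realType) (d : nat).
Local Open Scope complex_scope.
Local Open Scope sesquilinear_scope.
Implicit Types (A B X Y Z V rho sigma : op R d) (p w : R).

Lemma mxfun2_adj f A B X Y :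
  hsip (mxfun2 f A B X) Y = hsip X (mxfun2 f A B Y).
Proof.
have PXQ (P Q : op R d) : P^t* = P -> Q^t* = Q ->
    hsip (P *m X *m Q) Y = hsip X (P *m Y *m Q).
  move=> Ph Qh; rewrite /hsip !adjmxM Ph Qh.
  by rewrite -!mulmxA mxtrace_mulC !mulmxA.
rewrite /mxfun2 hsip_suml hsip_sumr; apply: eq_bigr => i _.
rewrite hsip_suml hsip_sumr; apply: eq_bigr => k _.
by rewrite hsipZrl hsipZr PXQ// spec_proj_adj.
Qed.

Lemma mxfun2Z f A B z X : mxfun2 f A B (z *: X) = z *: mxfun2 f A B X.
Proof.
rewrite /mxfun2 scaler_sumr; apply: eq_bigr => i _; rewrite scaler_sumr.
by apply: eq_bigr => k _; rewrite -scalemxAr -scalemxAl !scalerA mulrC.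
Qed.

Lemma spec_proj_decomposition A B X :
  \sum_i \sum_k spec_proj A i *m X *m spec_proj B k = X.
Proof.
under eq_bigr do rewrite -mulmx_sumr spec_proj_sum mulmx1.
by rewrite -mulmx_suml spec_proj_sum mul1mx.
Qed.

(* theta_p is the divided difference making the chain rule exact. *)
Lemma mxfun2_theta p A B V : 1 < p -> pdmx A -> pdmx B ->
  mxfun2 (theta p) A B (V *m mxpow B (p - 1) - mxpow A (p - 1) *m V) =
  (p - 1)%:C *: (V *m B - A *m V).
Proof.
move=> p1 [Ah A0] [Bh B0].
have PQ (P Q C D : op R d) a b : P *m C = a%:C *: P -> D *m Q = b%:C *: Q ->
    P *m (V *m D - C *m V) *m Q = (b - a)%:C *: (P *m V *m Q).
  move=> PC DQ; rewrite mulmxBr mulmxBl mulmxA -mulmxA DQ mulmxA PC.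
  by rewrite -scalemxAr -!scalemxAl -scalerBl rmorphB.
rewrite -[V *m B - _](spec_proj_decomposition A B) scaler_sumr.
apply: eq_bigr => i _; rewrite scaler_sumr; apply: eq_bigr => k _.
rewrite (PQ _ _ _ _ _ _ (spec_proj_mxfun _ A i) (mxfun_spec_proj _ B k)).
rewrite (PQ _ _ _ _ _ _ (spec_proj_mull i Ah) (spec_proj_mulr k Bh)).
rewrite !scalerA -!rmorphM; congr (_%:C *: _).
have := A0 i; have := B0 k; move: (spec_val A i) (spec_val B k) => x y y0 x0.
rewrite /theta; have [->|xy] := eqVneq x y; first by rewrite !subrr !mulr0.
have p10 : 0 < p - 1 by rewrite subr_gt0.
have ne : x `^ (p - 1) - y `^ (p - 1) != 0.
  rewrite subr_eq0; apply: contra xy => /eqP h; apply/eqP.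
  have := congr1 (fun z => z `^ (p - 1)^-1) h; rewrite /= -!powRrM.
  by rewrite divff ?gt_eqF// !powRr1// ltW.
by field.
Qed.

Lemma commutatorZ V z X : commutator V (z *: X) = z *: commutator V X.
Proof. by rewrite /commutator -scalemxAr -scalemxAl scalerBr. Qed.

Lemma commutatorD V X Y : commutator V (X + Y) = commutator V X + commutator V Y.
Proof. by rewrite /commutator mulmxDr mulmxDl opprD addrACA. Qed.

Lemma commutator_scalar V z : commutator V z%:M = 0.
Proof. by rewrite /commutator scalar_mxC subrr. Qed.

Lemma hsip_commutator V X Y :
  hsip (commutator V X) Y = hsip X (commutator (V^t*) Y).
Proof.
rewrite /hsip /commutator adjmxB !adjmxM mulmxBl mulmxBr !raddfB /=.
congr (_ - _); first by rewrite mulmxA.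
by rewrite -mulmxA mxtrace_mulC mulmxA.
Qed.

Lemma hsadj_commutator V Y : hsadj (commutator V) Y = commutator (V^t*) Y.
Proof. by apply: hsadj_eq => X; exact: hsip_commutator. Qed.

Lemma hsadj_commutator_hsip V X Y :
  hsip (hsadj (commutator V) X) Y = hsip X (commutator V Y).
Proof. by rewrite hsadj_commutator hsip_commutator trmxCK. Qed.

Lemma hsip_hsadj_commutator V X Y :
  hsip X (hsadj (commutator V) Y) = hsip (commutator V X) Y.
Proof. by rewrite hsadj_commutator hsip_commutator. Qed.

End Bracket.

Opaque mxfun2 hsadj Gamma bracket commutator.

(** * The generator as a gradient for the metric *)

Section Generator.
Variables (R : realType) (d : nat) (sigma : op R d).
Variables (J : nat) (V : 'I_J -> op R d) (omega : 'I_J -> R) (p : R).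
Hypothesis sigma_pd : pdmx sigma.
Hypothesis p12 : 1 < p <= 2.
Hypothesis modular : forall j,
  sigma *m V j *m invmx sigma = (expR (- omega j))%:C%C *: V j.
Local Open Scope complex_scope.
Local Open Scope sesquilinear_scope.
Implicit Types (X Y Z rho A B : op R d) (w r s : R).

Let p1 : 1 < p. Proof. by case/andP: p12. Qed.
Let p0 : p != 0. Proof. by rewrite gt_eqF// (lt_trans _ p1). Qed.
Let pB1 : p - 1 != 0. Proof. by rewrite subr_eq0 gt_eqF. Qed.

(** This is sigma^((1-p)/(2p)) rho sigma^((1-p)/(2p)), the operator of the sandwiched Renyi entropy:
    the trace of its p-th power is the p-norm in [Fp], and its multiples are the arguments of
    theta_p. *)
Definition relop rho : op R d := Gamma sigma (- (conjexp p)^-1) rho.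

Lemma conjexpV : (conjexp p)^-1 = 1 - p^-1.
Proof. by rewrite /conjexp; field; rewrite p0 pB1. Qed.

Lemma relopE rho : Gamma sigma p^-1 (Gamma sigma (-1) rho) = relop rho.
Proof. by rewrite GammaM// /relop conjexpV opprB. Qed.

Lemma relopK rho : Gamma sigma (conjexp p)^-1 (relop rho) = rho.
Proof. exact: GammaK. Qed.

Lemma mxabs_psd A : psdmx A -> mxabs A = A.
Proof.
move=> Ap; have Ah := psd_herm Ap; rewrite /mxabs Ah.
rewrite -{1 2}(@mxfun_id _ _ id A Ah)// mxfunM mxfun_comp mxfun_id// => i /=.
by rewrite -expr2 sqrtr_sqr ger0_norm// psd_spec_val.
Qed.

Lemma Fp_trpow rho : psdmx rho ->
  Fp sigma p rho = (p * (p - 1))^-1 * (trpow p (relop rho) - 1).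
Proof.
move=> rp; have Yp : psdmx (relop rho) by exact: Gamma_psd.
rewrite /Fp /pnorm relopE mxabs_psd// -trpow_mxpow /= -powRrM.
rewrite mulVf// powRr1//; apply: sumr_ge0 => i _; exact: powR_ge0.
Qed.

(** (p - 1) times the Hilbert-Schmidt gradient of [Fp], as [Fp_klein] shows in subgradient form. It
    is also the left argument of the KMS product in [Ep]. *)
Definition gradient rho : op R d :=
  Gamma sigma (- (conjexp p)^-1) (mxpow (relop rho) (p - 1)).

(** The chain rule. The modular relation turns the commutator with [gradient] into a difference of
    (p-1)-th powers of two multiples of [relop], which theta_p replaces by the difference of the
    multiples themselves; the outer Gamma then restores rho. *)
Lemma bracket_gradient rho j : pdmx rho ->
  bracket sigma p rho (omega j) (commutator (V j) (gradient rho)) =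
  (p - 1)%:C *: ((expR (- omega j / 2))%:C *: (V j *m rho) -
                 (expR (omega j / 2))%:C *: (rho *m V j)).
Proof.
move=> rpd; have Ypd : pdmx (relop rho) by exact: Gamma_pd.
set Y := relop rho in Ypd *; set a := (conjexp p)^-1.
set w := omega j; set v := V j.
have Sv : mxpow sigma (a / 2) *m v = (expR (- w * (a / 2)))%:C *: (v *m mxpow sigma (a / 2)).
  exact: mxpow_modular (modular j).
have vS : v *m mxpow sigma (a / 2) = (expR (w * (a / 2)))%:C *: (mxpow sigma (a / 2) *m v).
  exact: mxpow_modularV (modular j).
have E1 : Gamma sigma a (commutator v (gradient rho)) =
    (expR (- w * (a / 2)))%:C *: (v *m mxpow Y (p - 1)) -
    (expR (w * (a / 2)))%:C *: (mxpow Y (p - 1) *m v).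
  rewrite /gradient -/Y -/a commutatorE !GammaE mulNr.
  exact: conj_commutator (mxpowVr sigma_pd _) (mxpowVl sigma_pd _) Sv vS.
have x0 := expR_gt0 (w / (2 * p)); have y0 := expR_gt0 (- w / (2 * p)).
have Ah : pdmx ((expR (w / (2 * p)))%:C *: Y) by exact: pdZ.
have Bh : pdmx ((expR (- w / (2 * p)))%:C *: Y) by exact: pdZ.
have powE z : expR z `^ (p - 1) = expR (z * (p - 1)).
  by rewrite /powR gt_eqF ?expR_gt0// expRK mulrC.
(* This equality of exponents matches the weight from crossing sigma^(a/2) with (e^(w/(2p)))^(p-1).
   Adding the two crossings gives the exponents -w/2 and w/2 of the generator. *)
have aE : a / 2 = (p - 1) / (2 * p) by rewrite /a conjexpV; field.
have E2 : Gamma sigma a (commutator v (gradient rho)) =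
    v *m mxpow ((expR (- w / (2 * p)))%:C *: Y) (p - 1) -
    mxpow ((expR (w / (2 * p)))%:C *: Y) (p - 1) *m v.
  rewrite E1 !mxpow_scale ?ltW// !powE -scalemxAl -scalemxAr aE.
  by congr (_%:C *: _ - _%:C *: _); congr expR; field.
rewrite bracketE -/a E2 -/(relop rho) -/Y mxfun2_theta//.
rewrite GammaZ; congr (_ *: _); rewrite GammaB -scalemxAl -scalemxAr !GammaZ.
have GY : mxpow sigma (a / 2) *m Y *m mxpow sigma (a / 2) = rho.
  by rewrite -GammaE; exact: relopK.
rewrite !GammaE (conj_mull Y Sv) (conj_mulr Y vS) GY !scalerA -!rmorphM -!expRD aE.
by congr (_%:C *: _ - _%:C *: _); congr expR; field.
Qed.

(** The generator on states, that is the Hilbert-Schmidt adjoint of L; see [hsadj_generator]. *)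
Definition dissipator rho : op R d := \sum_(j < J)
  ((expR (- omega j / 2))%:C *: (V j *m rho *m (V j)^t* - (V j)^t* *m V j *m rho) +
   (expR (omega j / 2))%:C *: ((V j)^t* *m rho *m V j - rho *m V j *m (V j)^t*)).

Lemma Dop_gradient rho : pdmx rho ->
  Dop sigma p V omega rho (gradient rho) = - (p - 1)%:C *: dissipator rho.
Proof.
move=> rpd; rewrite /Dop /dissipator scaler_sumr; apply: eq_bigr => j _.
rewrite bracket_gradient// hsadj_commutator commutatorZ scaleNr -scalerN.
congr (_ *: _); rewrite commutatorE mulmxBr mulmxBl -!scalemxAr -!scalemxAl.
rewrite !mulmxA.
exact: scale_sub_sub.
Qed.

Lemma bracketZ rho w z X :
  bracket sigma p rho w (z *: X) = z *: bracket sigma p rho w X.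
Proof. by rewrite !bracketE GammaZ mxfun2Z GammaZ. Qed.

Lemma DopZ rho z A : Dop sigma p V omega rho (z *: A) = z *: Dop sigma p V omega rho A.
Proof.
rewrite /Dop scaler_sumr; apply: eq_bigr => j _.
by rewrite (commutatorZ _ z) bracketZ hsadjZ.
Qed.

Lemma Dop_shift rho A z : Dop sigma p V omega rho (A + z%:M) = Dop sigma p V omega rho A.
Proof.
by apply: eq_bigr => j _; rewrite commutatorD commutator_scalar addr0.
Qed.

Lemma bracket_hsip rho w X Y :
  hsip (bracket sigma p rho w X) Y = hsip X (bracket sigma p rho w Y).
Proof. by rewrite !bracketE Gamma_hsip mxfun2_adj Gamma_hsip. Qed.

Lemma Dop_hsip rho A B :
  hsip (Dop sigma p V omega rho A) B = hsip A (Dop sigma p V omega rho B).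
Proof.
rewrite /Dop hsip_suml hsip_sumr; apply: eq_bigr => j _.
by rewrite hsip_hsadj_commutator hsadj_commutator_hsip bracket_hsip.
Qed.

(* Since [Dop] is self-adjoint, the metric may be computed from any solution of
   Dop rho A = nu: whether [Dop] is injective plays no role. *)
Lemma metricE rho nu A : tangent A -> Dop sigma p V omega rho A = nu ->
  metric sigma p V omega rho nu nu = hsre A nu.
Proof.
move=> At DA; rewrite /metric /Dinv -/(hsre _ _).
case: xgetP => [B _ [Bt DB]|/(_ A)/=[]//].
by rewrite -{1}DA /hsre -Dop_hsip DB -/(hsre _ _) hsreC.
Qed.

Lemma trace_dissipator rho : \tr (dissipator rho) = 0.
Proof.
rewrite /dissipator raddf_sum big1// => j _; rewrite /= mxtraceD !mxtraceZ !raddfB /=.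
rewrite [\tr (V j *m rho *m _)]mxtrace_mulC mulmxA subrr mulr0 add0r.
by rewrite [\tr (rho *m _ *m _)]mxtrace_mulC mulmxA subrr mulr0.
Qed.

Lemma gradient_adj rho : (gradient rho)^t* = gradient rho.
Proof. by rewrite /gradient Gamma_adj mxpow_adj. Qed.

Lemma metric_dissipator rho r : density rho -> pdmx rho ->
  metric sigma p V omega rho (r%:C *: dissipator rho) (r%:C *: dissipator rho) =
  r ^+ 2 * (- (p - 1)^-1 * hsre (gradient rho) (dissipator rho)).
Proof.
move=> [_ tr1] rpd.
(* The division by d in [c] requires this; in dimension 0 no matrix has trace 1. *)
have d0 : d%:R != 0 :> R[i].
  rewrite pnatr_eq0; apply/eqP => d0; move: tr1; rewrite /mxtrace big1.
    by move/eqP; rewrite eq_sym oner_eq0.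
  by move=> i; move: (ltn_ord i); rewrite [in X in (_ < X)%N]d0.
have trR : \tr (gradient rho) = (complex.Re (\tr (gradient rho)))%:C.
  rewrite RRe_real//; apply/CrealP; rewrite -mxtrace_adj gradient_adj//.
(* Subtracting the mean of the trace makes the potential tangent. It changes neither its image under
   [Dop] nor its pairing with the traceless dissipator. *)
pose c : R := complex.Re (\tr (gradient rho)) / d%:R.
pose A : op R d := (- (r / (p - 1)))%:C *: (gradient rho - c%:C%:M).
have At : tangent A.
  split; first by rewrite /A adjmxZr adjmxB gradient_adj -scalemx1 adjmxZr adjmx1.
  rewrite /A mxtraceZ raddfB /= mxtrace_scalar trR /c rmorphM fmorphV rmorph_nat.
  by rewrite -[_ *+ d]mulr_natr divfK// subrr mulr0.
rewrite (metricE At); last first.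
  rewrite /A DopZ -raddfN Dop_shift Dop_gradient// scalerA; congr (_ *: _).
  by rewrite -rmorphN -rmorphM mulrNN divfK.
rewrite /A hsreZl hsreZr hsreBl.
have -> : hsre c%:C%:M (dissipator rho) = 0.
  rewrite -scalemx1 hsreZl /hsre /hsip adjmx1 mul1mx trace_dissipator.
  by rewrite mulr0.
by rewrite subr0; ring.
Qed.

Variable L : op R d -> op R d.
Hypothesis LE : forall X, L X = \sum_(j < J)
    ((expR (- omega j / 2))%:C *: ((V j)^t* *m commutator X (V j)) +
     (expR (omega j / 2))%:C *: (commutator (V j) X *m (V j)^t*)).

(** The similarity matching the KMS product in which [Ep] is written. *)
Lemma dissipator_KMS rho : Gamma sigma 1 (L (Gamma sigma (-1) rho)) = dissipator rho.
Proof.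
have mod j := mxpow_modular sigma_pd 2^-1 (modular j).
have modV j := mxpow_modularV sigma_pd 2^-1 (modular j).
have moda j := mxpow_modular sigma_pd 2^-1 (mxpow_modular_adj sigma_pd (modular j)).
have modaV j := mxpow_modularV sigma_pd 2^-1 (mxpow_modular_adj sigma_pd (modular j)).
rewrite LE Gamma_sum /dissipator; apply: eq_bigr => j _.
rewrite -[rho in RHS](GammaK sigma_pd 1) !commutatorE.
move: (Gamma sigma (-1) rho) => X; rewrite !GammaE !mul1r.
have := sandwich_lindblad (y := (expR (- omega j / 2))%:C)
  (x := (expR (omega j / 2))%:C) X (moda j) (mod j) (modV j) (modaV j).
rewrite -!rmorphM -!expRD; apply.
- by rewrite (_ : _ + _ = 0) ?expR0//; ring.
- by rewrite (_ : _ + _ = 0) ?expR0//; ring.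
- by congr ((expR _)%:C); field.
- by congr ((expR _)%:C); field.
Qed.

(** The one-sided similarity matching the GNS product: it links detailed balance to the adjoint of L
    and to the eigenvectors of the dissipator. *)
Lemma dissipator_GNS rho : L (rho *m invmx sigma) *m sigma = dissipator rho.
Proof.
have mod j : V j *m sigma = (expR (omega j))%:C *: (sigma *m V j).
  by have := mxpow_modularV sigma_pd 1 (modular j); rewrite mxpow1// mulr1.
have moda j : (V j)^t* *m sigma = (expR (- omega j))%:C *: (sigma *m (V j)^t*).
  by have := mxpow_modularV sigma_pd 1 (mxpow_modular_adj sigma_pd (modular j));
    rewrite mxpow1// mulr1.
have one (X : op R d) : 1%:M *m X = 1 *: (X *m 1%:M).
  by rewrite mul1mx mulmx1 scale1r.
rewrite LE mulmx_suml /dissipator; apply: eq_bigr => j _.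
rewrite -[rho in RHS](mulmxKV (pd_unit sigma_pd)) !commutatorE.
move: (rho *m invmx sigma) => X.
have := @sandwich_lindblad _ _ 1%:M sigma ((V j)^t*) (V j) X 1 (expR (omega j))%:C
  1 (expR (- omega j))%:C (expR (omega j / 2))%:C (expR (- omega j / 2))%:C
  (one _) (one _) (mod j) (moda j).
rewrite !mul1mx !mul1r -!rmorphM -!expRD; apply=> //.
- by rewrite subrr expR0.
- by congr ((expR _)%:C); field.
- by congr ((expR _)%:C); field.
Qed.

Lemma Ep_dissipator rho :
  Ep sigma p L (Gamma sigma (-1) rho) =
  - (conjexp p * p / 4) * hsre (gradient rho) (dissipator rho).
Proof.
rewrite /Ep; congr (_ * _); rewrite relopE -/(gradient rho) -dissipator_KMS.
move: (L _) => Y; rewrite /hsre /KMSip /hsip gradient_adj (GammaE sigma 1) mul1r.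
by move: (gradient rho) (mxpow _ _) => Z S; rewrite -!mulmxA mxtrace_mulC !mulmxA.
Qed.

End Generator.


Transparent mxfun mxpow spec_proj spec_val mxfun2 hsadj Gamma bracket commutator.

(** * Detailed balance and the dual semigroup *)

Section EigenDecomposition.
Variables (R : realType) (d : nat).
Local Open Scope complex_scope.
Local Open Scope sesquilinear_scope.
Implicit Types (X Y Z : op R d).

Lemma mxvec_hsip X Y : (mxvec X *m (mxvec Y)^t*) 0 0 = hsip Y X.
Proof.
rewrite hsipE pair_bigA mxE (reindex _ (curry_mxvec_bij _ _)) /=.
by apply: eq_bigr => -[i j] _ /=; rewrite !mxE !mxvecE mulrC.
Qed.

(** T acts on vectorized operators through a matrix, Hermitian because [mxvec] is isometric; the
    spectral projections of this matrix cut Z into eigenvectors, some possibly zero. *)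
Lemma selfadjoint_decomposition (T : op R d -> op R d) : linear T ->
  (forall X Y, hsip (T X) Y = hsip X (T Y)) ->
  forall Z, exists (N : nat) (lam : 'I_N -> R) (B : 'I_N -> op R d),
    Z = \sum_k B k /\ forall k, T (B k) = (lam k)%:C *: B k.
Proof.
move=> Tlin Tsa Z.
pose f : {linear op R d -> op R d} :=
  HB.pack T (GRing.isLinear.Build _ _ _ _ T Tlin).
pose M : op R (d * d) := lin_mx f.
have ME u : u *m M = mxvec (T (vec_mx u)) by rewrite mul_rV_lin.
have Mh : M^t* = M.
  have qf (u v : 'rV[R[i]]_(d * d)) : (u *m M *m v^t*) 0 0 = (u *m M^t* *m v^t*) 0 0.
    rewrite -[u *m M^t* *m _]mulmxA -adjmxM !ME -[u in RHS]vec_mxK -[v in LHS]vec_mxK.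
    by rewrite !mxvec_hsip Tsa.
  apply/matrixP => i j; have := qf (delta_mx 0 i) (delta_mx 0 j).
  rewrite trmx_delta map_delta_mx -!mulmxA -!colE -!rowE !mxE => ->.
  by [].
exists (d * d)%N, (spec_val M), (fun k => vec_mx (mxvec Z *m spec_proj M k)).
split.
  by rewrite -linear_sum /= -mulmx_sumr spec_proj_sum mulmx1 mxvecK.
move=> k; apply: (can_inj mxvecK); rewrite -ME -mulmxA spec_proj_mull//.
by rewrite -scalemxAr linearZ /= vec_mxK.
Qed.

(* Z |-> L (Z S^-1) S with S = sigma^(1/2) is symmetric for the Hilbert-Schmidt
   product, and conjugate to K. *)
Lemma GNS_decomposition (sigma : op R d) (K L : op R d -> op R d) :
  pdmx sigma -> linear L -> GNS_detailed_balance sigma L ->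
  (forall rho, K rho = L (rho *m invmx sigma) *m sigma) ->
  forall rho, exists (N : nat) (lam : 'I_N -> R) (B : 'I_N -> op R d),
    rho = \sum_k B k /\ forall k, K (B k) = (lam k)%:C *: B k.
Proof.
move=> spd Llin gns KE rho.
set S := mxpow sigma 2^-1; set S' := mxpow sigma (- 2^-1).
have SS' : S *m S' = 1%:M by exact: mxpowVr.
have S'S : S' *m S = 1%:M by exact: mxpowVl.
have half : 2^-1 + 2^-1 = 1 :> R by lra.
have SS : S *m S = sigma by rewrite mxpowD// half mxpow1.
have Sh : S^t* = S by exact: mxpow_adj.
have S's : S' *m sigma = S by rewrite -SS mulmxA S'S mul1mx.
have Ss : S *m invmx sigma = S'.
  have su := pd_unit spd.
  by rewrite -[S *m _]mul1mx -S'S -!mulmxA [S *m (S *m _)]mulmxA SS mulmxV// mulmx1.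
pose T Z := L (Z *m S') *m S.
have Tlin : linear T.
  by move=> a X Y; rewrite /T mulmxDl -scalemxAl Llin mulmxDl -scalemxAl.
have Tsa X Y : hsip (T X) Y = hsip X (T Y).
  have := gns (X *m S') (Y *m S'); rewrite /hsip /T !adjmxM Sh -SS => h.
  have -> : \tr (S *m (L (X *m S'))^t* *m Y) =
      \tr (S *m S *m (L (X *m S'))^t* *m (Y *m S')).
    rewrite -[S *m S *m _ *m _]mulmxA -[S *m S *m _]mulmxA [RHS]mxtrace_mulC.
    by rewrite -!mulmxA S'S mulmx1.
  rewrite h /S' mxpow_adj -/S' -!mulmxA [S *m (S' *m _)]mulmxA SS' mul1mx.
  by rewrite mxtrace_mulC -!mulmxA.
have [N [lam [B [E TB]]]] := selfadjoint_decomposition Tlin Tsa (rho *m S').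
exists N, lam, (fun k => B k *m S); split.
  by rewrite -mulmx_suml -E -mulmxA S'S mulmx1.
move=> k; rewrite KE -[B k *m S *m _]mulmxA Ss -{1}SS mulmxA.
by rewrite -/(T (B k)) TB -scalemxAl.
Qed.

End EigenDecomposition.

Section ConstantFromSmallIncrements.
Variable R : realType.

(** Over equal pieces of [0, t] the increments add up to at most eta t. The uniformity in s replaces
    differentiability of b. *)
Lemma constant_of_small_increments (b : R -> R) (t : R) : 0 < t ->
  (forall eta, 0 < eta -> exists2 del, 0 < del &
     forall s r, 0 <= s -> 0 < r < del -> s + r <= t ->
       `|b (s + r) - b s| <= eta * r) ->
  b t = b 0.
Proof.
move=> t0 small; apply/eqP; rewrite -subr_eq0 -normr_le0; apply/ler_addgt0Pr => e e0.
have [|del del0 H] := small (e / t); first by rewrite divr_gt0.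
pose n := (Num.truncn (t / del)).+1.
have n0 : 0 < n%:R :> R by rewrite ltr0n.
have nt : t / n%:R < del.
  by rewrite ltr_pdivrMr// mulrC -ltr_pdivrMr//; exact: truncnS_gt.
pose x j : R := j%:R * (t / n%:R).
have xS j : x j.+1 = x j + t / n%:R by rewrite /x -natr1 mulrDl mul1r.
have xn : x n = t by rewrite /x mulrC divfK// gt_eqF.
have x0 : x 0%N = 0 by rewrite /x mul0r.
have -> : b t - b 0 = \sum_(0 <= j < n) (b (x j.+1) - b (x j)).
  by rewrite (telescope_sumr (fun j => b (x j)))// xn x0.
apply: le_trans (ler_norm_sum _ _ _) _; rewrite add0r.
apply: (@le_trans _ _ (\sum_(0 <= j < n) e / t * (t / n%:R))).
  rewrite big_nat_cond [leRHS]big_nat_cond; apply: ler_sum => j /andP[/andP[_ jn] _].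
  rewrite xS; apply: H.
  - by rewrite /x mulr_ge0// divr_ge0// ltW.
  - by rewrite divr_gt0.
  - rewrite -xS -[leRHS]xn /x ler_wpM2r ?ler_nat//.
    by rewrite divr_ge0// ltW.
rewrite sumr_const_nat subn0 -[leLHS]mulr_natr le_eqVlt; apply/orP; left.
by apply/eqP; field; rewrite !gt_eqF.
Qed.

Lemma is_derive_expRM (lam t : R) :
  is_derive t 1 (fun r : R => expR (lam * r)) (lam * expR (lam * t)).
Proof.
have d1 : is_derive t 1 (fun r : R => lam * r) lam.
  by apply: is_derive_eq; rewrite /GRing.scale /=; ring.
by rewrite mulrC; exact: (is_derive1_comp (is_derive_expR (lam * t)) d1).
Qed.

Lemma expR_first_order (lam : R) : forall eta : R, 0 < eta ->
  exists2 del, 0 < del & forall r : R, 0 < r < del ->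
    `|expR (lam * r) - 1 - lam * r| <= eta * r.
Proof.
move=> eta eta0.
have /is_derive1_caratheodory[g [gE gc g0]] := is_derive_expRM lam 0.
move: g0; rewrite mulr0 expR0 mulr1 => g0.
move: gc => /cvgrPdist_le/(_ _ eta0)[del /= del0 H].
exists del => // r /andP[r0 rd].
have := gE r; rewrite mulr0 expR0 subr0 => ->.
rewrite -mulrBl normrM (gtr0_norm r0) ler_wpM2r ?(ltW r0)// -g0 distrC.
by apply: H => /=; rewrite sub0r normrN gtr0_norm.
Qed.

End ConstantFromSmallIncrements.

(** * The semigroup and its dual on eigenvectors *)

Section MarkovFlow.
Variables (R : realType) (d : nat).
Local Open Scope complex_scope.
Local Open Scope sesquilinear_scope.
Implicit Types (X Y Z B rho : op R d).

Lemma hsipBl X Y Z : hsip (X - Y) Z = hsip X Z - hsip Y Z.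
Proof. by rewrite -scaleN1r hsipDl hsipZl rmorphN rmorph1 mulN1r. Qed.

(** Complete positivity speaks of block matrices; its case of a single block is positivity. *)
Lemma psd_mxblock1 X : psdmx (\mxblock_(i < 1, j < 1) X) <-> psdmx X.
Proof.
have qf (u : 'I_1 -> 'cV[R[i]]_d) :
    (\mxcol_i u i)^t* *m (\mxblock_(i < 1, j < 1) X) *m (\mxcol_i u i) =
    (u 0)^t* *m X *m u 0.
  have -> : (\mxcol_i u i)^t* = \mxrow_i (u i)^t*.
    by apply/matrixP => a b; rewrite !mxE.
  rewrite mul_mxrow_mxblock mul_mxrow_mxcol big_ord1.
  by rewrite big_ord1.
split=> Xp v.
  by have := Xp (\mxcol_(i < 1) v); rewrite qf.
by rewrite -[v]submxcolK qf.
Qed.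

Lemma cp_positive (Phi : op R d -> op R d) X :
  completely_positive Phi -> psdmx X -> psdmx (Phi X).
Proof.
move=> cp Xp; apply/psd_mxblock1.
exact: (cp 1%N (fun _ _ => X)) ((psd_mxblock1 X).2 Xp).
Qed.

Lemma hsnorm_delta_mx i j : hsnorm (delta_mx i j : op R d) = 1.
Proof. by rewrite /hsnorm hsip_delta mxE !eqxx sqrtr1. Qed.

Lemma hsnorm_le_entries X :
  hsnorm X <= \sum_i \sum_j (`|complex.Re (X i j)| + `|complex.Im (X i j)|).
Proof.
rewrite {1}[X]matrix_sum_delta; apply: le_trans (hsnorm_sum _ _ _) _.
apply: ler_sum => i _; apply: le_trans (hsnorm_sum _ _ _) _.
apply: ler_sum => j _; rewrite {1}[X i j]complexE scalerDl.
apply: le_trans (hsnormD _ _) _; rewrite -scalerA hsnormZ hsnormZi hsnormZ.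
by rewrite hsnorm_delta_mx !mulr1.
Qed.

Lemma normr_Re_hsip X Y : `|complex.Re (hsip X Y)| <= hsnorm X * hsnorm Y.
Proof. exact: normr_hsre_le. Qed.

Lemma normr_Im_hsip X Y : `|complex.Im (hsip X Y)| <= hsnorm X * hsnorm Y.
Proof.
have <- : hsre ('i%C *: X) Y = complex.Im (hsip X Y).
  rewrite /hsre hsipZl conj_i; case: (hsip X Y) => a b /=.
  by rewrite oppr0 mul0r mulN1r opprK add0r.
by rewrite -[hsnorm X]hsnormZi normr_hsre_le.
Qed.

(** Quadratic forms as pairings with rank-one operators: positivity and identities can then be
    transferred to the adjoint. *)
Lemma hsip_rank1 (v : 'cV[R[i]]_d) X : hsip (v *m v^t*) X = (v^t* *m X *m v) 0 0.
Proof.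
by rewrite /hsip adjmxM trmxCK -[X in \tr X]mulmxA mxtrace_mulC trace_mx11.
Qed.

Variables (P : R -> op R d -> op R d) (L : op R d -> op R d).
Hypothesis qms : quantum_markov_semigroup P.
Hypothesis genP : is_generator P L.

Lemma psd_semigroup t X : 0 <= t -> psdmx X -> psdmx (P t X).
Proof. by move=> t0; apply: cp_positive; exact: qms_cp. Qed.

(** From 0 <= X <= c, positivity and unitality give 0 <= Y <= c for Y = P_s X, whence <Y, Y> <= c
    <Y, 1> <= c^2 <1, 1>. The trace of X serves as c. *)
Lemma semigroup_bounded X : psdmx X ->
  exists2 C, 0 <= C & forall s, 0 <= s -> hsnorm (P s X) <= C.
Proof.
move=> Xp; have Xh := psd_herm Xp.
pose c := \sum_i spec_val X i.
have c0 : 0 <= c by apply: sumr_ge0 => i _; exact: psd_spec_val.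
have cX : psdmx (c%:C *: 1%:M - X).
  rewrite -(spec_proj_sum X) {2}(herm_spec Xh) scaler_sumr -sumrB.
  apply: psd_sum => i _; rewrite -scalerBl -rmorphB; apply: psdZ.
    rewrite subr_ge0 /c (bigD1 i)//= lerDl; apply: sumr_ge0 => j _.
    exact: psd_spec_val.
  exact: psd_spec_proj.
exists (c * hsnorm (1%:M : op R d)) => [|s s0].
  by rewrite mulr_ge0// hsnorm_ge0.
have Y0 := psd_semigroup s0 Xp; have := psd_semigroup s0 cX.
have Plin := qms_linear qms s0.
have -> : P s (c%:C *: 1%:M - X) = c%:C *: 1%:M - P s X.
  rewrite addrC -scaleN1r Plin scaleN1r addrC; congr (_ - _).
  have P0 : P s 0 = 0.
    by have := Plin (-1) 0 0; rewrite scaler0 addr0 scaleN1r addNr.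
  by rewrite -[c%:C *: 1%:M]addr0 Plin P0 !addr0 (qms_unital qms s0).
move: (P s X) Y0 => Y Y0 cY.
have h1 := psd_hsre Y0 cY; have h2 := psd_hsre cY (@psd1 R d).
move: h1 h2; rewrite hsreBr hsreBl hsreZr hsreZl => h1 h2.
rewrite -(@ler_pXn2r _ 2) ?nnegrE ?mulr_ge0 ?hsnorm_ge0// exprMn !sqr_hsnorm.
have : c * hsre Y 1%:M <= c * (c * hsre (1%:M : op R d) 1%:M) by rewrite ler_wpM2l//; lra.
by lra.
Qed.

(** Each entry of the dual is a pairing with P_r applied to a matrix unit. The generator limit is
    therefore needed at finitely many operators only, so one [del] suffices. *)
Lemma generator_remainder B lam : hsadj L B = lam%:C *: B ->
  forall eta, 0 < eta -> exists2 del, 0 < del & forall r, 0 < r < del ->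
    hsnorm (hsadj (P r) B - (expR (lam * r))%:C *: B) <= eta * r.
Proof.
move=> LB eta eta0.
pose b := hsnorm B; have b0 : 0 <= b by exact: hsnorm_ge0.
(* The real and imaginary parts of an entry cost 2 b e1 r each. The 1 in the denominator of [e1]
   covers B = 0. *)
pose k := 4 * b; have k0 : 0 <= k by rewrite mulr_ge0.
pose e1 := eta / (\sum_(i < d) \sum_(j < d) k + 1).
have S0 : 0 <= \sum_(i < d) \sum_(j < d) k.
  by apply: sumr_ge0 => i _; apply: sumr_ge0.
have e10 : 0 < e1 by rewrite divr_gt0// ltr_wpDl.
pose Q i j r : op R d := (r^-1)%:C *: (P r (delta_mx i j) - delta_mx i j) - L (delta_mx i j).
have [d1 d10 H1] := expR_first_order lam e10.
have [d2 d20 H2] : exists2 del, 0 < del & forall r, 0 < r < del ->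
    forall i j, hsnorm (Q i j r) <= e1.
  have : (\forall r \near (0 : R)^'+, forall ij : 'I_d * 'I_d,
      hsnorm (Q ij.1 ij.2 r) <= e1)%classic.
    apply: filter_forall => -[i j] /=.
    have /cvgrPdist_le/(_ _ e10) := genP (delta_mx i j).
    apply: filterS => r; rewrite sub0r normrN; exact: le_trans (ler_norm _).
  case=> del /= del0 H; exists del => // r /andP[r0 rd] i j.
  by apply: (H r _ r0 (i, j)) => /=; rewrite sub0r normrN gtr0_norm.
exists (Num.min d1 d2); first by rewrite lt_min d10.
move=> r /andP[r0]; rewrite lt_min => /andP[rd1 rd2].
have {}H1 : `|expR (lam * r) - 1 - lam * r| <= e1 * r by apply: H1; rewrite r0.
have {}H2 := H2 r _; rewrite r0 rd2 in H2; have {}H2 := H2 isT.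
have entry i j : (hsadj (P r) B - (expR (lam * r))%:C *: B) i j =
    r%:C * hsip (Q i j r) B - (expR (lam * r) - 1 - lam * r)%:C * hsip (delta_mx i j) B.
  have LBij : hsip (L (delta_mx i j)) B = lam%:C * hsip (delta_mx i j) B.
    by rewrite -hsadj_entry LB mxE hsip_delta.
  rewrite mxE hsadj_entry mxE mxE -[B i j]hsip_delta /Q.
  rewrite hsipBl hsipZrl hsipBl LBij.
  move: (hsip (P r _) B) (hsip (delta_mx i j) B) (expR _) => u w e.
  rewrite !rmorphB /= rmorphM rmorph1 fmorphV.
  by field; rewrite -(rmorph0 (real_complex R)) (inj_eq (@complexI R)) gt_eqF.
apply: le_trans (hsnorm_le_entries _) _.
apply: (@le_trans _ _ (\sum_(i < d) \sum_(j < d) k * (e1 * r))).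
  apply: ler_sum => i _; apply: ler_sum => j _; rewrite entry.
  rewrite ReD ImD ReN ImN !ReZ !ImZ.
  have q0 := hsnorm_ge0 (Q i j r).
  have qe := H2 i j.
  have h1 := normr_Re_hsip (Q i j r) B; have h2 := normr_Im_hsip (Q i j r) B.
  have h3 := normr_Re_hsip (delta_mx i j) B; have h4 := normr_Im_hsip (delta_mx i j) B.
  rewrite hsnorm_delta_mx mul1r -/b in h3 h4; rewrite -/b in h1 h2.
  have half z w : `|z| <= hsnorm (Q i j r) * b -> `|w| <= b ->
      `|r * z - (expR (lam * r) - 1 - lam * r) * w| <= 2 * b * (e1 * r).
    move=> zb wb; apply: le_trans (ler_normB _ _) _; rewrite !normrM (gtr0_norm r0).
    have -> : 2 * b * (e1 * r) = r * (e1 * b) + e1 * r * b by ring.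
    rewrite lerD//; last by apply: ler_pM.
    by rewrite ler_wpM2l ?(ltW r0)// (le_trans zb)// ler_wpM2r.
  have := half _ _ h1 h3; have := half _ _ h2 h4; rewrite /k; lra.
under eq_bigr do rewrite -mulr_suml; rewrite -mulr_suml [leLHS]mulrA ler_wpM2r ?(ltW r0)//.
rewrite /e1 mulrCA -[leRHS]mulr1 ler_wpM2l ?(ltW eta0)//.
by rewrite ler_pdivrMr ?mul1r ?lerDl// ltr_wpDl.
Qed.

(* By the semigroup law the increments of e^(-lam s) <P_s X, B> over [s, s + r] are
   o(r) uniformly in s, as they only involve P_r near time 0 and the bounded P_s X. *)
Lemma semigroup_eigen_hsre B lam X t : hsadj L B = lam%:C *: B -> psdmx X -> 0 <= t ->
  hsre (P t X) B = expR (lam * t) * hsre X B.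
Proof.
move=> LB Xp; rewrite le_eqVlt => /predU1P[<-|t0].
  by rewrite (qms0 qms) mulr0 expR0 mul1r.
have [C C0 HC] := semigroup_bounded Xp.
pose b s := expR (- lam * s) * hsre (P s X) B.
suff : b t = b 0.
  rewrite /b (qms0 qms) mulr0 expR0 mul1r => <-.
  by rewrite mulrA -expRD mulNr subrr expR0 mul1r.
apply: constant_of_small_increments => // eta eta0.
(* Bounds e^(-lam (s + r)) while s + r <= t, whatever the sign of lam. *)
pose M := expR (`|lam| * t).
have M0 : 0 < M by exact: expR_gt0.
have e0 : 0 < eta / (M * C + 1).
  by rewrite divr_gt0// ltr_wpDl// mulr_ge0// ltW.
have [del del0 H] := generator_remainder LB e0.
exists del => // s r s0 rdel srt; have /andP[r0 rd] := rdel.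
have -> : b (s + r) - b s = expR (- lam * (s + r)) *
    hsre (P s X) (hsadj (P r) B - (expR (lam * r))%:C *: B).
  rewrite /b (addrC s r) (qmsD qms _ (ltW r0) s0).
  rewrite hsreBr hsreZr /hsre (hsadjP _ _ (qms_linear qms (ltW r0))) -!/(hsre _ _).
  rewrite mulrBr mulrA -expRD; congr (_ - expR _ * _); ring.
rewrite normrM ger0_norm ?expR_ge0//.
have EM : expR (- lam * (s + r)) <= M.
  rewrite ler_expR; apply: le_trans (ler_norm _) _.
  rewrite normrM normrN; apply: ler_pM => //.
  by rewrite ger0_norm// addr_ge0// ltW.
apply: (@le_trans _ _ (M * (C * (eta / (M * C + 1) * r)))).
  apply: ler_pM; rewrite ?expR_ge0//; apply: le_trans (normr_hsre_le _ _) _.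
  by apply: ler_pM; rewrite ?hsnorm_ge0 ?HC ?H.
rewrite !mulrA ler_wpM2r ?(ltW r0)// -mulrA mulrCA -[leRHS]mulr1 ler_wpM2l ?(ltW eta0)//.
by rewrite ler_pdivrMr ?mul1r ?lerDl// ltr_wpDl// mulr_ge0// ltW.
Qed.

(** The rank-one operators, tested in a quadratic form, determine a matrix. Applying the real
    identity to B and to i B recovers both parts of each pairing. *)
Lemma semigroup_eigen B lam t : hsadj L B = lam%:C *: B -> 0 <= t ->
  hsadj (P t) B = (expR (lam * t))%:C *: B.
Proof.
move=> LB t0; apply/eqP; rewrite -subr_eq0; apply/eqP/qform_eq0 => v.
rewrite -hsip_rank1.
have Xp := psd_rank1 v; set X := v *m _ in Xp *.
have LiB : hsadj L ('i%C *: B) = lam%:C *: ('i%C *: B).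
  by rewrite hsadjZ LB !scalerA mulrC.
have h1 := semigroup_eigen_hsre LB Xp t0.
have h2 := semigroup_eigen_hsre LiB Xp t0.
rewrite hsipDr hsadjP; last exact: (qms_linear qms t0).
rewrite -scaleN1r !hsipZr.
move: h1 h2; rewrite /hsre !hsipZr; case: (hsip (P t X) B) (hsip X B) => [a1 a2] [c1 c2] /=.
rewrite !mul0r !sub0r !mul1r => -> h2.
apply/eqP; rewrite eq_complex /=; apply/andP; split; apply/eqP; last lra.
by lra.
Qed.

Lemma hsadj_semigroup_psd rho t : 0 <= t -> psdmx rho -> psdmx (hsadj (P t) rho).
Proof.
move=> t0 rp v.
rewrite -hsip_rank1.
rewrite (hsadjP _ _ (qms_linear qms t0)); apply: psd_hsip => //.
by apply: psd_semigroup => //; exact: psd_rank1.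
Qed.

Lemma hsadj_semigroup_trace rho t : 0 <= t -> \tr (hsadj (P t) rho) = \tr rho.
Proof.
move=> t0; have trE X : \tr X = hsip 1%:M X by rewrite /hsip adjmx1 mul1mx.
by rewrite !trE (hsadjP _ _ (qms_linear qms t0)) (qms_unital qms t0).
Qed.

End MarkovFlow.

(** * The p-relative entropy *)

Section Entropy.
Variables (R : realType) (d : nat) (sigma : op R d) (p : R).
Hypothesis sigma_pd : pdmx sigma.
Hypothesis sigma_tr : \tr sigma = 1.
Hypothesis p12 : 1 < p <= 2.
Local Open Scope complex_scope.
Local Open Scope sesquilinear_scope.
Implicit Types (X Y Z rho : op R d) (s : R).

Let p1 : 1 < p. Proof. by case/andP: p12. Qed.
Let p0 : 0 < p. Proof. exact: lt_trans p1. Qed.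
Let pB1 : 0 < p - 1. Proof. by rewrite subr_gt0. Qed.
Let ppB1 : 0 < p * (p - 1). Proof. exact: mulr_gt0. Qed.

Lemma relopB X Y : relop sigma p (X - Y) = relop sigma p X - relop sigma p Y.
Proof. exact: GammaB. Qed.

Lemma relopZ z X : relop sigma p (z *: X) = z *: relop sigma p X.
Proof. exact: GammaZ. Qed.

Lemma relop_sum I (r : seq I) (P : pred I) (F : I -> op R d) :
  relop sigma p (\sum_(i <- r | P i) F i) = \sum_(i <- r | P i) relop sigma p (F i).
Proof. exact: Gamma_sum. Qed.

Lemma relop_sigma : relop sigma p sigma = mxpow sigma p^-1.
Proof. by rewrite /relop Gamma_id// conjexpV// opprB subrK. Qed.

(** Pairing with 1 is the trace, so sigma is a critical point of [Fp] among operators of fixed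
    trace. *)
Lemma gradient_sigma : gradient sigma p sigma = 1%:M.
Proof.
rewrite /gradient relop_sigma mxpowM// Gamma_mxpow// conjexpV//.
rewrite mulrBr mulVf ?gt_eqF// mulr1 addrC subrr; exact: mxpow0.
Qed.

Lemma hsre_gradient rho X :
  hsre (mxpow (relop sigma p rho) (p - 1)) (relop sigma p X) =
  hsre (gradient sigma p rho) X.
Proof. by rewrite /relop -Gamma_hsre. Qed.

Lemma hsre1 X : hsre 1%:M X = complex.Re (\tr X).
Proof. by rewrite /hsre /hsip adjmx1 mul1mx. Qed.

Lemma trpow_sigma : trpow p (relop sigma p sigma) = 1.
Proof.
rewrite trpow_mxpow relop_sigma mxpowM// mulVf ?gt_eqF// mxpow1//.
by rewrite sigma_tr.
Qed.

Lemma spec_val_le_trace Y i : psdmx Y -> spec_val Y i <= complex.Re (\tr Y).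
Proof.
move=> Yp; rewrite -[X in \tr X](@mxfun_id _ _ id _ (psd_herm Yp))// trace_mxfun /=.
rewrite (bigD1 i)//= lerDl; apply: sumr_ge0 => j _; exact: psd_spec_val.
Qed.

(** Pairing [relop] with sigma^(1 - 1/p) returns the trace of rho, which is 1. A lower bound m for
    that power of sigma thus bounds the trace of [relop], hence its spectrum, by 1/m. *)
Lemma relop_spec_bound : exists2 M, 0 < M & forall rho, density rho ->
  forall i, spec_val (relop sigma p rho) i <= M.
Proof.
have [m m0 Zm] := pd_lower (mxpow_pd sigma_pd (conjexp p)^-1).
exists m^-1; first by rewrite invr_gt0.
move=> rho [rp rtr] i.
have Yp : psdmx (relop sigma p rho) by exact: Gamma_psd.
apply: le_trans (spec_val_le_trace i Yp) _.
have := psd_hsre Zm Yp; rewrite hsreBl -scalemx1 hsreZl hsre1.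
have -> : hsre (mxpow sigma (conjexp p)^-1) (relop sigma p rho) = 1.
  rewrite /relop -Gamma_hsre// Gamma_mxpow// addNr mxpow0// hsre1 rtr.
  by [].
by rewrite subr_ge0 mulrC -ler_pdivlMr// mul1r.
Qed.

(** Strong convexity at sigma, where the linear term vanishes by [gradient_sigma]. Dividing p (p-1)
    / 2 by the normalization p (p-1) leaves the factor 1/2. *)
Lemma Fp_coercive : exists2 kappa, 0 < kappa & forall rho, density rho ->
  kappa * hsnorm (relop sigma p rho - relop sigma p sigma) ^+ 2 <= Fp sigma p rho.
Proof.
have [M M0 HM] := relop_spec_bound.
exists (2^-1 * M `^ (p - 2)); first by rewrite mulr_gt0// powR_gt0.
move=> rho rd; have [rp rtr] := rd.
have Yp : psdmx (relop sigma p rho) by exact: Gamma_psd.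
have Spd : pdmx (relop sigma p sigma) by exact: Gamma_pd.
have sd : density sigma by split; [exact: pd_psd|].
have HA i : 0 <= spec_val (relop sigma p rho) i <= M by rewrite psd_spec_val// HM.
have HB k : 0 < spec_val (relop sigma p sigma) k <= M.
  by apply/andP; split; [case: Spd|exact: HM].
have := trpow_strongly_convex p12 (psd_herm Yp) Spd.1 HA HB.
have -> : hsre (mxpow (relop sigma p sigma) (p - 1))
    (relop sigma p rho - relop sigma p sigma) = 0.
  by rewrite -relopB hsre_gradient gradient_sigma hsreBr !hsre1 rtr sigma_tr subrr.
rewrite mulr0 subr0 trpow_sigma Fp_trpow//; move: (hsnorm _ ^+ 2) (trpow _ _) => N t h.
rewrite ler_pdivlMl//; apply: le_trans h; rewrite le_eqVlt; apply/orP; left.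
by apply/eqP; ring.
Qed.

Lemma Fp_ge0 rho : density rho -> 0 <= Fp sigma p rho.
Proof.
move=> rd; have [k k0 H] := Fp_coercive; apply: le_trans (H _ rd).
by rewrite mulr_ge0 ?sqr_ge0// ltW.
Qed.

Lemma Fp_klein rho tau : psdmx rho -> pdmx tau ->
  (p - 1)^-1 * hsre (gradient sigma p tau) (rho - tau) <= Fp sigma p rho - Fp sigma p tau.
Proof.
move=> rp tp.
have Yp : psdmx (relop sigma p rho) by exact: Gamma_psd.
have Tpd : pdmx (relop sigma p tau) by exact: Gamma_pd.
have := trpow_klein p12 (psd_herm Yp) Tpd.1 (fun i => psd_spec_val i Yp) Tpd.2.
rewrite -relopB hsre_gradient !Fp_trpow//; last exact: pd_psd.
move: (hsre _ _) (trpow _ _) (trpow _ _) => u w v h.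
have -> : (p * (p - 1))^-1 * (v - 1) - (p * (p - 1))^-1 * (w - 1) =
  (p * (p - 1))^-1 * (v - w) by ring.
rewrite ler_pdivlMl//; apply: le_trans h; rewrite le_eqVlt; apply/orP; left.
by apply/eqP; field; rewrite gt_eqF.
Qed.

(** Convexity together with F(sigma) = 0. The two Klein inequalities at the mixture are averaged
    with weights 1 - e and e, and their linear terms cancel. *)
Lemma Fp_mix rho e : density rho -> 0 < e < 1 ->
  Fp sigma p ((1 - e)%:C *: rho + e%:C *: sigma) <= Fp sigma p rho.
Proof.
move=> rd /andP[e0 e1]; have [rp rtr] := rd.
set tau := _ + _.
have e1' : 0 < 1 - e by rewrite subr_gt0.
have tp : pdmx tau.
  rewrite /tau addrC; apply: pdD; first exact: pdZ.
  by apply: psdZ => //; exact: ltW.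
have h1 := Fp_klein rp tp; have h2 := Fp_klein (pd_psd sigma_pd) tp.
have Fs : Fp sigma p sigma = 0.
  by rewrite Fp_trpow ?trpow_sigma ?subrr ?mulr0//; exact: pd_psd.
have F0 := Fp_ge0 rd.
have : (1 - e) * hsre (gradient sigma p tau) (rho - tau) +
       e * hsre (gradient sigma p tau) (sigma - tau) = 0.
  rewrite !hsreBr /tau !hsreDr !hsreZr; ring.
move: h1 h2 F0; rewrite Fs.
move: (hsre _ (rho - tau)) (hsre _ (sigma - tau)) (Fp _ _ rho) (Fp _ _ tau).
move=> u v x y h1 h2 x0 uv.
have uv' : (1 - e) * ((p - 1)^-1 * u) + e * ((p - 1)^-1 * v) = 0.
  by rewrite !(mulrCA _ (p - 1)^-1) -mulrDr uv mulr0.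
have h3 := ler_wpM2l (ltW e1') h1; have h4 := ler_wpM2l (ltW e0) h2.
have h5 := mulr_ge0 (ltW e0) x0.
have h6 := lerD h3 h4; rewrite uv' in h6; lra.
Qed.

Lemma Gamma_bounded s : exists2 C, 0 < C & forall X,
  hsnorm (Gamma sigma s X) <= C * hsnorm X.
Proof.
exists (\sum_i \sum_j (2 * hsnorm (Gamma sigma s (delta_mx i j))) + 1).
  rewrite ltr_wpDl//; apply: sumr_ge0 => i _; apply: sumr_ge0 => j _.
  by rewrite mulr_ge0// hsnorm_ge0.
move=> X; rewrite mulrDl mul1r; apply: ler_wpDr; first exact: hsnorm_ge0.
apply: le_trans (hsnorm_le_entries _) _.
rewrite mulr_suml; apply: ler_sum => i _; rewrite mulr_suml; apply: ler_sum => j _.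
rewrite -hsip_delta -Gamma_hsip// mulrAC.
have := normr_Re_hsip (Gamma sigma s (delta_mx i j)) X.
have := normr_Im_hsip (Gamma sigma s (delta_mx i j)) X.
move: (hsip _ _) (hsnorm (Gamma _ _ _)) (hsnorm X) => z u v; lra.
Qed.

End Entropy.

(** * The flow and the transport cost *)

Section ExponentialPolynomials.
Variable R : realType.

Lemma is_derive_sum_fun N (f : 'I_N -> R -> R) (df : 'I_N -> R) (x : R) :
  (forall k, is_derive x 1 (f k) (df k)) ->
  is_derive x 1 (fun s => \sum_k f k s) (\sum_k df k).
Proof.
move=> fd; have -> : (fun s => \sum_k f k s) = \sum_k f k.
  by apply/funext => s; rewrite fct_sumE.
exact: is_derive_sum.
Qed.

(** Polynomial coefficients make this class closed under differentiation, which gives derivatives of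
    all orders by induction. *)
Definition exppoly N (lam : 'I_N -> R) (q : 'I_N -> {poly R}) (tau : {poly R})
    (s : R) : R := \sum_k (q k).[s] * expR (lam k * tau.[s]).

Lemma is_derive_exppoly N (lam : 'I_N -> R) q (tau : {poly R}) (s : R) :
  is_derive s 1 (exppoly lam q tau)
    (exppoly lam (fun k => (q k)^`() + lam k *: (q k * tau^`())) tau s).
Proof.
apply: is_derive_sum_fun => k.
have d1 := is_derive_horner (q k) s; have d2 := is_derive_horner tau s.
have d3 : is_derive s 1 (fun s => expR (lam k * tau.[s]))
    (lam k * expR (lam k * tau.[s]) * (tau^`()).[s]).
  exact: (is_derive1_comp (is_derive_expRM (lam k) tau.[s]) d2).
have -> : ((q k)^`() + lam k *: (q k * tau^`())).[s] * expR (lam k * tau.[s]) =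
    (q k).[s] *: (lam k * expR (lam k * tau.[s]) * (tau^`()).[s]) +
    expR (lam k * tau.[s]) *: (q k)^`().[s].
  by rewrite !hornerE /GRing.scale /=; ring.
exact: is_deriveM.
Qed.

Lemma smooth_exppoly N (lam : 'I_N -> R) q (tau : {poly R}) :
  smooth_on setT (exppoly lam q tau).
Proof.
move=> n; elim: n q => [|n IH] q x _.
  by case: (is_derive_exppoly lam q tau x).
rewrite derive1Sn.
have -> : ((exppoly lam q tau)^`())%classic =
    exppoly lam (fun k => (q k)^`() + lam k *: (q k * tau^`())) tau.
  apply/funext => s; rewrite derive1E.
  by have [_ ->] := is_derive_exppoly lam q tau s.
exact: IH.
Qed.

End ExponentialPolynomials.

Opaque psdmx.

(** * Estimates along the flow and the transport bound *)

Section Flow.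
Variables (R : realType) (d : nat) (P : R -> op R d -> op R d)
  (L : op R d -> op R d) (sigma : op R d) (J : nat) (V : 'I_J -> op R d)
  (omega : 'I_J -> R) (p alpha : R).
Local Open Scope complex_scope.
Local Open Scope sesquilinear_scope.
Hypothesis qms : quantum_markov_semigroup P.
Hypothesis gen : is_generator P L.
Hypothesis sigma_pd : pdmx sigma.
Hypothesis sigma_tr : \tr sigma = 1.
Hypothesis sigma_inv : forall t, 0 <= t -> hsadj (P t) sigma = sigma.
Hypothesis gns : GNS_detailed_balance sigma L.
Hypothesis LE : forall X, L X = \sum_(j < J)
    ((expR (- omega j / 2))%:C *: ((V j)^t* *m commutator X (V j)) +
     (expR (omega j / 2))%:C *: (commutator (V j) X *m (V j)^t*)).
Hypothesis modular : forall j,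
  sigma *m V j *m invmx sigma = (expR (- omega j))%:C *: V j.
Hypothesis p12 : 1 < p <= 2.
Hypothesis alpha0 : 0 < alpha.
Hypothesis beck : beckner sigma p L alpha.

Let p1 : 1 < p. Proof. by case/andP: p12. Qed.
Let p0 : 0 < p. Proof. exact: lt_trans p1. Qed.
Let pB1 : 0 < p - 1. Proof. by rewrite subr_gt0. Qed.

Lemma generator_linear : linear L.
Proof.
move=> a X Y; rewrite !LE scaler_sumr -big_split; apply: eq_bigr => j _ /=.
rewrite commutatorD commutatorZ.
have -> : commutator (a *: X + Y) (V j) = a *: commutator X (V j) + commutator Y (V j).
  by rewrite !commutatorE mulmxDl mulmxDr -scalemxAl -scalemxAr scalerBr opprD addrACA.
exact: lindblad_linear.
Qed.

(** Detailed balance moves L from X onto rho sigma^-1, so the adjoint is L (rho sigma^-1) sigma. *)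
Lemma hsadj_generator rho : hsadj L rho = dissipator V omega rho.
Proof.
apply: hsadj_eq => X; rewrite -(dissipator_GNS sigma_pd modular LE).
have := gns X (rho *m invmx sigma); rewrite /hsip.
move: (L (rho *m _)) (L X) => Z Y h.
have -> : \tr (X^t* *m (Z *m sigma)) = \tr (sigma *m X^t* *m Z).
  by rewrite mulmxA mxtrace_mulC mulmxA.
rewrite -h -[sigma *m _ *m _]mulmxA [RHS]mxtrace_mulC -!mulmxA.
by rewrite mulVmx ?mulmx1// pd_unit.
Qed.

Section Trajectory.
Variable rho : op R d.
Hypothesis rho_density : density rho.
Hypothesis rho_pd : pdmx rho.
Variables (N : nat) (lam : 'I_N -> R) (B : 'I_N -> op R d).
Hypothesis rhoE : rho = \sum_k B k.
Hypothesis eigenB : forall k, dissipator V omega (B k) = (lam k)%:C *: B k.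

(** The formula makes sense for every real t, but it is identified with the dual semigroup, and
    shown to be a density, only for t >= 0. *)
Definition flow (t : R) : op R d := \sum_k (expR (lam k * t))%:C *: B k.

Lemma flowE t : 0 <= t -> flow t = hsadj (P t) rho.
Proof.
move=> t0; rewrite rhoE hsadj_sum; apply: eq_bigr => k _.
by rewrite (semigroup_eigen qms gen (lam := lam k))// hsadj_generator eigenB.
Qed.

Lemma flow0 : flow 0 = rho.
Proof. by rewrite /flow rhoE; apply: eq_bigr => k _; rewrite mulr0 expR0 scale1r. Qed.

Lemma dissipator_flow t : dissipator V omega (flow t) =
  \sum_k (lam k * expR (lam k * t))%:C *: B k.
Proof.
rewrite -hsadj_generator /flow hsadj_sum; apply: eq_bigr => k _.
by rewrite hsadjZ hsadj_generator eigenB scalerA -rmorphM mulrC.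
Qed.

Lemma flow_density t : 0 <= t -> density (flow t).
Proof.
move=> t0; case: rho_density => rp rt; rewrite flowE//; split.
  exact: (hsadj_semigroup_psd qms).
by rewrite (hsadj_semigroup_trace qms).
Qed.

(** Since sigma has trace 1, sigma <= 1 and hence rho >= m >= m sigma. The dual semigroup is
    positive and fixes sigma, so the bound persists uniformly in time. *)
Lemma flow_lower : exists2 e, 0 < e & forall t, 0 <= t ->
  psdmx (flow t - e%:C *: sigma).
Proof.
have [m m0 rm] := pd_lower rho_pd; exists m; first exact: m0.
move=> t t0; have -> : flow t - m%:C *: sigma = hsadj (P t) (rho - m%:C *: sigma).
  by rewrite hsadjD -scaleNr hsadjZ sigma_inv// -flowE// scaleNr.
apply: (hsadj_semigroup_psd qms t0).
have s1 : psdmx (1%:M - sigma).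
  rewrite -(spec_proj_sum sigma) {2}(herm_spec sigma_pd.1) -sumrB.
  apply: psd_sum => i _.
  rewrite -[X in X - _]scale1r -[1]/(1%:C) -scalerBl -rmorphB; apply: psdZ.
    rewrite subr_ge0; apply: le_trans (spec_val_le_trace i (pd_psd sigma_pd)) _.
    by rewrite sigma_tr.
  exact: psd_spec_proj.
have -> : rho - m%:C *: sigma = (rho - m%:C%:M) + m%:C *: (1%:M - sigma).
  by rewrite scalerBr scalemx1 addrA subrK.
apply: psdD rm _; exact: (psdZ (ltW m0) s1).
Qed.

Lemma flow_pd t : 0 <= t -> pdmx (flow t).
Proof.
move=> t0; have [e e0 H] := flow_lower.
rewrite -[flow t](subrK (e%:C *: sigma)) addrC; apply: pdD (H t t0).
exact: pdZ.
Qed.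

Lemma flow_pdensity t : 0 <= t -> pdensity (flow t).
Proof.
by move=> t0; split; [exact: flow_density|apply: pd_unit; exact: flow_pd].
Qed.

Lemma relop_flow_lower : exists2 m, 0 < m & forall t, 0 <= t ->
  forall i, m <= spec_val (relop sigma p (flow t)) i.
Proof.
have [e e0 H] := flow_lower.
have Spd : pdmx (relop sigma p sigma) by exact: Gamma_pd.
have [m m0 Sm] := pd_lower (pdZ e0 Spd); exists m => // t t0 i.
apply: lower_spec_val.
have -> : relop sigma p (flow t) - m%:C%:M =
    relop sigma p (flow t - e%:C *: sigma) +
    (e%:C *: relop sigma p sigma - m%:C%:M).
  by rewrite relopB relopZ addrA subrK.
apply: psdD _ Sm; exact: (Gamma_psd _ _ (H t t0)).
Qed.

Definition entropy (t : R) : R := Fp sigma p (flow t).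

(** The derivative of [Fp] in the direction [B k], hence the subgradient coefficient of the entropy
    for the coordinate e^(lam_k t). *)
Definition slope (k : 'I_N) (t : R) : R :=
  (p - 1)^-1 * hsre (gradient sigma p (flow t)) (B k).

(** By [metric_dissipator], the squared length of the velocity of the flow. *)
Definition production (t : R) : R :=
  - (p - 1)^-1 * hsre (gradient sigma p (flow t)) (dissipator V omega (flow t)).

Lemma productionE t : - production t =
  \sum_k slope k t * (lam k * expR (lam k * t)).
Proof.
rewrite /production mulNr opprK dissipator_flow hsre_sumr mulr_sumr.
by apply: eq_bigr => k _; rewrite hsreZr /slope; ring.
Qed.

Lemma entropy_subgradient u v : 0 <= u -> 0 <= v ->
  \sum_k slope k u * (expR (lam k * v) - expR (lam k * u)) <= entropy v - entropy u.
Proof.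
move=> u0 v0; have [vp _] := flow_density v0.
apply: le_trans (Fp_klein sigma_pd p12 vp (flow_pd u0)).
rewrite /flow -sumrB hsre_sumr mulr_sumr le_eqVlt; apply/orP; left; apply/eqP.
apply: eq_bigr => k _; rewrite -scalerBl -rmorphB hsreZr /slope; ring.
Qed.

(** The map x^(p-1) is Lipschitz above the uniform level of [relop_flow_lower], and
    [mxfun_lipschitz] lifts this to operators. Time enters only through the exponentials. *)
Lemma slope_lipschitz : exists2 C, 0 <= C & forall k u v, 0 <= u -> 0 <= v ->
  `|slope k u - slope k v| <= C * \sum_l `|expR (lam l * u) - expR (lam l * v)|.
Proof.
have [m m0 Hm] := relop_flow_lower.
pose b := \sum_k hsnorm (relop sigma p (B k)).
have bk k : hsnorm (relop sigma p (B k)) <= b.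
  rewrite /b (bigD1 k)//= lerDl; apply: sumr_ge0 => l _; exact: hsnorm_ge0.
have b0 : 0 <= b by apply: sumr_ge0 => l _; exact: hsnorm_ge0.
have [l lE] : exists l : R, l = (p - 1) * m `^ (p - 1 - 1) by eexists.
have l0 : 0 <= l by rewrite lE mulr_ge0 ?powR_ge0// ltW.
exists ((p - 1)^-1 * l * b * b) => [|k u v u0 v0].
  by do 3![apply: mulr_ge0 => //]; rewrite invr_ge0 ltW.
have Yh t : 0 <= t -> (relop sigma p (flow t))^t* = relop sigma p (flow t).
  by move=> t0; apply: psd_herm; apply: Gamma_psd => //; exact/pd_psd/flow_pd.
have q01 : 0 <= p - 1 <= 1 by case/andP: p12 => ? ?; apply/andP; split; lra.
have hl x y : m <= x -> m <= y -> `|x `^ (p - 1) - y `^ (p - 1)| <= l * `|x - y|.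
  by move=> mx my; rewrite lE; exact: powR_lipschitz.
have lip := @mxfun_lipschitz R d (fun x => x `^ (p - 1)) _ _ l l0 (Yh u u0) (Yh v v0)
  (fun i j => hl _ _ (Hm u u0 i) (Hm v v0 j)).
rewrite -/(mxpow _ _) -/(mxpow _ _) -relopB in lip.
have Yuv : hsnorm (relop sigma p (flow u - flow v)) <=
    b * \sum_l `|expR (lam l * u) - expR (lam l * v)|.
  rewrite /flow -sumrB relop_sum; apply: le_trans (hsnorm_sum _ _ _) _.
  rewrite mulr_sumr; apply: ler_sum => i _.
  by rewrite -scalerBl -rmorphB relopZ hsnormZ mulrC ler_wpM2r.
have i0 : 0 <= (p - 1)^-1 by rewrite invr_ge0 ltW.
have E t : slope k t = (p - 1)^-1 *
    hsre (mxpow (relop sigma p (flow t)) (p - 1)) (relop sigma p (B k)).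
  by rewrite hsre_gradient.
move: lip Yuv (E u) (E v) (bk k).
move: (mxpow (relop sigma p (flow u)) _) (mxpow (relop sigma p (flow v)) _) => Zu Zv.
move: (relop sigma p (flow u - _)) (relop sigma p (B k)) => Yuv Bk lip HY -> -> HB.
rewrite -mulrBr -hsreBl normrM (ger0_norm i0).
rewrite -!mulrA ler_wpM2l//.
apply: le_trans (normr_hsre_le _ _) _.
have S0 : 0 <= \sum_l `|expR (lam l * u) - expR (lam l * v)| by apply: sumr_ge0.
apply: (@le_trans _ _ (l * (b * \sum_l0 `|expR (lam l0 * u) - expR (lam l0 * v)|) * b)).
  apply: ler_pM; rewrite ?hsnorm_ge0//.
  by apply: le_trans lip _; rewrite ler_wpM2l.
by rewrite le_eqVlt; apply/orP; left; apply/eqP; ring.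
Qed.

Let exp_dist t u : R := \sum_l `|expR (lam l * t) - expR (lam l * u)|.

Lemma exp_dist_continuous t : {for t, continuous (exp_dist t)}.
Proof.
apply: sum_continuous => l; apply: cvg_norm; apply: cvgB; first exact: cvg_cst.
exact: is_derive_continuous (is_derive_expRM (lam l) t).
Qed.

Lemma exp_dist_small t eps : 0 < eps ->
  exists2 del, 0 < del & forall u, `|t - u| < del -> exp_dist t u < eps.
Proof.
move=> e0; have := @exp_dist_continuous t; rewrite /prop_for /continuous_at.
move=> /cvgrPdist_lt/(_ _ e0)[del /= del0 H]; exists del => // u tu.
have -> : exp_dist t u = `|exp_dist t t - exp_dist t u|.
  have -> : exp_dist t t = 0 by rewrite /exp_dist big1// => l _; rewrite subrr normr0.
  by rewrite sub0r normrN ger0_norm//; apply: sumr_ge0.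
exact: H.
Qed.

Lemma slope_continuous k t : 0 < t -> {for t, continuous (slope k)}.
Proof.
move=> t0; have [C C0 HC] := slope_lipschitz.
rewrite /prop_for /continuous_at; apply/cvgrPdist_le => e e0.
have C1 : 0 < C + 1 by lra.
have [del del0 H] := exp_dist_small t (divr_gt0 e0 C1).
near=> z.
have z0 : 0 < z by near: z; exact: lt_nbhsr.
have tz : `|t - z| < del by near: z; exists del.
apply: le_trans (HC k t z (ltW t0) (ltW z0)) _.
have := H z tz; rewrite ltr_pdivlMr// -/(exp_dist t z) => h.
have s0 : 0 <= exp_dist t z by apply: sumr_ge0.
by rewrite mulrC; apply: le_trans (ltW h); rewrite ler_wpM2l// lerDl.
Unshelve. all: by end_near. Qed.

Lemma is_derive_entropy (t : R) : 0 < t -> is_derive t 1 entropy (- production t).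
Proof.
move=> t0; rewrite productionE.
apply: (@is_derive_subgradient _ _ (fun k v => expR (lam k * v))
  (fun k v => lam k * expR (lam k * v)) slope) => //.
- by move=> k; exact: is_derive_expRM.
- by move=> k; exact: slope_continuous.
- exact: entropy_subgradient.
Qed.

Lemma production_continuous t : 0 < t -> {for t, continuous production}.
Proof.
move=> t0.
have -> : production = fun t => \sum_k slope k t * (- (lam k * expR (lam k * t))).
  apply/funext => u; rewrite -[LHS]opprK productionE -sumrN.
  by apply: eq_bigr => k _; rewrite mulrN.
apply: sum_continuous => k; apply: cvgM; first exact: slope_continuous.
apply: cvgN; apply: cvgM; first exact: cvg_cst.
exact: is_derive_continuous (is_derive_expRM (lam k) t).
Qed.

Lemma production_ge t : 0 <= t -> 4 * alpha * entropy t <= production t.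
Proof.
move=> t0; have := beck (flow_pdensity t0).
rewrite (Ep_dissipator sigma_pd p12 modular LE) -/(entropy t) /production /conjexp.
move: (hsre _ _) (entropy t) => u v h.
(* The prefactor of [Ep] divided by p^2 is 1 / (4 (p - 1)), whence the factor 4. *)
have -> : - (p - 1)^-1 * u = 4 * (p ^- 2 * (- (p / (p - 1) * p / 4) * u)).
  by field; rewrite !gt_eqF.
by rewrite -mulrA ler_wpM2l.
Qed.

Lemma entropy_ge0 t : 0 <= t -> 0 <= entropy t.
Proof. by move=> t0; apply: Fp_ge0 => //; exact: flow_density. Qed.

Lemma production_ge0 t : 0 <= t -> 0 <= production t.
Proof.
move=> t0; apply: le_trans (production_ge t0).
by rewrite mulr_ge0 ?entropy_ge0// mulr_ge0// ltW.
Qed.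

(** The entropy is differentiated only at positive times, so the curve must start after 0. The
    subgradient inequality taken at a and tested at 0 controls the entropy at a. *)
Lemma flow_start eta : 0 < eta -> exists2 a, 0 < a <= 1 &
  entropy a <= entropy 0 + eta /\ hsnorm (flow a - rho) < eta.
Proof.
move=> eta0; have [C C0 HC] := slope_lipschitz.
(* Bounds the slopes at time a, once the exponentials have moved by at most 1. *)
pose K := \sum_k (`|slope k 0| + C); pose b := \sum_k hsnorm (B k).
have K0 : 0 <= K by apply: sumr_ge0 => k _; rewrite addr_ge0.
have b0 : 0 <= b by apply: sumr_ge0 => k _; exact: hsnorm_ge0.
pose eps := Num.min 1 (eta / (K + b + 1)).
have Kb : 0 < K + b + 1 by lra.
have eps0 : 0 < eps by rewrite lt_min ltr01/= divr_gt0.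
have [del del0 H] := exp_dist_small 0 eps0.
pose a := Num.min 1 (del / 2).
have a0 : 0 < a by rewrite lt_min ltr01/= divr_gt0.
have a1 : a <= 1 by rewrite ge_min lexx.
have ad : a < del by rewrite gt_min ltr_pdivrMr// ltr_pMr// ltr1n orbT.
exists a; first by rewrite a0.
have := H a; rewrite sub0r normrN gtr0_norm// => /(_ ad).
rewrite lt_min => /andP[S1 S2].
have S0 : 0 <= exp_dist 0 a by apply: sumr_ge0.
have ek k : `|expR (lam k * 0) - expR (lam k * a)| <= exp_dist 0 a.
  by rewrite /exp_dist (bigD1 k)//= lerDl; apply: sumr_ge0.
have KS : K * exp_dist 0 a + b * exp_dist 0 a < eta.
  rewrite -mulrDl mulrC; move: S2; rewrite ltr_pdivlMr//; nra.
split.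
  have h := entropy_subgradient (ltW a0) (lexx 0).
  have hK : - (K * exp_dist 0 a) <=
      \sum_k slope k a * (expR (lam k * 0) - expR (lam k * a)).
    rewrite lerNl -sumrN mulr_suml; apply: ler_sum => k _.
    apply: le_trans (ler_norm _) _; rewrite normrN normrM; apply: ler_pM => //.
    have := HC k a 0 (ltW a0) (lexx 0).
    have -> : \sum_l `|expR (lam l * a) - expR (lam l * 0)| = exp_dist 0 a.
      by apply: eq_bigr => l _; rewrite distrC.
    have := ler_dist_dist (slope k a) (slope k 0).
    have : C * exp_dist 0 a <= C by rewrite ler_piMr// ltW.
    rewrite ler_norml => h1 /andP[_ h2] hk.
    by rewrite -lerBlDl (le_trans h2)// (le_trans hk).
  have {h} := le_trans hK h; have := mulr_ge0 b0 S0; move: KS.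
  by move: (K * _) (b * _) (entropy a) (entropy 0) => *; lra.
rewrite -flow0 /flow -sumrB; apply: le_lt_trans (hsnorm_sum _ _ _) _.
apply: (@le_lt_trans _ _ (b * exp_dist 0 a)).
  rewrite mulr_suml; apply: ler_sum => k _; rewrite -scalerBl -rmorphB hsnormZ mulrC.
  by rewrite ler_wpM2l ?hsnorm_ge0// distrC.
by have := mulr_ge0 K0 S0; lra.
Qed.

(** Gronwall: e^(4 alpha s) F(s) has nonpositive derivative. Time 1 stands for a starting point
    inside the domain of differentiability. *)
Lemma entropy_decay t : 1 <= t ->
  entropy t <= expR (- (4 * alpha * (t - 1))) * entropy 1.
Proof.
move=> t1.
pose f s := expR (4 * alpha * s) * entropy s.
have fd (s : R) : 0 < s -> is_derive s 1 f
    (expR (4 * alpha * s) * (4 * alpha * entropy s - production s)).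
  move=> s0; have d1 := is_derive_entropy s0; have d2 := is_derive_expRM (4 * alpha) s.
  have -> : expR (4 * alpha * s) * (4 * alpha * entropy s - production s) =
     expR (4 * alpha * s) *: - production s +
     entropy s *: (4 * alpha * expR (4 * alpha * s)).
    by rewrite /GRing.scale /=; ring.
  exact: is_deriveM.
have [|c /andP[c1 ct] E] := @MVT_le _ f
    (fun s => expR (4 * alpha * s) * (4 * alpha * entropy s - production s)) 1 t t1.
  by move=> s /andP[s1 _]; apply: fd; exact: lt_le_trans s1.
have c0 : 0 <= c by exact: le_trans c1.
have : f t <= f 1.
  rewrite -subr_le0 E /= mulr_le0_ge0 ?subr_ge0// mulr_ge0_le0 ?expR_ge0//.
  by rewrite subr_le0 production_ge.
rewrite /f => h.
rewrite -(@ler_pM2l _ (expR (4 * alpha * t))) ?expR_gt0//.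
apply: le_trans h _; rewrite [leRHS]mulrA -expRD le_eqVlt; apply/orP; left; apply/eqP.
by congr (expR _ * _); ring.
Qed.

Lemma flow_limit eta : 0 < eta -> exists2 T, 1 <= T & forall t, T <= t ->
  hsnorm (flow t - sigma) < eta.
Proof.
move=> eta0.
have [k k0 Hk] := Fp_coercive sigma_pd sigma_tr p12.
have [C C0 HC] := Gamma_bounded sigma (conjexp p)^-1.
have E10 : 0 <= entropy 1 by exact: entropy_ge0.
(* From e^(-y) (1 + y) <= 1, waiting until 4 alpha (t - 1) >= x gives (C n)^2 (1 + x) <= x eta^2 for
   n the norm of the weighted difference; hence C n < eta. *)
pose x := entropy 1 * C ^+ 2 / (k * eta ^+ 2).
have x0 : 0 <= x by apply: divr_ge0; apply: mulr_ge0 => //; rewrite ?sqr_ge0 ?(ltW k0).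
have a4 : 0 < 4 * alpha by rewrite mulr_gt0.
exists (1 + x / (4 * alpha)) => [|t Tt]; first by rewrite lerDl divr_ge0// ltW.
have t1 : 1 <= t by apply: le_trans Tt; rewrite lerDl divr_ge0// ltW.
have xt : x <= 4 * alpha * (t - 1).
  by rewrite mulrC -ler_pdivrMr//; lra.
have t0 : 0 <= t by exact: le_trans t1.
have h1 := Hk _ (flow_density t0); rewrite -relopB in h1.
have h2 := le_trans h1 (entropy_decay t1).
have -> : flow t - sigma = Gamma sigma (conjexp p)^-1 (relop sigma p (flow t - sigma)).
  by rewrite relopK.
apply: le_lt_trans (HC _) _; move: h2.
move: (hsnorm _) (hsnorm_ge0 (relop sigma p (flow t - sigma))) => n n0 h2.
have h3 : expR (- (4 * alpha * (t - 1))) * (1 + x) <= 1.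
  rewrite expRN mulrC ler_pdivrMr ?expR_gt0// mul1r.
  by apply: le_trans (expR_ge1Dx _); rewrite lerD2l.
have h4 : k * n ^+ 2 * (1 + x) <= entropy 1.
  apply: le_trans (_ : expR (- (4 * alpha * (t - 1))) * entropy 1 * (1 + x) <= _).
    by rewrite ler_wpM2r// addr_ge0.
  move: E10 h3; move: (expR _) (entropy 1) (1 + x) => u v w v0 h3.
  by rewrite mulrAC ler_piMl.
have E : entropy 1 = x * (k * eta ^+ 2) / C ^+ 2.
  by rewrite /x; field; rewrite !gt_eqF.
have h5 : k * ((C * n) ^+ 2 * (1 + x)) <= k * (x * eta ^+ 2).
  have := ler_wpM2r (sqr_ge0 C) h4; rewrite E divfK ?gt_eqF ?exprn_gt0//.
  by rewrite exprMn; lra.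
move: h5; rewrite ler_pM2l// => h5.
rewrite -(@ltr_pXn2r _ 2) ?nnegrE ?mulr_ge0// ?(ltW C0)// ?(ltW eta0)//.
have eta20 : 0 < eta ^+ 2 by rewrite exprn_gt0.
rewrite -(@ltr_pM2r _ (1 + x)); last lra.
by apply: le_lt_trans h5 _; nra.
Qed.

Lemma flow_entry_Re (tau : {poly R}) i j :
  (fun s => complex.Re (flow tau.[s] i j)) =
  exppoly lam (fun k => (complex.Re (B k i j))%:P) tau.
Proof.
apply/funext => s; rewrite /flow summxE Re_sum; apply: eq_bigr => k _.
by rewrite mxE ReZ hornerC mulrC.
Qed.

Lemma flow_entry_Im (tau : {poly R}) i j :
  (fun s => complex.Im (flow tau.[s] i j)) =
  exppoly lam (fun k => (complex.Im (B k i j))%:P) tau.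
Proof.
apply/funext => s; rewrite /flow summxE Im_sum; apply: eq_bigr => k _.
by rewrite mxE ImZ hornerC mulrC.
Qed.

Lemma deriv_mx_flow (tau : {poly R}) s :
  deriv_mx (fun s => flow tau.[s]) s =
  ((deriv tau).[s])%:C *: dissipator V omega (flow tau.[s]).
Proof.
apply/matrixP => i j; rewrite dissipator_flow !mxE summxE.
rewrite flow_entry_Re flow_entry_Im !derive1E.
have [_ ->] := is_derive_exppoly lam (fun k => (complex.Re (B k i j))%:P) tau s.
have [_ ->] := is_derive_exppoly lam (fun k => (complex.Im (B k i j))%:P) tau s.
apply/eqP; rewrite eq_complex; apply/andP; split; apply/eqP.
  rewrite ReZ Re_sum mulr_sumr; apply: eq_bigr => k _.
  rewrite [in RHS]mxE ReZ derivC add0r hornerZ hornerM hornerC; ring.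
rewrite ImZ Im_sum mulr_sumr; apply: eq_bigr => k _.
by rewrite [in RHS]mxE ImZ derivC add0r hornerZ hornerM hornerC; ring.
Qed.

Lemma W2p_flow_le (tau : {poly R}) C : 0 <= C ->
  (forall s, 0 <= s <= 1 ->
     0 < tau.[s] /\ (deriv tau).[s] ^+ 2 * production tau.[s] <= C) ->
  W2p sigma p V omega (flow tau.[0]) (flow tau.[1]) <= Num.sqrt C.
Proof.
move=> C0 H; rewrite /W2p ler_wsqrtr//.
have adm : admissible_curve (flow tau.[0]) (flow tau.[1]) (fun s => flow tau.[s]).
  split=> // [s /H[s0 _]|]; first exact/flow_pdensity/ltW.
  exists setT; first by split; [exact: openT|exact: subsetT].
  by move=> i j; rewrite flow_entry_Re flow_entry_Im; split; exact: smooth_exppoly.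
have E : (energy sigma p V omega (fun s => flow tau.[s]) <= C%:E)%E.
  rewrite /energy.
  have -> : C%:E = (\int[lebesgue_measure]_(s in `[0%R, 1%R]) (cst C%:E) s)%E.
    rewrite integral_cst//= lebesgue_measure_itv/= lte_fin ltr01 oppr0 adde0.
    by rewrite mule1.
  have ME s : 0 <= s <= 1 -> metric sigma p V omega (flow tau.[s])
      (deriv_mx (fun s => flow tau.[s]) s) (deriv_mx (fun s => flow tau.[s]) s) =
      (deriv tau).[s] ^+ 2 * production tau.[s].
    move=> /H[/ltW s0 _]; rewrite deriv_mx_flow metric_dissipator//.
    - exact: flow_density.
    - exact: flow_pd.
  have mE : measurable_fun (`[0, 1] : set R)
      (fun s : R => metric sigma p V omega (flow tau.[s])
      (deriv_mx (fun s => flow tau.[s]) s) (deriv_mx (fun s => flow tau.[s]) s)).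
    apply: (eq_measurable_fun (fun s => (deriv tau).[s] ^+ 2 * production tau.[s])).
      by move=> s; rewrite inE/= in_itv/= => s01; rewrite ME.
    apply: measurable_realfun.subspace_continuous_measurable_fun => //.
    apply: continuous_in_subspaceT => s; rewrite inE/= in_itv/= => /H[s0 _].
    have c1 := is_derive_continuous (is_derive_horner tau s).
    have c2 := is_derive_continuous (is_derive_horner (deriv tau) s).
    have c3 : {for s, continuous (fun s => production tau.[s])}.
      apply: continuous_comp c1 _; exact: production_continuous.
    apply: cvgM c3; apply: (cvgM c2 c2).
  apply: ge0_le_integral => //=.
  - move=> s; rewrite in_itv/= => s01; rewrite ME// lee_fin mulr_ge0 ?sqr_ge0//.
    by apply: production_ge0; case: (H s s01) => /ltW.
  - exact/measurable_realfun.measurable_EFinP.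
  - move=> s; rewrite in_itv/= => s01; rewrite ME// lee_fin.
    by case: (H s s01).
set A := [set _ | _ in _]%classic.
have : (ereal_inf A <= C%:E)%E.
  by apply: le_trans E; apply: ereal_inf_lbound; eexists; [exact: adm|].
(* The value -oo is sent to 0 by [fine], where 0 <= C is needed. *)
by case: (ereal_inf A) => //= x; rewrite lee_fin.
Qed.

Lemma sqrtrD_le (x y : R) : 0 <= x -> 0 <= y ->
  Num.sqrt (x + y) <= Num.sqrt x + Num.sqrt y.
Proof.
move=> x0 y0; rewrite -ler_sqr ?nnegrE ?addr_ge0 ?sqrtr_ge0//.
rewrite sqrrD !sqr_sqrtr ?addr_ge0// addrAC lerDl.
by rewrite mulrn_wge0// mulr_ge0 ?sqrtr_ge0.
Qed.

Lemma transport_cost_pd (W : op R d -> op R d -> R) :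
  continuous_extension_W2p sigma p V omega W ->
  W rho sigma <= Num.sqrt (Fp sigma p rho / alpha).
Proof.
move=> [WE Wc]; apply/ler_addgt0Pr => e e0.
have sd : density sigma by split; [exact: pd_psd|].
have e20 : 0 < e / 2 by rewrite divr_gt0.
have [del del0 Hdel] := Wc _ _ rho_density sd _ e20.
(* Three errors of size z occur under the square root: the entropy at a, the positive perturbation
   and the reparametrization. Together they cost at most e / 2 outside it; continuity of W costs the
   other half. *)
have [z [z0 zE]] : exists z : R, 0 < z /\ z = (e / 2) ^+ 2 / 3.
  by eexists; split; [|reflexivity]; rewrite divr_gt0 ?exprn_gt0.
have az0 : 0 < alpha * z by rewrite mulr_gt0.
have m0 : 0 < Num.min del (alpha * z) by rewrite lt_min del0.
have [a /andP[a0 _] []] := flow_start m0.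
rewrite lt_min => Ea /andP[Da _].
have {}Ea : entropy a <= Fp sigma p rho + alpha * z.
  have E0 : entropy 0 = Fp sigma p rho by rewrite /entropy flow0.
  by rewrite -E0; apply: le_trans Ea _; rewrite lerD2l ge_min lexx orbT.
have [T T1 HT] := flow_limit del0.
(* The added exponential satisfies the decay inequality with equality, so it keeps [hPhi] true while
   making [Phi] strictly positive even if the flow rests at sigma. *)
pose Phi t := entropy t + alpha * z * expR (- (4 * alpha) * t).
pose h t := production t + alpha * z * (4 * alpha * expR (- (4 * alpha) * t)).
have a4 : 0 < 4 * alpha by rewrite mulr_gt0.
(* The time change may fall short of its end by z, so it still passes T. *)
have aT : a < a + T + z by rewrite -addrA ltrDl; lra.
have dPhi (t : R) : 0 < t -> is_derive t 1 Phi (- h t).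
  move=> t0.
  have d1 := is_derive_entropy t0; have d2 := is_derive_expRM (- (4 * alpha)) t.
  have d3 := is_deriveZ (alpha * z) d2.
  have -> : - h t = - production t +
      alpha * z *: (- (4 * alpha) * expR (- (4 * alpha) * t)).
    by rewrite /h /GRing.scale /=; ring.
  exact: is_deriveD d1 d3.
have ch t : 0 < t -> {for t, continuous h}.
  move=> t0; apply: cvgD; first exact: production_continuous.
  apply: cvgM; first exact: cvg_cst.
  apply: cvgM; first exact: cvg_cst.
  exact: is_derive_continuous (is_derive_expRM (- (4 * alpha)) t).
have xp t : 0 < alpha * z * expR (- (4 * alpha) * t) by rewrite mulr_gt0 ?expR_gt0.
have Phi0 t : 0 < t -> 0 < Phi t.
  by move=> t0; rewrite ltr_wpDl// entropy_ge0// ltW.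
have hPhi t : 0 < t -> 4 * alpha * Phi t <= h t.
  move=> t0; rewrite /Phi /h mulrDr lerD ?production_ge ?(ltW t0)//.
  by rewrite le_eqVlt; apply/orP; left; apply/eqP; ring.
have [tau [tau0 tau1 Htau]] :=
  constant_rate_reparametrization alpha0 a0 aT z0 dPhi ch Phi0 hPhi.
have PhiC : Phi a / alpha + z <= Fp sigma p rho / alpha + (e / 2) ^+ 2.
  have -> : (e / 2) ^+ 2 = z + z + z by rewrite zE; field.
  have x1 : expR (- (4 * alpha) * a) <= 1.
    by rewrite -[leRHS]expR0 ler_expR mulNr oppr_le0; apply: mulr_ge0; exact: ltW.
  have : Phi a <= Fp sigma p rho + alpha * z + alpha * z.
    by rewrite /Phi lerD// ler_piMr// ltW.
  move: (Phi a) (Fp sigma p rho) => u v uv.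
  have -> : v / alpha + (z + z + z) = (v + alpha * z + alpha * z) / alpha + z.
    by field; rewrite gt_eqF.
  by rewrite lerD2r ler_pM2r ?invr_gt0.
have F0 : 0 <= Fp sigma p rho / alpha by rewrite divr_ge0 ?(ltW alpha0)// Fp_ge0.
have C0 : 0 <= Phi a / alpha + z.
  by rewrite addr_ge0 ?(ltW z0)// divr_ge0 ?(ltW alpha0)// ltW// Phi0.
have s01 : 0 <= (1 : R) <= 1 by rewrite ler01 lexx.
have [t10 _] := Htau _ s01.
have Wle : W (flow a) (flow tau.[1]) <= Num.sqrt (Phi a / alpha + z).
  rewrite WE; [|exact/flow_pdensity/ltW|exact/flow_pdensity/ltW].
  rewrite -tau0; apply: W2p_flow_le => [//|s /Htau[s0 hs]]; first by rewrite tau0.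
  split=> //; rewrite tau0; apply: le_trans hs; rewrite ler_wpM2l ?sqr_ge0//.
  rewrite /h lerDl mulr_ge0 ?(ltW az0)// mulr_ge0 ?expR_ge0//; exact: ltW.
have Tt : T <= tau.[1] by apply: le_trans tau1; lra.
have := Hdel _ _ (flow_density (ltW a0)) (flow_density (ltW t10)) Da (HT _ Tt).
rewrite ltr_norml => /andP[h1 _].
have h2 : Num.sqrt (Phi a / alpha + z) <= Num.sqrt (Fp sigma p rho / alpha) + e / 2.
  apply: le_trans (ler_wsqrtr PhiC) _; apply: le_trans (sqrtrD_le F0 (sqr_ge0 _)) _.
  by rewrite sqrtr_sqr gtr0_norm.
move: h1 h2 Wle; move: (W _ _) (W _ _) (Num.sqrt _) (Num.sqrt _) => u v x y h1 h2 h3.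
lra.
Qed.

End Trajectory.

(** A singular rho is approached by full-rank mixtures with sigma: [Fp_mix] controls their entropy
    and continuity of W the left side. *)
Lemma transport_cost (W : op R d -> op R d -> R) rho :
  continuous_extension_W2p sigma p V omega W -> density rho ->
  W rho sigma <= Num.sqrt (Fp sigma p rho / alpha).
Proof.
move=> Wext rd; have [_ Wc] := Wext; apply/ler_addgt0Pr => e e0.
have sd : density sigma by split; [exact: pd_psd|].
have [del del0 Hdel] := Wc _ _ rd sd _ e0.
pose N := hsnorm (sigma - rho).
have N0 : 0 <= N by exact: hsnorm_ge0.
(* The mixture moves rho by r N; N + 1 in the denominator gives r N < del also when N = 0. *)
pose r := Num.min (1 / 2) (del / (N + 1)).
have N1 : 0 < N + 1 by lra.
have r0 : 0 < r by rewrite lt_min !divr_gt0.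
have r1 : r < 1.
  by apply: le_lt_trans (_ : 1 / 2 < 1); [rewrite ge_min lexx|lra].
have rN : r * N < del.
  have : r <= del / (N + 1) by rewrite ge_min lexx orbT.
  by rewrite ler_pdivlMr//; nra.
pose tau := (1 - r)%:C *: rho + r%:C *: sigma.
have r1' : 0 < 1 - r by rewrite subr_gt0.
have tp : pdmx tau.
  rewrite /tau addrC; apply: pdD; first exact: pdZ.
  by apply: psdZ; [exact: ltW|case: rd].
have td : density tau.
  split; first exact: pd_psd.
  rewrite /tau raddfD /= !mxtraceZ sigma_tr rd.2 !mulr1 -rmorphD.
  by rewrite subrK.
have [N' [lam [B [tauE eigenB]]]] := GNS_decomposition sigma_pd generator_linear gns
  (fun X => esym (dissipator_GNS sigma_pd modular LE X)) tau.
have h1 := transport_cost_pd td tp tauE eigenB Wext.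
have h2 : Num.sqrt (Fp sigma p tau / alpha) <= Num.sqrt (Fp sigma p rho / alpha).
  have r01 : 0 < r < 1 by rewrite r0.
  have := Fp_mix sigma_pd sigma_tr p12 rd r01; rewrite -/tau.
  move: (Fp sigma p tau) (Fp sigma p rho) => x y xy.
  by apply: ler_wsqrtr; rewrite ler_pM2r ?invr_gt0.
have D : hsnorm (tau - rho) < del.
  have -> : tau - rho = r%:C *: (sigma - rho).
    rewrite /tau rmorphB scalerBl scale1r scalerBr; move: (r%:C *: rho) (r%:C *: sigma).
    by move=> A C; rewrite addrAC [rho - A - rho]addrAC subrr sub0r addrC.
  by rewrite hsnormZ gtr0_norm.
have := Hdel _ _ td sd D; rewrite subrr hsnorm0 => /(_ del0).
rewrite ltr_norml => /andP[/ltW h3 _].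
apply: le_trans (lerD (le_trans h1 h2) (lexx e)).
by move: h3; rewrite lerBrDr addrC lerBlDr.
Qed.

End Flow.

Unset Implicit Arguments.
Set Strict Implicit.
Set Printing Implicit Defensive.

Theorem proposition4p20 (R : realType) (d : nat)
    (P : R -> op R d -> op R d) (L : op R d -> op R d) (sigma : op R d)
    (J : nat) (V : 'I_J -> op R d) (omega : 'I_J -> R)
    (p alpha : R) (W : op R d -> op R d -> R) :
  quantum_markov_semigroup P ->
  is_generator P L ->
  primitive P sigma ->
  GNS_detailed_balance sigma L ->
  alicki_form sigma L V omega ->
  1 < p <= 2 ->
  0 < alpha ->
  beckner sigma p L alpha ->
  continuous_extension_W2p sigma p V omega W ->
  forall c : R, alpha^-1 <= c ->
  forall rho : op R d, density rho ->
    W rho sigma <= Num.sqrt (c * Fp sigma p rho).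
Proof.
move=> qms gen [[sd sinv] su _] gns [LE modular _ _ _] p12 alpha0 beck Wext c ac rho rd.
have sigma_pd : pdmx sigma by apply: psd_unit_pd => //; case: sd.
apply: le_trans (transport_cost qms gen sigma_pd sd.2 sinv gns LE modular p12
  alpha0 beck Wext rd) _.
(* Enlarging 1 / alpha to c is legitimate because F >= 0. *)
by rewrite ler_wsqrtr// mulrC ler_wpM2r// Fp_ge0// sd.2.
Qed.
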